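(* Let $\{Z_x^{\mathcal S}\}_{x\in\mathcal X}$ be a zero mean Gaussian field with variance-covariance matrix $\Sigma^{\mathcal S}=(-Q\circ\mathcal S)^{-1}$, and let $A\subset\mathcal X$ be finite. Then $$\mathbf E\left[Z_b^{\mathcal S}\mid Z_a^{\mathcal S},\ a\in A\right]=\sum_{a\in A}\mathbf E_b\left[1_{\{X_{R_A}=a\}}H_{R_A}\right]Z_a^{\mathcal S}\qquad\text{for all } b\in\mathcal X\setminus A,$$ and $$\mathrm{Cov}\left(Z_b^{\mathcal S},Z_{b'}^{\mathcal S}\mid Z_a^{\mathcal S},\ a\in A\right)=\mathbf E_b\left[\int_0^\infty 1_{\{X_s=b'\}}H_s1_{\{s<R_A\}}\,ds\right]\qquad\text{for all } b,b'\in\mathcal X\setminus A.$$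
   Context: **Generator.** $\mathcal X$ is a countable (finite or countably infinite) set and $Q=((q_{xy}))_{x,y\in\mathcal X}$ is a symmetric real matrix with $q_{xy}=q_{yx}\ge 0$ for $x\ne y$, $q_{xx}<0$, and $\sum_{y\in\mathcal X}q_{xy}\le 0$ for every $x$. It is assumed that either (i) $Q$ is irreducible and $\sum_{y}q_{xy}<0$ for at least one $x\in\mathcal X$, or (ii) $\sum_y q_{xy}<0$ for every $x\in\mathcal X$. Let $p_{xy}=-q_{xy}/q_{xx}$ for $x\neq y$, $p_{xx}=0$, $P=((p_{xy}))$, and let $Q^{diag}$ be the diagonal matrix with the same diagonal as $Q$, so $Q=Q^{diag}(I-P)$. Under these assumptions every entry of $\sum_{n\ge0}P^n$ is finite. **Process.** $\mathbb X=\{X_t\}_{t\ge0}$ is the continuous-time Markov process on $\mathcal X\cup\{\Delta\}$ with generator $Q$, where $\Delta\notin\mathcal X$ is an absorbing ''cemetery''. It is described by its embedded jump chain $Y_0,Y_1,\dots$ with transition probabilities $p_{xy}$ on $\mathcal X$ and probability $p(x,\Delta)=1-\sum_{y\in\mathcal X}p_{xy}$ of jumping from $x$ to $\Delta$, and its jump times $0=S_0<S_1<S_2<\cdots$: $X_t=Y_n$ on $[S_n,S_{n+1})$, and conditionally on the jump chain the holding times $S_{i+1}-S_i$ in the states $Y_i\in\mathcal X$ are independent, exponential with rate $-q_{Y_iY_i}$. After a jump to $\Delta$ (or after an accumulation point of the jump times, if any) the process is in no state of $\mathcal X$. $\mathbf P_x,\mathbf E_x$ denote probability and expectation for the process started at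 $Y_0=x$. **Signs.** $\mathcal S$ is a matrix indexed by $\mathcal X\times\mathcal X$ with $\mathcal S(x,x)=1$, $\mathcal S(x,y)=\mathcal S(y,x)\in\{-1,1\}$ for all $x\ne y$. A transition from $x$ to $y$ is negative if $\mathcal S(x,y)=-1$ and positive otherwise; transitions to $\Delta$ are positive. The sign process is $H_t=\prod_{i\ge1:\,S_i\le t}\mathcal S(Y_{i-1},Y_i)$ (with $H_0=1$ and $\mathcal S(\cdot,\Delta)=1$), i.e. $H_t=1$ or $-1$ according to whether the number of negative transitions up to time $t$ is even or odd. **Hitting time.** $R_A=\inf\{t\ge S_1: X_t\in A\}$ is the first time greater than or equal to the first jump time $S_1$ at which $\mathbb X$ is in $A$ ($R_A=\infty$ if there is none, in which case $1_{\{X_{R_A}=a\}}=0$). **Inverses.** $\circ$ is the entrywise (Hadamard) product. If $\tilde Q=\tilde R(I-\tilde P)$ with $\tilde R$ diagonal with negative entries and $|\tilde P|$ (entrywise absolute value) a sub-Markov matrix such that all entries of $\sum_{n\ge0}|\tilde P|^n$ are finite, define $\tilde Q^{-1}=\left(\sum_{n\ge0}\tilde P^n\right)\tilde R^{-1}$ and $(-\tilde Q)^{-1}=-\tilde Q^{-1}$. This applies to $Q\circ\mathcal S=Q^{diag}(I-P\circ\mathcal S)$. An infinite matrix is called positive definite if all its finite principal submatrices are; $\Sigma^{\mathcal S}$ is symmetric and positive definite in this sense. *)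

(* Defs.v *)
From mathcomp Require Export all_boot all_order all_algebra finmap.
From mathcomp Require Export all_classical all_reals all_analysis.
Export Order.TTheory GRing.Theory Num.Def Num.Theory.
Export numFieldNormedType.Exports.

Set Implicit Arguments.
Unset Strict Implicit.
Unset Printing Implicit Defensive.

Global Open Scope classical_set_scope.
Global Open Scope ring_scope.

Section matrices.
Context {R : realType} {X : countType}.
Implicit Types (M N Q S P : X -> X -> R) (r : X -> R).

(* Sum of an absolutely summable real family (junk value otherwise). *)
Definition infsum (f : X -> R) : R :=
  fine (\esum_(x in [set: X]) (maxr (f x) 0)%:E)
  - fine (\esum_(x in [set: X]) (maxr (- f x) 0)%:E).

Definition mxprod M N : X -> X -> R :=
  fun x y => infsum (fun z => M x z * N z y).

Fixpoint mxpow M (n : nat) : X -> X -> R :=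
  if n is m.+1 then mxprod M (mxpow M m) else fun x y => (x == y)%:R.

Definition neumann M : X -> X -> R :=
  fun x y => limn (series (fun n => mxpow M n x y)).

Definition hadamard M N : X -> X -> R := fun x y => M x y * N x y.

(* The inverse, (\sum_n P^n) diag(r)^-1, of the matrix diag(r) (I - P). *)
Definition decomp_inv r P : X -> X -> R := fun x y => neumann P x y * (r y)^-1.

(* The sum of row x of a matrix with nonnegative off-diagonal entries; it may
   be +oo. *)
Definition rowsum Q (x : X) : \bar R :=
  ((Q x x)%:E + \esum_(y in [set y | y != x]) (Q x y)%:E)%E.

Definition irreducible_gen Q : Prop :=
  forall x y : X, exists s : seq X,
    path (fun u v => (u != v) && (0 < Q u v)) x s /\ last x s = y.

Record symmetric_generator Q : Prop := {
  gen_sym : forall x y, x != y -> Q x y = Q y x;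
  gen_offdiag : forall x y, x != y -> 0 <= Q x y;
  gen_diag : forall x, Q x x < 0;
  gen_rowsum : forall x, (rowsum Q x <= 0)%E;
  gen_transient :
    (irreducible_gen Q /\ exists x, (rowsum Q x < 0)%E)
    \/ (forall x, (rowsum Q x < 0)%E) }.

Definition jump_matrix Q : X -> X -> R :=
  fun x y => if x == y then 0 else - Q x y / Q x x.

Record sign_matrix S : Prop := {
  sign_diag : forall x, S x x = 1;
  sign_sym : forall x y, x != y -> S x y = S y x;
  sign_val : forall x y, x != y -> S x y = -1 \/ S x y = 1 }.

(* (- Q o S)^-1, computed from Q o S = Qdiag (I - P o S). *)
Definition Sigma Q S : X -> X -> R :=
  fun x y => - decomp_inv (fun z => Q z z) (hadamard (jump_matrix Q) S) x y.

(* The cemetery is [None]. *)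
Definition trans_prob Q (u v : option X) : R :=
  match u, v with
  | Some x, Some y => jump_matrix Q x y
  | Some x, None => 1 - infsum (jump_matrix Q x)
  | None, Some _ => 0
  | None, None => 1
  end.

Definition trans_sign S (u v : option X) : R :=
  match u, v with
  | Some x, Some y => S x y
  | _, _ => 1
  end.

End matrices.

Section process.
Context {R : realType} {X : countType}.
Context {d : measure_display} {Omega : measurableType d}.
(* Y n is the state after n jumps, tau n the holding time in that state. The
   holding time in the cemetery is an arbitrary positive number, which almost
   surely affects neither the path nor the sign process. *)
Variables (Y : nat -> Omega -> option X) (tau : nat -> {mfun Omega >-> R}).

Definition jump_time (n : nat) (w : Omega) : R := \sum_(i < n) tau i w.

(* [process_law Y tau Q x P]: under P, the jump chain Y is Markov and starts at x and, given
   Y, the holding times in states of X are independent and exponential. *)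
Record process_law (Q : X -> X -> R) (x : X) (P : probability Omega R) : Prop := {
  chain_measurable : forall n u, measurable [set w | Y n w = u];
  holding_gt0 : forall n w, 0 < tau n w;
  chain_law : forall (n : nat) (y : nat -> option X),
    P [set w | forall i, (i <= n)%N -> Y i w = y i] =
    ((y 0%N == Some x)%:R * \prod_(i < n) trans_prob Q (y i) (y i.+1))%:E;
  holding_law : forall (n : nat) (y : nat -> option X) (B : nat -> set R),
    (forall i, measurable (B i)) ->
    P [set w | (forall i, (i <= n)%N -> Y i w = y i) /\
               (forall i, (i <= n)%N -> y i <> None -> B i (tau i w))] =
    (P [set w | forall i, (i <= n)%N -> Y i w = y i] *
     \prod_(i < n.+1)
       (if y i is Some z then exponential_prob (- Q z z) (B i) else 1))%E }.

(* [None] at the cemetery as well as after an accumulation of jump times. *)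
Definition state (t : R) (w : Omega) : option X :=
  xget None [set u | exists n,
    jump_time n w <= t < jump_time n.+1 w /\ Y n w = u].

(* The product is over the finitely many i whose factor is not 1, and is 1 by
   convention when there are infinitely many, which requires t to be past an
   accumulation of jump times. *)
Definition sign_process (S : X -> X -> R) (t : R) (w : Omega) : R :=
  \big[*%R/1]_(i \in [set i | (1 <= i)%N /\ jump_time i w <= t])
    trans_sign S (Y i.-1 w) (Y i w).

Definition hit_time (A : {fset X}) (w : Omega) : \bar R :=
  ereal_inf [set t%:E | t in
    [set t | jump_time 1 w <= t /\ exists2 a, a \in A & state t w = Some a]].

(* 1_{X_{R_A} = a} H_{R_A} *)
Definition hit_sign (S : X -> X -> R) (A : {fset X}) (a : X) (w : Omega) : R :=
  if hit_time A w is r%:E then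
    (state r w == Some a)%:R * sign_process S r w
  else 0.

(* \int_0^oo 1_{X_s = b'} H_s 1_{s < R_A} ds *)
Definition signed_occupation (S : X -> X -> R) (A : {fset X}) (b' : X)
    (w : Omega) : \bar R :=
  (\int[@lebesgue_measure R]_(s in `[0%R, +oo[)
    ((state s w == Some b')%:R * sign_process S s w
      * ((s : R)%:E < hit_time A w)%E%:R)%:E)%E.

End process.

Definition gaussian_prob {R : realType} (m v : R) (U : set R) : \bar R :=
  if v == 0 then dirac m U else normal_prob m (Num.sqrt v) U.

Section gaussian_conditioning.
Context {R : realType} {X : countType}.
Context {d : measure_display} {Omega : measurableType d}.
Variable P : probability Omega R.

(* A family is Gaussian when all its finite linear combinations are (possibly
   degenerate) normal variables. *)
Definition gaussian_field (Z : X -> {RV P >-> R}) : Prop :=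
  forall (B : {fset X}) (c : X -> R), exists m v : R, 0 <= v /\
    forall U : set R, measurable U ->
      P [set w | U (\sum_(x <- B) c x * Z x w)] = gaussian_prob m v U.

Definition centered_gaussian_field (K : X -> X -> R)
    (Z : X -> {RV P >-> R}) : Prop :=
  [/\ gaussian_field Z,
      forall x, ('E_P[Z x] = 0)%E
    & forall x y, covariance P (Z x) (Z y) = (K x y)%:E].

Definition sigma_of (Z : X -> {RV P >-> R}) (A : {fset X}) : set (set Omega) :=
  <<s \bigcup_(a in [set` A]) preimage_set_system setT (Z a) measurable >>.

(* g is a version of the conditional expectation E[f | G]. *)
Definition is_cond_exp (G : set (set Omega)) (f g : Omega -> R) : Prop :=
  [/\ P.-integrable setT (EFin \o f),
      P.-integrable setT (EFin \o g),
      forall U : set R, measurable U -> G (g @^-1` U)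
    & forall B, G B -> (\int[P]_(w in B) (g w)%:E = \int[P]_(w in B) (f w)%:E)%E].

(* h is a version of E[(f - E[f | G]) (f' - E[f' | G]) | G]. *)
Definition is_cond_cov (G : set (set Omega)) (f f' h : Omega -> R) : Prop :=
  exists g g' : Omega -> R,
    [/\ is_cond_exp G f g, is_cond_exp G f' g'
      & is_cond_exp G (fun w => (f w - g w) * (f' w - g' w)) h].

End gaussian_conditioning.

(* Main.v *)
Require Import Defs.
From mathcomp Require Import measurable_realfun ring lra.
Import HBNNSimple.

(* Both identities follow from the decomposition at the first passage in A.
   Write Pt = P o S. Following H along the jump chain, Pt^n(x, y) is
   P_x(Y_n = y, H = 1) - P_x(Y_n = y, H = -1), and splitting at the first n >= 1
   with Y_n in A gives, after summation over n and division by - q_yy, for b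
   not in A,
     Sigma(b, y) = E_b[\int 1{X_s = y} H_s 1{s < R_A} ds]   (0 if y is in A)
                   + \sum_(a in A) E_b[1{X_(R_A) = a} H_(R_A)] Sigma(a, y).
   For y in A these are the normal equations, saying that the residual
   Z_b - \sum_a E_b[1{X_(R_A) = a} H_(R_A)] Z_a is uncorrelated with the Z_a,
   a in A; for y = b' not in A they give the covariance of the residuals.

   An element V of the Gaussian space which is uncorrelated with the Z_a is
   independent of them: let D be cos(sV + th) - E[cos(sV + th)]. Then
   E[D cos(u + t)] = 0 for u in the span of the Z_a, by the formula for the
   characteristic function. This property of D is preserved when D is multiplied
   by cos(u + t), hence by polynomials in these functions and by bounded limits
   of such polynomials, among which are the indicators of {u > c}: the iterates
   of x |-> (3x - x^3)/2 converge to the sign on [-1, 1], and sg(sin(x/n))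
   tends to sg(x). So E[D 1_B] = 0 for all B in the sigma-algebra of the Z_a. *)

(** * Normal laws *)

(** The interchanges of sums behind the decomposition rest on absolute convergence. It comes from
    |Pt^n(x, y)| <= P_x(Y_n = y) and from transience, which is obtained by counting absorptions:
    from y the cemetery is reached with a fixed positive probability after a fixed number of jumps,
    and absorptions at different times are almost surely disjoint. As X may be infinite, sums over
    states are first written for paths of sign 1 and paths of sign -1 separately; these are sums of
    probabilities, to which countable additivity applies, and signed quantities are their
    differences.

    The phase th stands in for complex exponentials: cos (u + th) gives sines as well as cosines,
    and a product of two such functions is a half-sum of two such functions. The division by - q_yy
    is the passage from the number of visits to the time spent: 1 / (- q_yy) is the mean holding
    time at y. *)

Section density.
Local Open Scope ereal_scope.
Context d (T : measurableType d) (R : realType).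
Variables (mu nu : {measure set T -> \bar R}) (h : T -> R).
Hypothesis mh : measurable_fun setT h.
Hypothesis h0 : forall x, (0 <= h x)%R.
Hypothesis nuE : forall U, measurable U -> nu U = \int[mu]_(x in U) (h x)%:E.

(** For indicators this is [nuE]; simple functions and monotone convergence on both sides give the
    rest. *)
Lemma ge0_integral_density (f : T -> \bar R) : (forall x, 0 <= f x) ->
  measurable_fun setT f -> \int[nu]_x f x = \int[mu]_x (f x * (h x)%:E).
Proof.
move=> f0 mf; pose g := nnsfun_approx measurableT mf.
have mhE : measurable_fun setT (EFin \o h) by exact/measurable_EFinP.
have -> : \int[nu]_x f x = limn (fun n => \int[nu]_x (g n x)%:E).
  rewrite -monotone_convergence//=.
  - by apply: eq_integral => x _; apply/esym/cvg_lim => //;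
    exact: cvg_nnsfun_approx.
  - by move=> n; exact/measurable_EFinP.
  - by move=> n x _; rewrite lee_fin.
  - by move=> x _ a b ab; rewrite lee_fin; exact/lefP/nd_nnsfun_approx.
have -> : \int[mu]_x (f x * (h x)%:E) =
    limn (fun n => \int[mu]_x ((g n x)%:E * (h x)%:E)).
  rewrite -monotone_convergence//=.
  - apply: eq_integral => x _; apply/esym/cvg_lim => //; apply: cvgeZr => //.
    exact: cvg_nnsfun_approx.
  - by move=> n; apply: emeasurable_funM => //; exact/measurable_EFinP.
  - by move=> n x _; rewrite mule_ge0 ?lee_fin.
  - move=> x _ a b ab; rewrite lee_wpmul2r ?lee_fin//.
    exact/lefP/nd_nnsfun_approx.
congr (limn _); apply/funext => n.
rewrite integralT_nnsfun sintegralE.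
transitivity (\int[mu]_x (\sum_(y \in range (g n))
    (y * \1_(g n @^-1` [set y]) x)%:E * (h x)%:E)); last first.
  apply: eq_integral => x _; rewrite -ge0_mule_fsuml => [|y]; last first.
    exact: nnfun_muleindic_ge0.
  by rewrite fsumEFin// -(fimfunE _ x).
rewrite ge0_integral_fsum//=; last 2 first.
- move=> y; apply: emeasurable_funM => //; apply/measurable_EFinP.
  exact: measurable_funM.
- by move=> y x _; rewrite mule_ge0 ?lee_fin// -lee_fin nnfun_muleindic_ge0.
apply: eq_fsbigr => y yg; rewrite nuE//.
have y0 : (0 <= y)%R by move: yg; rewrite inE => -[x _ <-].
under [RHS]eq_integral do rewrite EFinM -muleA.
rewrite ge0_integralZl//=; first last.
  by move=> x _; rewrite mule_ge0 ?lee_fin.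
  by apply: emeasurable_funM => //; apply/measurable_EFinP.
congr (_ * _); rewrite [LHS]integral_mkcond; apply: eq_integral => x _.
rewrite patchE indicE; case: ifPn => _; by rewrite ?mul1e ?mul0e.
Qed.

Lemma integrable_density (f : T -> R) : measurable_fun setT f ->
  mu.-integrable setT (EFin \o (fun x => f x * h x)%R) ->
  nu.-integrable setT (EFin \o f).
Proof.
move=> mf /integrableP[_ H]; apply/integrableP; split; first exact/measurable_EFinP.
rewrite ge0_integral_density//=; last exact/measurable_EFinP/measurableT_comp.
by under eq_integral => x _ do rewrite -EFinM -[X in (_ * X)%R]ger0_norm// -normrM.
Qed.

Lemma integral_density (f : T -> R) : measurable_fun setT f ->
  mu.-integrable setT (EFin \o (fun x => f x * h x)%R) ->
  \int[nu]_x (f x)%:E = \int[mu]_x (f x * h x)%:E.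
Proof.
move=> mf intf; rewrite integralE [RHS]integralE.
have mE : measurable_fun setT (EFin \o f) by exact/measurable_EFinP.
rewrite !ge0_integral_density; [|by []|exact: measurable_funeneg|by []|exact:
  measurable_funepos].
congr (_ - _); apply: eq_integral => x _.
  by rewrite !funeposE/= -!EFin_max -EFinM maxr_pMl// mul0r.
by rewrite !funenegE/= -!EFin_max -EFinM maxr_pMl// mul0r mulNr.
Qed.

End density.

Section real_dominated_convergence.
Context d (T : measurableType d) (R : realType).
Variable mu : {measure set T -> \bar R}.

Lemma Rintegral_dominated_cvg (f_ : nat -> T -> R) (f g : T -> R) :
  (forall n, measurable_fun setT (f_ n)) ->
  (forall x, f_ ^~ x @ \oo --> f x) ->
  mu.-integrable setT (EFin \o g) ->
  (forall n x, `|f_ n x| <= g x) ->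
  mu.-integrable setT (EFin \o f) /\
  \int[mu]_x f_ n x @[n --> \oo] --> \int[mu]_x f x.
Proof.
move=> mf_ cf ig fg.
have mf : measurable_fun setT f.
  by apply: (@measurable_fun_cvg _ _ _ setT f_) => // x _; exact: cf.
have mEf_ n : measurable_fun setT (fun x => (f_ n x)%:E).
  exact/measurable_EFinP.
have mEf : measurable_fun setT (EFin \o f) by exact/measurable_EFinP.
have cE : {ae mu, forall x, setT x -> (f_ n x)%:E @[n --> \oo] --> (EFin \o f) x}.
  by apply: aeW => x _; apply: cvg_EFin; [exact: nearW|exact: cf].
have bE : {ae mu, forall x n, setT x -> (`|(f_ n x)%:E| <= (EFin \o g) x)%E}.
  by apply: aeW => x n _; exact: fg.
have [intf _ cvf] := dominated_convergence measurableT mEf_ mEf cE ig bE.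
split=> //; apply: fine_cvg; rewrite fineK; first exact: cvf.
exact: integrable_fin_num.
Qed.

End real_dominated_convergence.

Section FTC_line.
Context (R : realType).
Notation mu := (@lebesgue_measure R).

(** The integral over [-n, n] is F(n) - F(-n), and the integrability of [f] lets n tend to infinity
    by dominated convergence. *)
Lemma Rintegral_derive_eq0 (F f : R -> R) :
  (forall x, is_derive x (1:R) F (f x)) -> continuous f ->
  mu.-integrable setT (EFin \o f) ->
  F n%:R @[n --> \oo] --> 0 -> F (- n%:R) @[n --> \oo] --> 0 ->
  \int[mu]_x f x = 0.
Proof.
move=> dF cf intf Fy FNy.
have mf : measurable_fun setT f by exact: continuous_measurable_fun.
pose f_ n x := f x * \1_(`[- n%:R, n%:R]%classic) x.
have [_ H] : mu.-integrable setT (EFin \o f) /\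
    \int[mu]_x f_ n x @[n --> \oo] --> \int[mu]_x f x.
  have := @Rintegral_dominated_cvg _ _ _ mu f_ f (fun x => `|f x|).
  apply.
  - by move=> n; exact: measurable_funM.
  - move=> x; apply: cvg_near_cst; near=> n.
    rewrite /f_ indicE mem_set ?mulr1//= in_itv/= -ler_norml.
    near: n; exact: nbhs_infty_ger.
  - exact: integrable_norm.
  - move=> n x; rewrite normrM indicE; case: (_ \in _);
    rewrite ?normr1 ?normr0 ?mulr1// mulr0//.
suff : \int[mu]_x f_ n x @[n --> \oo] --> 0 - (0 : R).
  by move=> H2; rewrite -(cvg_lim _ H)// (cvg_lim _ H2)// subr0.
(* The shift makes the interval nondegenerate, as [continuous_FTC2] requires. *)
rewrite -(cvg_shiftS (fun n => \int[mu]_x f_ n x)).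
have -> : (fun n => \int[mu]_x f_ n.+1 x) = (fun n => F n.+1%:R - F (- n.+1%:R)).
  apply/funext => n.
  have nn : - n.+1%:R < n.+1%:R :> R by rewrite gtrN.
  rewrite /Rintegral -[RHS]/(fine (_ - _)%:E) EFinB.
  rewrite -(@continuous_FTC2 _ f F)//.
  - congr fine; rewrite [RHS]integral_mkcond; apply: eq_integral => x _.
    by rewrite patchE /f_ indicE; case: (_ \in _); rewrite ?mulr1 ?mulr0.
  - exact: continuous_subspaceT.
  - split=> [x _||]; first by have [] := dF x.
      apply: cvg_at_right_filter; apply: differentiable_continuous.
      by apply/derivable1_diffP; have [] := dF (- n.+1%:R).
    apply: cvg_at_left_filter; apply: differentiable_continuous.
    by apply/derivable1_diffP; have [] := dF n.+1%:R.
  - by move=> x _; rewrite derive1E; have [_ ->] := dF x.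
by apply: cvgB; [rewrite (cvg_shiftS (fun n => F n%:R))|rewrite (cvg_shiftS (fun
  n => F (- n%:R)))].
Unshelve. all: by end_near. Qed.

End FTC_line.

Section normal_law.
Context (R : realType) (m s : R).
Hypothesis s0 : 0 < s.
Notation mu := (@lebesgue_measure R).
Notation phi := (normal_pdf m s).

Let sN0 : s != 0. Proof. by rewrite gt_eqF. Qed.

(** Doubling the deviation leaves room for a quadratic factor: with y = (x - m)^2 / (8 s^2) the two
    exponentials are exp(-4y) and exp(-y). The bound yields both the integrability of quadratic
    functions and the decay at infinity. *)
Lemma normal_pdf_decay x : (x - m) ^+ 2 * phi x <=
  8 * s ^+ 2 * normal_peak s / normal_peak (2 * s) * normal_pdf m (2 * s) x.
Proof.
have s20 : 2 * s != 0 by rewrite mulf_neq0// pnatr_eq0.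
rewrite !normal_pdfE//= /normal_fun.
set y := (x - m) ^+ 2 / (8 * s ^+ 2).
have y0 : 0 <= y by rewrite divr_ge0 ?sqr_ge0// mulr_ge0// sqr_ge0.
have -> : (x - m) ^+ 2 = 8 * s ^+ 2 * y by rewrite /y; field.
have -> : - (8 * s ^+ 2 * y) / (s ^+ 2 *+ 2) = - y - (3 * y).
  by rewrite -mulr_natr; field; rewrite ?sN0 ?pnatr_eq0.
have -> : - (8 * s ^+ 2 * y) / ((2 * s) ^+ 2 *+ 2) = - y.
  by rewrite -mulr_natr; field; rewrite ?sN0 ?pnatr_eq0.
have pk : normal_peak (2 * s) != 0 by rewrite gt_eqF// normal_peak_gt0.
rewrite [leRHS]mulrA divfK// expRD.
(* exp(3y) >= 1 + 3y >= y. *)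
have key : y * expR (- (3 * y)) <= 1.
  rewrite expRN ler_pdivrMr ?expR_gt0// mul1r.
  apply: le_trans (expR_ge1Dx _); lra.
rewrite [leLHS](_ : _ = (8 * s ^+ 2 * normal_peak s * expR (- y)) *
  (y * expR (- (3 * y)))); last by ring.
apply: ler_piMr => //; apply: mulr_ge0 (expR_ge0 _).
apply: mulr_ge0 (normal_peak_ge0 _); apply: mulr_ge0 (sqr_ge0 _); lra.
Qed.

Lemma integrable_sqr_normal_pdf :
  mu.-integrable setT (EFin \o (fun x => (x - m) ^+ 2 * phi x)).
Proof.
have mphi := measurable_normal_pdf m s.
apply: (@le_integrable _ _ _ mu _ measurableT _ (fun x => (8 * s ^+ 2 *
  normal_peak s /
   normal_peak (2 * s))%:E * (normal_pdf m (2 * s) x)%:E)%E) => //.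
- apply/measurable_EFinP; apply: measurable_funM => //.
  by apply: measurable_funX; exact: measurable_funB.
- move=> x _; rewrite -EFinM/= lee_fin (ger0_norm (mulr_ge0 (sqr_ge0 _)
  (normal_pdf_ge0 _ _ _))).
  exact: le_trans (normal_pdf_decay x) (ler_norm _).
- exact: (integrableZl measurableT _ (integrable_normal_pdf m (2 * s))).
Qed.

Lemma integrable_quadratic_normal_pdf (f : R -> R) (C : R) :
  measurable_fun setT f -> (forall x, `|f x| <= C * (1 + (x - m) ^+ 2)) ->
  mu.-integrable setT (EFin \o (fun x => f x * phi x)).
Proof.
move=> mf fle.
have mphi := measurable_normal_pdf m s.
apply: (@le_integrable _ _ _ mu _ measurableT _
  (fun x => C%:E * ((phi x)%:E + ((x - m) ^+ 2 * phi x)%:E))%E) => //.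
- by apply/measurable_EFinP; exact: measurable_funM.
- move=> x _; rewrite -EFinD -EFinM/= lee_fin normrM (ger0_norm (normal_pdf_ge0
  _ _ _)).
  apply: le_trans (ler_norm _); rewrite -[X in _ * (X + _)]mul1r -mulrDl mulrA.
  by rewrite ler_wpM2r ?normal_pdf_ge0.
- exact: (integrableZl measurableT _
    (integrableD measurableT (integrable_normal_pdf m s)
      integrable_sqr_normal_pdf)).
Qed.

Lemma is_derive_normal_pdf x : is_derive x (1:R) phi (- (x - m) / s ^+ 2 * phi x).
Proof.
rewrite normal_pdfE//= /normal_fun.
have H : is_derive x (1:R) (fun x => - (x - m) ^+ 2 / (s ^+ 2 *+ 2)) (- (x - m)
  / s ^+ 2).
  apply: is_derive_eq; rewrite /GRing.scale/= !(mulr0, mulr1, addr0, oppr0,add0r).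
  by rewrite -mulr_natr; field; rewrite ?sN0 ?pnatr_eq0.
have H2 := is_derive1_comp (is_derive_expR _) H.
apply: is_derive_eq (is_deriveZ (normal_peak s) H2) _.
by rewrite /GRing.scale/=; ring.
Qed.

(** A bound for phi(x) (1 + |x - m|)^2; the factor 2 comes from (1 + u)^2 <= 2 (1 + u^2). *)
Let decayC := 2 * (normal_peak s + 8 * s ^+ 2 * normal_peak s /
   normal_peak (2 * s) * normal_peak (2 * s)).

(** Of the two powers of 1 + |x - m| that [phi] absorbs, one is spent on [g] and the other on 1 +
    |x| <= (1 + |x - m|)(1 + |m|). *)
Let decay_pdf (g : R -> R) x : (forall x, `|g x| <= 1 + `|x - m|) ->
  `|g x * phi x| <= decayC * (1 + `|m|) / (1 + `|x|).
Proof.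
move=> gle.
have s20 : 2 * s != 0 by rewrite mulf_neq0// pnatr_eq0.
have phi0 := normal_pdf_ge0 m s x.
rewrite normrM (ger0_norm phi0).
have u0 := normr_ge0 (x - m).
have H0 : phi x * (1 + `|x - m|) ^+ 2 <= decayC.
  have C0 : 0 <= 8 * s ^+ 2 * normal_peak s / normal_peak (2 * s).
    by rewrite !mulr_ge0 ?invr_ge0 ?normal_peak_ge0 ?sqr_ge0//; exact: ltW.
  have H1 := normal_pdf_decay x.
  have H2 := normal_pdf_ub m x sN0.
  have H3 := ler_wpM2l C0 (normal_pdf_ub m x s20).
  have H4 : (1 + `|x - m|) ^+ 2 <= 2 * (1 + (x - m) ^+ 2).
    by rewrite -[X in _ <= _ * (_ + X)]real_normK ?num_real//;
      have := sqr_ge0 (`|x - m| - 1); nra.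
  apply: le_trans (ler_wpM2l phi0 H4) _; rewrite /decayC mulrCA ler_pM2l//
    mulrDr mulr1 lerD//.
  by rewrite mulrC; exact: le_trans H1 H3.
have D0 : 0 <= decayC by apply: le_trans H0; rewrite mulr_ge0 ?sqr_ge0.
rewrite ler_pdivlMr; last by rewrite ltr_pwDl.
apply: (@le_trans _ _ ((1 + `|x - m|) * phi x * ((1 + `|x - m|) * (1 + `|m|)))).
  apply: ler_pM; rewrite ?mulr_ge0//; [by rewrite ler_wpM2r|].
  have H5 : `|x| <= `|x - m| + `|m| by rewrite -[in leLHS](subrK m x) ler_normD.
  have := normr_ge0 m; nra.
rewrite mulrA ler_wpM2r ?addr_ge0//.
by apply: le_trans H0; rewrite le_eqVlt; apply/orP; left; apply/eqP; ring.
Qed.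

(** Integration by parts: (g phi)' = g' phi - g (x - m) phi / s^2, and g phi vanishes at infinity.
    The linear growth allowed for [g] admits both sines and x - m itself. *)
Lemma normal_stein (g dg : R -> R) (K : R) :
  (forall x, is_derive x (1:R) g (dg x)) -> continuous dg ->
  (forall x, `|g x| <= 1 + `|x - m|) -> (forall x, `|dg x| <= K) ->
  \int[mu]_x (g x * (x - m) * phi x) = s ^+ 2 * \int[mu]_x (dg x * phi x).
Proof.
move=> dF cdg gle dgle.
have cg : continuous g.
  by move=> x; apply: differentiable_continuous; apply/derivable1_diffP;
    have [] := dF x.
have cphi : continuous phi by exact: continuous_normal_pdf.
have cid : continuous (fun x : R => x - m).
  by move=> x; apply: cvgB; [exact: cvg_id|exact: cvg_cst].
have c1 : continuous (fun x => g x * (x - m)).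
  by move=> x; apply: cvgM; [exact: cg|exact: cid].
have K0 : 0 <= K by exact: le_trans (normr_ge0 _) (dgle 0).
have i1 : mu.-integrable setT (EFin \o (fun x => g x * (x - m) * phi x)).
  apply: (@integrable_quadratic_normal_pdf _ 2).
    exact: continuous_measurable_fun.
  move=> x; rewrite normrM.
  apply: le_trans (ler_wpM2r (normr_ge0 _) (gle x)) _.
  by rewrite -[X in _ <= _ * (_ + X)]real_normK ?num_real//;
    have := sqr_ge0 (`|x - m| - 1); have := sqr_ge0 (`|x - m|); nra.
have i2 : mu.-integrable setT (EFin \o (fun x => dg x * phi x)).
  apply: (@integrable_quadratic_normal_pdf _ K).
    exact: continuous_measurable_fun.
  by move=> x; apply: le_trans (dgle x) _; rewrite ler_peMr// lerDl sqr_ge0.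
have i3 : mu.-integrable setT (EFin \o (fun x => s ^+ 2 * (dg x * phi x))).
  exact: (integrableZl measurableT (s ^+ 2) i2).
rewrite -(RintegralZl _ measurableT i2).
apply/eqP; rewrite eq_sym -subr_eq0; apply/eqP.
rewrite -(RintegralB measurableT i3 i1).
apply: (@Rintegral_derive_eq0 R (fun x => s ^+ 2 * (g x * phi x))).
- move=> x.
  apply: is_derive_eq (is_deriveZ (s ^+ 2) (is_deriveM (dF x)
    (is_derive_normal_pdf x))) _.
  by rewrite /GRing.scale/=; field; rewrite sN0.
- move=> x; apply: cvgB.
    by apply: cvgM; [exact: cvg_cst|apply: cvgM; [exact: cdg|exact: cphi]].
  by apply: cvgM; [exact: c1|exact: cphi].
- exact: (integrableB measurableT i3 i1).
- rewrite -[X in _ --> X](mulr0 (s ^+ 2)); apply: cvgM; first exact: cvg_cst.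
  apply: norm_cvg0; apply: (@squeeze_cvgr _ _ _ _ (cst 0) (fun n => decayC * (1
    + `|m|) * n.+1%:R^-1)).
  + apply: nearW => n; rewrite normr_ge0/=.
    by apply: le_trans (decay_pdf _ _ gle) _; rewrite normr_nat nat1r.
  + exact: cvg_cst.
  + by rewrite -[X in _ --> X](mulr0 (decayC * (1 + `|m|))); apply: cvgM;
    [exact: cvg_cst|exact: cvg_harmonic].
- rewrite -[X in _ --> X](mulr0 (s ^+ 2)); apply: cvgM; first exact: cvg_cst.
  apply: norm_cvg0; apply: (@squeeze_cvgr _ _ _ _ (cst 0) (fun n => decayC * (1
    + `|m|) * n.+1%:R^-1)).
  + apply: nearW => n; rewrite normr_ge0/=.
    by apply: le_trans (decay_pdf _ _ gle) _; rewrite normrN normr_nat nat1r.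
  + exact: cvg_cst.
  + by rewrite -[X in _ --> X](mulr0 (decayC * (1 + `|m|))); apply: cvgM;
    [exact: cvg_cst|exact: cvg_harmonic].
Qed.

End normal_law.

Section normal_char.
Context (R : realType) (m s : R).
Hypothesis s0 : 0 < s.
Notation mu := (@lebesgue_measure R).
Notation phi := (normal_pdf m s).

Let dsin (a b : R) x : is_derive x (1:R) (fun x => sin (a * (x - m) + b)) (a *
  cos (a * (x - m) + b)).
Proof.
have H : is_derive x (1:R) (fun x => a * (x - m) + b) a.
  by apply: is_derive_eq; rewrite /GRing.scale/=; ring.
apply: is_derive_eq (is_derive1_comp (is_derive_sin _) H) _.
by rewrite /GRing.scale/=; ring.
Qed.

Let caff (a b : R) : continuous (fun x : R => a * (x - m) + b).
Proof.
move=> x; apply: cvgD; last exact: cvg_cst.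
by apply: cvgM; [exact: cvg_cst|apply: cvgB; [exact: cvg_id|exact: cvg_cst]].
Qed.

Let ccos (a b : R) : continuous (fun x : R => cos (a * (x - m) + b)).
Proof. by move=> x; apply: continuous_comp; [exact: caff|exact: continuous_cos].
  Qed.

Let csin (a b : R) : continuous (fun x : R => sin (a * (x - m) + b)).
Proof. by move=> x; apply: continuous_comp; [exact: caff|exact: continuous_sin].
  Qed.

Let h th t := \int[mu]_x (cos (t * (x - m) + th) * phi x).

(** Differentiation under the integral, dominated by |x - m| phi, produces - (x - m) sin (t (x - m)
    + th); Stein's identity with g = sin (t (x - m) + th) turns this back into [h]. *)
Let dh th t : is_derive t (1:R) (h th) (- t * s ^+ 2 * h th t).
Proof.
pose f t x := cos (t * (x - m) + th) * phi x.
have df x t' : is_derive t' (1:R) (f ^~ x) (- (x - m) * sin (t' * (x - m) + th)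
  * phi x).
  have H : is_derive t' (1:R) (fun t' => t' * (x - m) + th) (x - m).
    by apply: is_derive_eq; rewrite /GRing.scale/=; ring.
  apply: is_derive_eq (is_deriveM (is_derive1_comp (is_derive_cos _) H)
    (is_derive_cst (phi x) _ _)) _.
  by rewrite /GRing.scale/=; ring.
have intf t' : mu.-integrable setT (EFin \o f t').
  apply: (integrable_quadratic_normal_pdf _ _ _ s0 (fun x => cos (t' * (x - m) +
    th)) 1).
    exact: continuous_measurable_fun.
  by move=> x; rewrite mul1r (le_trans (cos_max _))// lerDl sqr_ge0.
have intG : mu.-integrable setT (EFin \o (fun x => `|x - m| * phi x)).
  apply: (integrable_quadratic_normal_pdf _ _ _ s0 (fun x => `|x - m|) 1).
    by apply: measurableT_comp => //; exact: measurable_funB.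
  move=> x; rewrite mul1r normr_id -[X in _ <= _ + X]real_normK ?num_real//.
  by have := sqr_ge0 (`|x - m| - 1); have := normr_ge0 (x - m); nra.
have It : (`]t - 1, t + 1[%classic : set R) t by rewrite /= in_itv/= ltrDl
  ltrBlDr ltrDl ltr01.
have intf' t' : (`]t - 1, t + 1[%classic : set R) t' -> mu.-integrable setT
  (EFin \o f t') by [].
have der' t' x : (`]t - 1, t + 1[%classic : set R) t' -> setT x -> derivable (f
  ^~ x) t' 1.
  by move=> _ _; have [] := df x t'.
have G0 x : 0 <= `|x - m| * phi x by rewrite mulr_ge0// normal_pdf_ge0.
have Gub t' x : (`]t - 1, t + 1[%classic : set R) t' -> setT x -> `|partial1of2
  f t' x| <= `|x - m| * phi x.
  move=> _ _; rewrite partial1of2E; have [_ ->] := df x t'.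
  rewrite 2!normrM normrN (ger0_norm (normal_pdf_ge0 _ _ _)) ler_wpM2r
    ?normal_pdf_ge0//.
  by rewrite ler_piMr// sin_max.
have D1 := @derivable_under_integral R _ _ mu f setT measurableT _ _ _ It intf'
  der' _ G0 intG Gub.
have D2 := @differentiation_under_integral R _ _ mu f setT measurableT _ _ _ It
  intf' der' _ G0 intG Gub.
apply: DeriveDef; first exact: D1.
rewrite -derive1E [LHS]D2.
have -> : \int[mu]_y partial1of2 f t y =
    \int[mu]_y (- 1 * (sin (t * (y - m) + th) * (y - m) * phi y)).
  apply: eq_Rintegral => x _; rewrite partial1of2E; have [_ ->] := df x t; ring.
have ist : mu.-integrable setT (EFin \o (fun x => sin (t * (x - m) + th) * (x -
  m) * phi x)).
  apply: (le_integrable measurableT _ _ intG).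
    apply/measurable_EFinP; apply: measurable_funM;
      last exact: measurable_normal_pdf.
    by apply: measurable_funM; [exact: continuous_measurable_fun|exact:
      measurable_funB].
  move=> x _; rewrite lee_fin/= [leRHS]ger0_norm// 2!normrM (ger0_norm
    (normal_pdf_ge0 _ _ _)).
  by rewrite ler_wpM2r ?normal_pdf_ge0// ler_piMl// sin_max.
rewrite (RintegralZl _ measurableT ist).
rewrite (normal_stein _ _ _ s0 (fun x => sin (t * (x - m) + th)) (fun x => t *
  cos (t * (x - m) + th)) `|t| (dsin t th)).
- under eq_Rintegral do rewrite -mulrA.
  by rewrite (RintegralZl _ measurableT (intf t)) /h; ring.
- by move=> x; apply: cvgM; [exact: cvg_cst|exact: ccos].
- by move=> x; rewrite (le_trans (sin_max _))// lerDl.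
- by move=> x; rewrite normrM ler_piMr// cos_max.
Qed.

(* By Stein's identity the left-hand side, as a function of [t], solves the
   differential equation [h' = - t s^2 h]. *)
Lemma normal_char (th t : R) :
  \int[mu]_x (cos (t * (x - m) + th) * phi x) = cos th * expR (- (t ^+ 2 * s ^+
    2 / 2)).
Proof.
have H : h th t * expR (t ^+ 2 * s ^+ 2 / 2) = h th 0 * expR (0 ^+ 2 * s ^+ 2 / 2).
  apply: (@is_derive_0_is_cst R (fun t => h th t * expR (t ^+ 2 * s ^+ 2 / 2)))
    => t'.
  have E : is_derive t' (1:R) (fun t => t ^+ 2 * s ^+ 2 / 2) (t' * s ^+ 2).
    by apply: is_derive_eq; rewrite /GRing.scale/=; field.
  apply: is_derive_eq (is_deriveM (dh th t') (is_derive1_comp (is_derive_expR _)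
    E)) _.
  by rewrite /GRing.scale/=; ring.
rewrite expRN -[LHS]/(h th t); apply: (canRL (mulfK _));
  first by rewrite gt_eqF// expR_gt0.
rewrite H expr0n/= !mul0r expR0 mulr1 /h.
under eq_Rintegral do rewrite mul0r add0r.
rewrite (RintegralZl _ measurableT (integrable_normal_pdf m s)).
by rewrite /Rintegral integral_normal_pdf/= mulr1.
Qed.

Lemma normal_mean : \int[mu]_x (x * phi x) = m.
Proof.
have i1 : mu.-integrable setT (EFin \o (fun x => (x - m) * phi x)).
  apply: (integrable_quadratic_normal_pdf _ _ _ s0 (fun x => x - m) 1).
    exact: measurable_funB.
  move=> x; rewrite mul1r -[X in _ <= _ + X]real_normK ?num_real//.
  by have := sqr_ge0 (`|x - m| - 1); have := normr_ge0 (x - m); nra.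
have i2 := integrableZl measurableT m (integrable_normal_pdf m s).
have E : \int[mu]_x (x * phi x) = \int[mu]_x ((x - m) * phi x + m * phi x).
  by apply: eq_Rintegral => x _; ring.
rewrite E (RintegralD measurableT i1 i2) (RintegralZl _ measurableT
  (integrable_normal_pdf m s)).
rewrite /Rintegral integral_normal_pdf/= mulr1 -/(Rintegral _ _ _).
have -> : \int[mu]_x ((x - m) * phi x) = \int[mu]_x (1 * (x - m) * phi x).
  by apply: eq_Rintegral => x _; ring.
rewrite (normal_stein _ _ _ s0 (cst 1) (cst 0) 0 (fun x => is_derive_cst (1 : R)
  x (1 : R))).
- under eq_Rintegral do rewrite mul0r.
  by rewrite Rintegral_cst// mul0r mulr0 add0r.
- by move=> x; exact: cvg_cst.
- by move=> x; rewrite normr1 lerDl.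
- by move=> x; rewrite normr0.
Qed.

Lemma normal_variance : \int[mu]_x ((x - m) ^+ 2 * phi x) = s ^+ 2.
Proof.
under eq_Rintegral do rewrite expr2.
have d1 x : is_derive x (1:R) (fun x => x - m) (cst 1 x).
  by apply: is_derive_eq; rewrite ?subr0// addr0.
rewrite (normal_stein _ _ _ s0 (fun x => x - m) (cst 1) 1 d1).
- under eq_Rintegral do rewrite mul1r.
  by rewrite /Rintegral integral_normal_pdf/= mulr1.
- by move=> x; exact: cvg_cst.
- by move=> x; rewrite lerDr.
- by move=> x; rewrite normr1.
Qed.

End normal_char.

Section gaussian_law.
Context d (Omega : measurableType d) (R : realType).
Variables (P : probability Omega R) (X : Omega -> R) (m v : R).
Hypothesis mX : measurable_fun setT X.
Hypothesis v0 : 0 <= v.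
Hypothesis lawX : forall U : set R, measurable U ->
  P [set w | U (X w)] = gaussian_prob m v U.
Notation mu := (@lebesgue_measure R).

Let gauss_int (f : R -> R) :=
  if v == 0 then f m else \int[mu]_x (f x * normal_pdf m (Num.sqrt v) x).

(** A bound by a multiple of 1 + (x - m)^2 covers all the functions integrated below: powers up to
    the square, and cosines. *)
Let transfer (f : R -> R) (C : R) : measurable_fun setT f ->
  (forall x, `|f x| <= C * (1 + (x - m) ^+ 2)) ->
  P.-integrable setT (EFin \o (fun w => f (X w))) /\
  \int[P]_w f (X w) = gauss_int f.
Proof.
move=> mf fle.
(* [X] seen as a random variable into [measurableTypeR R], where its [distribution] is taken. *)
pose Y : {mfun Omega >-> measurableTypeR R} :=
  @mfun_Sub _ _ Omega (measurableTypeR R) X (mem_set (mX : @measurable_fun _ _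
    Omega (measurableTypeR R) setT X)).
have ge0E (g : measurableTypeR R -> \bar R) : measurable_fun setT g -> (forall
  y, 0 <= g y)%E ->
  (\int[P]_w g (X w) = \int[distribution P Y]_y g y)%E.
  by move=> mg g0; rewrite (ge0_integral_distribution (P := P) Y mg g0).
have mfE : @measurable_fun _ _ (measurableTypeR R) _ setT (EFin \o f) by
  exact/measurable_EFinP.
have mfA : @measurable_fun _ _ (measurableTypeR R) _ setT (fun x => `|(f
  x)%:E|)%E by exact: measurableT_comp.
have intI : (distribution P Y).-integrable setT (EFin \o f) ->
    P.-integrable setT (EFin \o (fun w => f (X w))).
  move=> /integrableP[_ H]; apply/integrableP; split.
    by apply/measurable_EFinP; exact: measurableT_comp.
  by rewrite (ge0E (fun x => `|(f x)%:E|)%E).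
suff [H1 H2] : (distribution P Y).-integrable setT (EFin \o f) /\
    (\int[distribution P Y]_y (f y)%:E = (gauss_int f)%:E)%E.
  split; first exact: intI.
  by rewrite /Rintegral -(integral_distribution (P := P) (X := Y) mfE (intI H1)) H2.
rewrite /gauss_int; move: lawX; rewrite /gaussian_prob; case: eqVneq => [_|vN0] law.
  have E (g : R -> \bar R) : (\int[distribution P Y]_y g y = \int[@dirac _
    (measurableTypeR R) m R]_y g y)%E.
    by apply: eq_measure_integral => U mU _; exact: law.
  split; last by rewrite E integral_dirac// diracT mul1e.
  apply/integrableP; split=> //; rewrite E integral_dirac//.
  by rewrite diracT mul1e ltry.
have s0 : 0 < Num.sqrt v by rewrite sqrtr_gt0 lt_neqAle eq_sym vN0.
have mphi := measurable_normal_pdf m (Num.sqrt v).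
have phi0 := normal_pdf_ge0 m (Num.sqrt v).
have nuE U : measurable U -> distribution P Y U =
    (\int[mu]_(x in U) (normal_pdf m (Num.sqrt v) x)%:E)%E by move=> mU; exact: law.
have ifp := integrable_quadratic_normal_pdf _ _ _ s0 _ _ mf fle.
split; first exact: (integrable_density _ _ _ mu (distribution P Y) _ mphi phi0
  nuE _ mf ifp).
rewrite (integral_density _ _ _ mu (distribution P Y) _ mphi phi0 nuE _ mf ifp)
  /Rintegral fineK//.
exact: (integrable_fin_num measurableT ifp).
Qed.

Lemma integrable_gaussian_sqr : P.-integrable setT (EFin \o (fun w => X w ^+ 2)).
Proof.
have [] := transfer (fun x => x ^+ 2) (2 + 2 * m ^+ 2).
- exact: measurable_funX.
- move=> x; rewrite ger0_norm ?sqr_ge0//.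
  (* x^2 <= 2 (x - m)^2 + 2 m^2 is (x - 2m)^2 >= 0. *)
  by have := sqr_ge0 (x - 2 * m); have := sqr_ge0 (m * (x - m)); nra.
- by [].
Qed.

Lemma integrable_gaussian : P.-integrable setT (EFin \o X).
Proof.
have [] := transfer id (1 + `|m|).
- exact: measurable_id.
- move=> x; have H : `|x| <= `|x - m| + `|m| by rewrite -[in leLHS](subrK m x)
  ler_normD.
  apply: le_trans H _; rewrite -[X in _ <= _ * (1 + X)]real_normK ?num_real//.
  by have := normr_ge0 m; have := sqr_ge0 (`|x - m| - 1);
    have := sqr_ge0 `|x - m|; nra.
- by [].
Qed.

Lemma gaussian_mean : \int[P]_w X w = m.
Proof.
have [|x|_ ->] := transfer id (1 + `|m|).
- exact: measurable_id.
- have H : `|x| <= `|x - m| + `|m| by rewrite -[in leLHS](subrK m x) ler_normD.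
  apply: le_trans H _; rewrite -[X in _ <= _ * (1 + X)]real_normK ?num_real//.
  by have := normr_ge0 m; have := sqr_ge0 (`|x - m| - 1);
    have := sqr_ge0 `|x - m|; nra.
rewrite /gauss_int; case: eqVneq => // vN0.
by rewrite normal_mean// sqrtr_gt0 lt_neqAle eq_sym vN0.
Qed.

Lemma gaussian_variance : \int[P]_w (X w - m) ^+ 2 = v.
Proof.
have [|x|_ ->] := transfer (fun x => (x - m) ^+ 2) 1.
- by apply: measurable_funX; exact: measurable_funB.
- by rewrite ger0_norm ?sqr_ge0// mul1r lerDr.
rewrite /gauss_int; case: eqVneq => [->|vN0]; first by rewrite subrr expr0n.
by rewrite normal_variance ?sqr_sqrtr// sqrtr_gt0 lt_neqAle eq_sym vN0.
Qed.

Lemma gaussian_char (th : R) :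
  \int[P]_w cos (X w - m + th) = cos th * expR (- (v / 2)).
Proof.
have mc : measurable_fun setT (fun x : R => cos (x - m + th)).
  apply: continuous_measurable_fun => x.
  apply: continuous_comp; last exact: continuous_cos.
  by apply: cvgD; [apply: cvgB; [exact: cvg_id|exact: cvg_cst]|exact: cvg_cst].
have [|x|_ ->] := transfer (fun x => cos (x - m + th)) 1.
- by [].
- by rewrite mul1r (le_trans (cos_max _))// lerDl sqr_ge0.
rewrite /gauss_int; case: eqVneq => [->|vN0].
  by rewrite subrr add0r mul0r oppr0 expR0 mulr1.
have s0 : 0 < Num.sqrt v by rewrite sqrtr_gt0 lt_neqAle eq_sym vN0.
have := normal_char _ m _ s0 th 1; rewrite expr1n mul1r sqr_sqrtr// => <-.
by apply: eq_Rintegral => x _; rewrite mul1r.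
Qed.

End gaussian_law.

(** * Independence in Gaussian families *)

(* The iterates of [sgn_step] converge to the sign function on [-1, 1], so that
   the sign of [s] is a bounded pointwise limit of polynomials in [s]. *)
Section sgn_iteration.
Context (R : realType).

(** The Newton-Schulz cubic: odd, with fixed points -1, 0 and 1, and with derivative 0 at -1 and
    1. *)
Definition sgn_step (x : R) := (3 * x - x ^+ 3) / 2.

Lemma sgn_step_norm x : `|x| <= 1 -> `|sgn_step x| <= 1.
Proof.
rewrite /sgn_step !ler_norml => /andP[h1 h2].
(* These products are 2 (1 + [sgn_step x]) and 2 (1 - [sgn_step x]). *)
have H1 : 0 <= (x + 1) ^+ 2 * (2 - x) by rewrite mulr_ge0 ?sqr_ge0//; lra.
have H2 : 0 <= (x - 1) ^+ 2 * (x + 2) by rewrite mulr_ge0 ?sqr_ge0//; lra.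
by apply/andP; split; nra.
Qed.

Lemma iter_sgn_step_norm n x : `|x| <= 1 -> `|iter n sgn_step x| <= 1.
Proof. by move=> x1; elim: n => //= n; exact: sgn_step_norm. Qed.

Let iter_sgn_stepN n x : iter n sgn_step (- x) = - iter n sgn_step x.
Proof. by elim: n => //= n ->; rewrite /sgn_step; field. Qed.

(** The iterates y stay in [x, 1], where 1 - [sgn_step y] = (1 - y)(1 - y/2 - y^2/2): the distance
    to 1 shrinks at least by the factor 1 - x/2. *)
Let iter_sgn_step_pos n x : 0 < x -> x <= 1 ->
  x <= iter n sgn_step x <= 1 /\ 1 - iter n sgn_step x <= (1 - x / 2) ^+ n.
Proof.
move=> x0 x1; elim: n => /= [|n]; first by rewrite expr0 lexx x1; split=> //; lra.
set y := iter n _ _; set z := _ ^+ n => -[/andP[xy y1] yz].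
have z0 : 0 <= z by rewrite exprn_ge0//; lra.
rewrite exprS -/z /sgn_step; split.
  have H1 : 0 <= y * (1 - y) * (1 + y) by rewrite !mulr_ge0//; lra.
  have H2 : 0 <= (y - 1) ^+ 2 * (y + 2) by rewrite mulr_ge0 ?sqr_ge0//; lra.
  by apply/andP; split; nra.
have -> : 1 - (3 * y - y ^+ 3) / 2 = (1 - y) * (1 - y / 2 - y ^+ 2 / 2) by field.
apply: (@le_trans _ _ ((1 - y) * (1 - x / 2))).
  by apply: ler_wpM2l; nra.
by rewrite [leRHS]mulrC ler_wpM2r//; lra.
Qed.

Let iter_sgn_step_cvg1 x : 0 < x -> x <= 1 -> iter n sgn_step x @[n --> \oo] -->
  (1 : R).
Proof.
move=> x0 x1; suff : 1 - iter n sgn_step x @[n --> \oo] --> (0 : R).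
  move=> H; rewrite (_ : (fun n => _) = (fun n => 1 - (1 - iter n sgn_step x))).
    by rewrite -[X in _ --> X](subr0 (1 : R)); apply: cvgB => //; exact: cvg_cst.
  by apply/funext => n; rewrite subKr.
apply: (@squeeze_cvgr _ _ _ _ (cst 0) (fun n => (1 - x / 2) ^+ n)).
- apply: nearW => n; have [/andP[_ h1] h2] := iter_sgn_step_pos n x x0 x1.
  by rewrite subr_ge0 h1.
- exact: cvg_cst.
- by apply: cvg_expr; rewrite ger0_norm; lra.
Qed.

Lemma iter_sgn_step_cvg x : `|x| <= 1 -> iter n sgn_step x @[n --> \oo] -->
  Num.sg x.
Proof.
move=> x1; have [x0|x0|->] := ltrgt0P x.
- rewrite gtr0_sg//; apply: iter_sgn_step_cvg1 => //;
  exact: le_trans (ler_norm _) x1.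
- rewrite ltr0_sg//.
  rewrite (_ : (fun n => _) = (fun n => - iter n sgn_step (- x))); last first.
    by apply/funext => n; rewrite -iter_sgn_stepN opprK.
  apply: cvgN; apply: iter_sgn_step_cvg1; first by rewrite oppr_gt0.
  by apply: le_trans x1; rewrite -normrN ler_norm.
- rewrite sgr0 (_ : (fun n => _) = cst 0); first exact: cvg_cst.
  by apply/funext => n; elim: n => //= n ->; rewrite /sgn_step expr0n/= mulr0
    subr0 mul0r.
Qed.

End sgn_iteration.

Section sin_estimates.
Context (R : realType).

Lemma normr_sin_le (x : R) : `|sin x| <= `|x|.
Proof.
have pos (y : R) : 0 <= y -> `|sin y| <= y.
  move=> y0; have [->|yN0] := eqVneq y 0; first by rewrite sin0 normr0.
  have yp : 0 < y by rewrite lt_neqAle eq_sym yN0.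
  have cs : {within `[0, y], continuous (@sin R)}.
    by apply: continuous_subspaceT; exact: continuous_sin.
  have [c _] := @MVT R sin cos 0 y yp (fun x _ => is_derive_sin x) cs.
  rewrite sin0 !subr0 => ->; rewrite normrM (ger0_norm y0).
  by rewrite ler_piMl// cos_max.
have [x0|x0] := leP 0 x; first by rewrite (ger0_norm x0) pos.
by rewrite -normrN -sinN (ltr0_norm x0) pos// oppr_ge0 ltW.
Qed.

(** The difference quotients of the sine at 0, taken along x / (n + 1), tend to cos 0 = 1. *)
Lemma natr_sin_cvg (x : R) : n.+1%:R * sin (x / n.+1%:R) @[n --> \oo] --> x.
Proof.
have [->|x0] := eqVneq x 0.
  rewrite (_ : (fun n => _) = cst 0); first exact: cvg_cst.
  by apply/funext => n; rewrite mul0r sin0 mulr0.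
have [/cvg_ex[l Hl] E] := is_derive_sin (0 : R).
have El : l = 1.
  by rewrite -cos0 -E; apply/esym/cvg_lim => //; move: Hl.
rewrite {}El in Hl.
have H : (x / n.+1%:R) @[n --> \oo] --> (0 : R).
  by rewrite -[X in _ --> X](mulr0 x); apply: cvgM;
    [exact: cvg_cst|exact: cvg_harmonic].
have Hd : (forall n : nat, x / n.+1%:R != 0) /\ (x / n.+1%:R) @[n --> \oo] -->
  (0 : R).
  by split=> // n; rewrite mulf_neq0// invr_eq0 pnatr_eq0.
move/cvgr_dnbhsP : Hl => /(_ _ Hd) Hl.
rewrite (_ : (fun n => _) = (fun n => x * ((x / n.+1%:R)^-1 *: (sin (0 + (x /
  n.+1%:R) *: 1) - sin 0)))); last first.
  apply/funext => n; rewrite add0r sin0 subr0 /GRing.scale/= mulr1.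
  have : n.+1%:R != 0 :> R by rewrite pnatr_eq0.
  by move: (n.+1%:R) => k k0; field; rewrite x0 k0.
rewrite -[X in _ --> X](mulr1 x); apply: cvgM; first exact: cvg_cst.
move: Hl; rewrite /GRing.scale/=.
by under eq_fun do rewrite [in X in sin X]addrC.
Qed.

End sin_estimates.

(** * Trigonometric orthogonality and its multipliers *)

Section trig_orthogonality.
Context d (Omega : measurableType d) (R : realType).
Variables (P : probability Omega R) (L : set (Omega -> R)).
Hypothesis L0 : L (fun=> 0).
Hypothesis LD : forall u v (c : R), L u -> L v -> L (fun w => u w + c * v w).
Hypothesis Lm : forall u, L u -> measurable_fun setT u.

(** In effect the conditional expectation of [D] given [L] is 0, tested against cosines and, through
    the phase [th], sines of elements of [L]. *)
Definition trig_orth (D : Omega -> R) :=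
  P.-integrable setT (EFin \o D) /\
  forall u th, L u -> \int[P]_w (D w * cos (u w + th)) = 0.

(* The multipliers form an algebra closed under bounded pointwise limits, and
   contain [cos (u + th)] for [u] in [L]. *)
Definition orth_multiplier (s : Omega -> R) :=
  [/\ measurable_fun setT s, (forall w, `|s w| <= 1) &
      forall D, trig_orth D -> trig_orth (fun w => D w * s w)].

Lemma measurable_cos_add (u : Omega -> R) th : measurable_fun setT u ->
  measurable_fun setT (fun w => cos (u w + th)).
Proof.
move=> mu; apply: (@measurableT_comp _ _ _ _ _ _ (@cos R)).
  by apply: continuous_measurable_fun; exact: continuous_cos.
exact: measurable_funD.
Qed.

Lemma integrable_mul_bounded (D s : Omega -> R) (C : R) :
  P.-integrable setT (EFin \o D) -> measurable_fun setT s ->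
  (forall w, `|s w| <= C) -> P.-integrable setT (EFin \o (fun w => D w * s w)).
Proof.
move=> iD ms sC.
have mD : measurable_fun setT D by apply/measurable_EFinP; exact: measurable_int iD.
apply: (le_integrable measurableT _ _ (integrableZl measurableT C
  (integrable_norm iD))).
  by apply/measurable_EFinP; exact: measurable_funM.
move=> w _; rewrite -EFinM/= lee_fin normrM mulrC.
apply: le_trans (ler_wpM2r (normr_ge0 _) (sC w)) _; exact: ler_norm.
Qed.

Lemma trig_orth_cvg (D_ : nat -> Omega -> R) (D g : Omega -> R) :
  (forall n, trig_orth (D_ n)) -> (forall w, D_ n w @[n --> \oo] --> D w) ->
  P.-integrable setT (EFin \o g) -> (forall n w, `|D_ n w| <= g w) -> trig_orth D.
Proof.
move=> oD cD ig Dg.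
have mD n : measurable_fun setT (D_ n).
  by apply/measurable_EFinP; exact: measurable_int (oD n).1.
split; first by have [] := Rintegral_dominated_cvg _ _ _ P D_ D g mD cD ig Dg.
move=> u th Lu.
have [||||_ H] := Rintegral_dominated_cvg _ _ _ P (fun n w => D_ n w * cos (u w
  + th))
  (fun w => D w * cos (u w + th)) g.
- by move=> n; apply: measurable_funM => //; apply: measurable_cos_add; exact: Lm.
- by move=> w; apply: cvgM; [exact: cD|exact: cvg_cst].
- by [].
- by move=> n w; rewrite normrM (le_trans _ (Dg n w))// ler_piMr// cos_max.
rewrite -(cvg_lim _ H)//.
under eq_fun do rewrite (oD _).2//.
by apply: cvg_lim => //; exact: cvg_cst.
Qed.

Lemma trig_orthD (D1 D2 : Omega -> R) (c : R) : trig_orth D1 -> trig_orth D2 ->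
  trig_orth (fun w => D1 w + c * D2 w).
Proof.
move=> [i1 o1] [i2 o2].
have i2' := integrableZl measurableT c i2.
split; first exact: (integrableD measurableT i1 i2').
move=> u th Lu.
have mc : measurable_fun setT (fun w => cos (u w + th)) by apply:
  measurable_cos_add; exact: Lm.
have j1 := integrable_mul_bounded _ _ _ i1 mc (fun w => cos_max _).
have j2 := integrable_mul_bounded _ _ _ i2 mc (fun w => cos_max _).
transitivity (\int[P]_w (D1 w * cos (u w + th) + c * (D2 w * cos (u w + th)))).
  by apply: eq_Rintegral => w _; ring.
rewrite (RintegralD measurableT j1 (integrableZl measurableT c j2)).
by rewrite (RintegralZl _ measurableT j2) o1// o2// mulr0 addr0.
Qed.

Lemma trig_orth_int0 D : trig_orth D -> \int[P]_w D w = 0.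
Proof.
move=> [_ /(_ _ 0 L0)]; rewrite addr0 cos0 => <-.
by apply: eq_Rintegral => w _; rewrite mulr1.
Qed.

(** cos a cos b = (cos (a + b) + cos (a - b)) / 2, and [LD] puts v + u and v - u in [L]. *)
Lemma trig_orth_cos D u th : L u -> trig_orth D ->
  trig_orth (fun w => D w * cos (u w + th)).
Proof.
move=> Lu [iD oD].
have mc v t : L v -> measurable_fun setT (fun w => cos (v w + t)).
  by move=> Lv; apply: measurable_cos_add; exact: Lm.
split; first exact: (integrable_mul_bounded _ _ _ iD (mc _ _ Lu) (fun w =>
  cos_max _)).
move=> v t Lv.
have Lp : L (fun w => v w + 1 * u w) by exact: LD.
have Ln : L (fun w => v w + (- 1) * u w) by exact: LD.
have jp := integrable_mul_bounded _ _ _ iD (mc _ (t + th) Lp) (fun w => cos_max _).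
have jn := integrable_mul_bounded _ _ _ iD (mc _ (t - th) Ln) (fun w => cos_max _).
transitivity (\int[P]_w (2^-1 * (D w * cos (v w + 1 * u w + (t + th))) +
    2^-1 * (D w * cos (v w + (- 1) * u w + (t - th))))).
  apply: eq_Rintegral => w _.
  have -> : v w + 1 * u w + (t + th) = (v w + t) + (u w + th) by ring.
  have -> : v w + (- 1) * u w + (t - th) = (v w + t) - (u w + th) by ring.
  by move: (v w + t) (u w + th) => x y; rewrite cosD cosB; field.
rewrite (RintegralD measurableT (integrableZl measurableT _ jp) (integrableZl
  measurableT _ jn)).
by rewrite (RintegralZl _ measurableT jp) (RintegralZl _ measurableT jn) !oD//
  !mulr0 addr0.
Qed.

Lemma orth_multiplier_cos u th : L u -> orth_multiplier (fun w => cos (u w + th)).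
Proof.
move=> Lu; split; [by apply: measurable_cos_add; exact: Lm|by move=> w;
  exact: cos_max|].
by move=> D; exact: trig_orth_cos.
Qed.

Lemma orth_multiplierM s1 s2 : orth_multiplier s1 -> orth_multiplier s2 ->
  orth_multiplier (fun w => s1 w * s2 w).
Proof.
move=> [m1 b1 o1] [m2 b2 o2]; split; first exact: measurable_funM.
  by move=> w; rewrite normrM mulr_ile1.
by move=> D /o1/o2; congr trig_orth; apply/funext => w; rewrite mulrA.
Qed.

Lemma orth_multiplier_lin s1 s2 a b : orth_multiplier s1 -> orth_multiplier s2 ->
  (forall w, `|a * s1 w + b * s2 w| <= 1) ->
  orth_multiplier (fun w => a * s1 w + b * s2 w).
Proof.
move=> [m1 b1 o1] [m2 b2 o2] le1; split=> //.
  by apply: measurable_funD; exact: measurable_funM.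
move=> D oD.
(* [trig_orthD] gives its first argument the coefficient 1, so the combination is built up from D s1
   - D s1 = 0. *)
have H0 := trig_orthD _ _ (- 1) (o1 _ oD) (o1 _ oD).
have H1 := trig_orthD _ _ a H0 (o1 _ oD).
have H2 := trig_orthD _ _ b H1 (o2 _ oD).
move: H2; congr trig_orth; apply/funext => w; ring.
Qed.

Lemma orth_multiplier_cvg (s_ : nat -> Omega -> R) (s : Omega -> R) :
  (forall n, orth_multiplier (s_ n)) -> (forall w, s_ n w @[n --> \oo] --> s w) ->
  orth_multiplier s.
Proof.
move=> os cs; split.
- have ms n : measurable_fun setT (s_ n) by have [] := os n.
  by apply: (@measurable_fun_cvg _ _ _ setT s_) => // w _; exact: cs.
- move=> w.
  have H : `|s_ n w| @[n --> \oo] --> `|s w| by apply: cvg_norm; exact: cs.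
  rewrite -(cvg_lim _ H)//; apply: limr_le.
    by apply/cvg_ex; eexists; exact: H.
  by apply: nearW => n; have [_ + _] := os n; exact.
- move=> D oD; have iD := oD.1.
  apply: (trig_orth_cvg (fun n w => D w * s_ n w) _ (fun w => `|D w|)).
  + by move=> n; have [_ _] := os n; exact.
  + by move=> w; apply: cvgM; [exact: cvg_cst|exact: cs].
  + exact: integrable_norm.
  + by move=> n w; rewrite normrM ler_piMr//; have [_ + _] := os n; exact.
Qed.

Lemma orth_multiplier_sgn s : orth_multiplier s ->
  orth_multiplier (fun w => Num.sg (s w)).
Proof.
move=> os; have [ms s1 _] := os.
apply: (orth_multiplier_cvg (fun n w => iter n (@sgn_step R) (s w))); last first.
  by move=> w; exact: iter_sgn_step_cvg.
elim=> // n IH /=.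
have E : (fun w => sgn_step R (iter n (sgn_step R) (s w))) =
  (fun w => (3 / 2) * iter n (sgn_step R) (s w) + (- 2^-1) *
   (iter n (sgn_step R) (s w) * (iter n (sgn_step R) (s w) * iter n (sgn_step R)
     (s w)))).
  by apply/funext => w; rewrite {1}/sgn_step; field.
rewrite E; apply: orth_multiplier_lin => //.
  by apply: orth_multiplierM => //; exact: orth_multiplierM.
move=> w; have := congr1 (fun f => f w) E => /= <-.
by apply: sgn_step_norm; exact: iter_sgn_step_norm.
Qed.

(* [sg (sin ((u - c) / n))] tends to [sg (u - c)]. *)
Lemma orth_multiplier_sgn_sub u c : L u -> orth_multiplier (fun w => Num.sg (u w
  - c)).
Proof.
move=> Lu.
apply: (orth_multiplier_cvg (fun n w => Num.sg (sin ((u w - c) / n.+1%:R)))) =>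
  [n|w].
  apply: orth_multiplier_sgn.
  (* A sine is a cosine with phase - pi / 2; the form 0 + c u is the one that [LD] provides. *)
  rewrite (_ : (fun w => _) = (fun w => cos (0 + n.+1%:R^-1 * u w + (- c /
    n.+1%:R - pi / 2)))).
    by apply: orth_multiplier_cos; apply: LD.
  by apply/funext => w; rewrite -cosBpihalf; congr cos; ring.
apply: cvg_near_cst; near=> n.
have n0 : 0 < n.+1%:R :> R by rewrite ltr0n.
set y := u w - c.
(* Once |y| / (n + 1) < pi, the sine of y / (n + 1) has the sign of y, so the sequence is eventually
   constant. *)
have yn : `|y| / n.+1%:R < pi.
  rewrite ltr_pdivrMr// -ltr_pdivrMl ?pi_gt0//.
  apply: (@lt_trans _ _ n%:R); last by rewrite ltr_nat.
  near: n; exact: nbhs_infty_gtr.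
have [y0|y0|->] := ltrgt0P y; last by rewrite mul0r sin0.
  rewrite [RHS]gtr0_sg// gtr0_sg// sin_gt0_pi// divr_gt0//=.
  by rewrite -(gtr0_norm y0).
rewrite [RHS]ltr0_sg// ltr0_sg// -oppr_gt0 -sinN -mulNr sin_gt0_pi//.
by rewrite divr_gt0 ?oppr_gt0//= -(ltr0_norm y0).
Unshelve. all: by end_near. Qed.

Lemma orth_multiplier_gt u c : L u -> orth_multiplier (\1_[set w | c < u w]).
Proof.
move=> Lu; have os := orth_multiplier_sgn_sub u c Lu.
(* For t in {-1, 0, 1}, (t + t^2) / 2 is 1 if t = 1 and 0 otherwise. *)
rewrite (_ : \1__ = (fun w => 2^-1 * Num.sg (u w - c) +
    2^-1 * (Num.sg (u w - c) * Num.sg (u w - c)))); last first.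
  apply/funext => w; rewrite indicE.
  have -> : (w \in [set w | c < u w]) = (0 < u w - c).
    by rewrite subr_gt0; apply/idP/idP; rewrite inE.
  by case: sgrP => _ /=; field.
apply: orth_multiplier_lin => //; first exact: orth_multiplierM.
move=> w; case: sgrP => _; rewrite ?mulr0 ?addr0 ?normr0// ?mulr1.
  by rewrite ler_norml; apply/andP; split; lra.
by rewrite ler_norml; apply/andP; split; lra.
Qed.

Lemma orth_multiplier1 : orth_multiplier (cst 1).
Proof.
rewrite (_ : cst 1 = (fun w => cos ((fun=> 0) w + 0)));
  first exact: orth_multiplier_cos.
by apply/funext => w; rewrite addr0 cos0.
Qed.

Definition orth_system : set (set Omega) :=
  [set B | measurable B /\ orth_multiplier (\1_B)].

(** Complements correspond to 1 - 1_B, intersections to products, and a countable union is the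
    pointwise limit of finite ones. Since multipliers are closed under products, no monotone class
    argument intervenes. *)
Lemma sigma_algebra_orth_system : sigma_algebra setT orth_system.
Proof.
have cC B : orth_system B -> orth_system (~` B).
  move=> [mB oB]; split; first exact: measurableC.
  rewrite (_ : \1__ = (fun w => 1 * cst 1 w + (- 1) * (\1_B : Omega -> R) w)).
    apply: orth_multiplier_lin => //; first exact: orth_multiplier1.
    by move=> w /=; rewrite indicE; case: (_ \in _);
      rewrite /= ?mulr1 ?mulr0 ?addr0 ?subrr ?normr0// normr1.
  by apply/funext => w; rewrite !indicE in_setC; case: (_ \in _) => /=; ring.
have cI B C : orth_system B -> orth_system C -> orth_system (B `&` C).
  move=> [mB oB] [mC oC]; split; first exact: measurableI.
  by rewrite indicI; exact: orth_multiplierM.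
have o0 : orth_system set0.
  rewrite -[set0]setCT; apply: cC; split=> //.
  by rewrite indicT; exact: orth_multiplier1.
have cU B C : orth_system B -> orth_system C -> orth_system (B `|` C).
  by move=> oB oC; rewrite -[B `|` C]setCK setCU; apply/cC/cI; exact: cC.
split=> //.
- by move=> B oB; rewrite setTD; exact: cC.
- move=> F oF; split.
    by apply: bigcupT_measurable => n; have [] := oF n.
  have oU n : orth_system (\big[setU/set0]_(i < n) F i).
    by elim: n => [|n IH]; rewrite ?big_ord0// big_ord_recr/=; exact: cU.
  apply: (orth_multiplier_cvg (fun n => \1_(\big[setU/set0]_(i < n) F i))).
    by move=> n; have [] := oU n.
  move=> w; have [[k _ Fk]|nF] := pselect ((\bigcup_i F i) w).
    apply: cvg_near_cst; near=> n; rewrite !indicE [in RHS]mem_set;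
      last by exists k.
    rewrite mem_set//; rewrite -bigcup_mkord; exists k => //=.
    near: n; exact: nbhs_infty_gt.
  apply: cvg_near_cst; apply: nearW => n; rewrite !indicE [in RHS]memNset//
    memNset//.
  by rewrite -bigcup_mkord => -[k _ Fk]; apply: nF; exists k.
Unshelve. all: by end_near. Qed.

(** The sets [U] with this property form a sigma-algebra that contains the rays ]c, +oo[, which
    generate the Borel sets. *)
Lemma orth_system_preimage u (U : set R) : L u -> measurable U ->
  orth_system (u @^-1` U).
Proof.
move=> Lu.
have [h1 h2 h3] := sigma_algebra_orth_system.
have S : sigma_algebra setT [set U : set R | orth_system (u @^-1` U)].
  split=> /=.
  - by rewrite preimage_set0.
  - by move=> V; rewrite !setTD preimage_setC => /h2; rewrite setTD.
  - by move=> F oF; rewrite preimage_bigcup; exact: h3.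
have -> : (measurable : set (set R)) = <<s @RGenOInfty.G R >> by exact:
  RGenOInfty.measurableE.
move=> /(smallest_sub S); apply=> _ [c ->] /=.
split; last by rewrite (_ : _ @^-1` _ = [set w | c < u w]);
  [exact: orth_multiplier_gt|apply/seteqP; split=> w /=; rewrite in_itv/= andbT].
by rewrite -[X in measurable X]setTI; apply: Lm.
Qed.

End trig_orthogonality.

Arguments trig_orth {d Omega R} P L D.
Arguments orth_multiplier {d Omega R} P L s.
Arguments orth_system {d Omega R} P L.
Arguments measurable_cos_add {d Omega R} u th.
Arguments integrable_mul_bounded {d Omega R P D s} C.
Arguments trig_orth_int0 {d Omega R P L} L0 {D}.
Arguments orth_multiplier1 {d Omega R P L}.

(** * Conditional moments of a Gaussian variable uncorrelated with a subspace *)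

Section gaussian_independence.
Context d (Omega : measurableType d) (R : realType).
Variables (P : probability Omega R) (L : set (Omega -> R)).
Hypothesis LD : forall u v (c : R), L u -> L v -> L (fun w => u w + c * v w).
Hypothesis Lm : forall u, L u -> measurable_fun setT u.
Hypothesis L2 : forall u, L u -> P.-integrable setT (EFin \o (fun w => u w ^+ 2)).
Hypothesis Lchar : forall u th, L u -> \int[P]_w cos (u w + th) =
  cos th * expR (- ((\int[P]_w (u w) ^+ 2) / 2)).

Lemma integrable_mul_sqr (u v : Omega -> R) : measurable_fun setT u ->
  measurable_fun setT v ->
  P.-integrable setT (EFin \o (fun w => u w ^+ 2)) ->
  P.-integrable setT (EFin \o (fun w => v w ^+ 2)) ->
  P.-integrable setT (EFin \o (fun w => u w * v w)).
Proof.
move=> mu mv iu iv.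
apply: (le_integrable measurableT _ _ (integrableD measurableT iu iv)).
  by apply/measurable_EFinP; exact: measurable_funM.
move=> w _ /=; rewrite lee_fin; apply: le_trans (ler_norm _).
by rewrite ler_norml; apply/andP; have := sqr_ge0 (u w + v w);
  have := sqr_ge0 (u w - v w);
  have := sqr_ge0 (u w); have := sqr_ge0 (v w); split; nra.
Qed.

Lemma integrable_bounded (s : Omega -> R) (C : R) : measurable_fun setT s ->
  (forall w, `|s w| <= C) -> P.-integrable setT (EFin \o s).
Proof.
move=> ms sC.
have -> : s = (fun w => cst 1 w * s w) by apply/funext => w; rewrite mul1r.
apply: (integrable_mul_bounded C) => //.
exact: finite_measure_integrable_cst.
Qed.

Let int2 (u v : Omega -> R) (c : R) : L u -> L v ->
  \int[P]_w (u w + c * v w) ^+ 2 = \int[P]_w (u w) ^+ 2 +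
    2 * c * (\int[P]_w (u w * v w)) + c ^+ 2 * \int[P]_w (v w) ^+ 2.
Proof.
move=> Lu Lv.
have iu := L2 _ Lu; have iv := L2 _ Lv.
have iuv := integrable_mul_sqr _ _ (Lm _ Lu) (Lm _ Lv) iu iv.
have i1 := integrableZl measurableT (2 * c) iuv.
have i2 := integrableZl measurableT (c ^+ 2) iv.
transitivity (\int[P]_w ((u w ^+ 2 + 2 * c * (u w * v w)) + c ^+ 2 * v w ^+ 2)).
  by apply: eq_Rintegral => w _; ring.
rewrite (RintegralD measurableT (integrableD measurableT iu i1) i2).
by rewrite (RintegralD measurableT iu i1) (RintegralZl _ measurableT iuv)
  (RintegralZl _ measurableT iv).
Qed.

Variables (V : Omega -> R) (U : set (Omega -> R)).
Hypothesis LV : L V.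
Hypothesis UL : U `<=` L.
Hypothesis U0 : U (fun=> 0).
Hypothesis UD : forall u v (c : R), U u -> U v -> U (fun w => u w + c * v w).
Hypothesis UV : forall u, U u -> \int[P]_w (V w * u w) = 0.

Let v := \int[P]_w (V w) ^+ 2.
(** The characteristic function of [V], real because [V] is a centered Gaussian variable. *)
Let kappa (s : R) := expR (- (s ^+ 2 * v / 2)).

Let L0 : L (fun=> 0). Proof. exact: UL. Qed.

Let LZ (s : R) : L (fun w => s * V w).
Proof. by rewrite (_ : (fun w => _) = (fun w => 0 + s * V w));
  [exact: LD|apply/funext => w; rewrite add0r]. Qed.

Let mcos (u : Omega -> R) th : L u -> measurable_fun setT (fun w => cos (u w + th)).
Proof. by move=> Lu; apply: measurable_cos_add; exact: Lm. Qed.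

(** For [u] in [U] the variances of u + sV and u - sV both equal E[u^2] + s^2 E[V^2], so by [Lchar]
    the expectation of cos (u + t) cos (sV + th) factorizes. *)
Lemma trig_orth_uncorrelated s th : trig_orth P U (fun w => cos (s * V w + th) -
  kappa s * cos th).
Proof.
have i1 : P.-integrable setT (EFin \o (fun w => cos (s * V w + th))).
  by apply: (integrable_bounded _ 1); [exact: (mcos (fun w => s * V w))|move=> w;
    exact: cos_max].
have i2 : P.-integrable setT (EFin \o cst (kappa s * cos th)).
  exact: finite_measure_integrable_cst.
split; first exact: (integrableB measurableT i1 i2).
move=> u t Uu; have Lu := UL _ Uu.
have Lp : L (fun w => u w + s * V w) by exact: LD.
have Ln : L (fun w => u w + (- s) * V w) by exact: LD.
have jp : P.-integrable setT (EFin \o (fun w => cos (u w + s * V w + (t + th)))).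
  by apply: (integrable_bounded _ 1); [exact: mcos|move=> w; exact: cos_max].
have jn : P.-integrable setT (EFin \o (fun w => cos (u w + (- s) * V w + (t -
  th)))).
  by apply: (integrable_bounded _ 1); [exact: mcos|move=> w; exact: cos_max].
have ju : P.-integrable setT (EFin \o (fun w => cos (u w + t))).
  by apply: (integrable_bounded _ 1); [exact: mcos|move=> w; exact: cos_max].
have k1 := integrableZl measurableT 2^-1 jp.
have k2 := integrableZl measurableT 2^-1 jn.
have k3 := integrableZl measurableT (kappa s * cos th) ju.
transitivity (\int[P]_w ((2^-1 * cos (u w + s * V w + (t + th)) +
   2^-1 * cos (u w + (- s) * V w + (t - th))) - kappa s * cos th * cos (u w + t))).
  apply: eq_Rintegral => w _.
  have -> : u w + s * V w + (t + th) = (u w + t) + (s * V w + th) by ring.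
  have -> : u w + (- s) * V w + (t - th) = (u w + t) - (s * V w + th) by ring.
  by move: (u w + t) (s * V w + th) => x y; rewrite cosD cosB; field.
rewrite (RintegralB measurableT (integrableD measurableT k1 k2) k3).
rewrite (RintegralD measurableT k1 k2) (RintegralZl _ measurableT jp)
  (RintegralZl _ measurableT jn) (RintegralZl _ measurableT ju).
rewrite (Lchar _ _ Lp) (Lchar _ _ Ln) (Lchar _ _ Lu) !int2//.
have uV0 : \int[P]_w (u w * V w) = 0.
  by rewrite -(UV _ Uu); apply: eq_Rintegral => w _; rewrite mulrC.
rewrite uV0 !mulr0 !addr0 sqrrN -/v /kappa.
set q := \int[P]_w _.
have -> : - ((q + s ^+ 2 * v) / 2) = - (s ^+ 2 * v / 2) - q / 2 by field.
by rewrite expRD cosD cosB; field.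
Qed.

(* The first two conditional moments of [V] are read off the conditional
   characteristic function with [sin (s V) / s] and [(sin (s V) / s)^2]. *)
Lemma cos_orth_system s th B : orth_system P U B ->
  \int[P]_w (cos (s * V w + th) * \1_B w) = kappa s * cos th * fine (P B).
Proof.
move=> sB; have [mB [_ _ oB]] := sB.
have H := trig_orth_int0 U0 (oB _ (trig_orth_uncorrelated s th)).
have mI : measurable_fun setT (\1_B : Omega -> R) by exact: measurable_indic.
have jB : P.-integrable setT (EFin \o (\1_B : Omega -> R)).
  by apply: (integrable_bounded _ 1) => // w; rewrite indicE; case: (_ \in _);
    rewrite ?normr1 ?normr0.
have jc : P.-integrable setT (EFin \o (fun w => cos (s * V w + th) * \1_B w)).
  apply: (integrable_bounded _ 1).
    by apply: measurable_funM => //; exact: (mcos (fun w => s * V w)).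
  move=> w; rewrite normrM mulr_ile1 ?cos_max//.
  by rewrite indicE; case: (_ \in _); rewrite ?normr1 ?normr0.
move: H.
have -> : \int[P]_w ((cos (s * V w + th) - kappa s * cos th) * \1_B w) =
  \int[P]_w (cos (s * V w + th) * \1_B w - kappa s * cos th * \1_B w).
  by apply: eq_Rintegral => w _; ring.
rewrite (RintegralB measurableT jc (integrableZl measurableT _ jB)).
rewrite (RintegralZl _ measurableT jB) => /eqP; rewrite subr_eq0 => /eqP ->.
by congr (_ * _); rewrite /Rintegral integral_indic// setIT.
Qed.

Lemma orth_system_setT : orth_system P U setT.
Proof.
split=> //; rewrite indicT; apply: orth_multiplier1 => //.
by move=> u Uu; apply: Lm; exact: UL.
Qed.

Let iV : P.-integrable setT (EFin \o V).
Proof.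
have i1 : P.-integrable setT (EFin \o cst (1 : R)) by exact:
  finite_measure_integrable_cst.
apply: (le_integrable measurableT _ _ (integrableD measurableT (L2 _ LV) i1)).
  by apply/measurable_EFinP; exact: Lm.
move=> w _ /=; rewrite lee_fin; apply: le_trans (ler_norm _).
by rewrite ler_norml; apply/andP; have := sqr_ge0 (V w + 1);
  have := sqr_ge0 (V w - 1);
   have := sqr_ge0 (V w); split; nra.
Qed.

Let sin_lin_le (x : R) n : `|n.+1%:R * sin (x / n.+1%:R)| <= `|x|.
Proof.
have n0 : 0 < n.+1%:R :> R by rewrite ltr0n.
rewrite normrM (gtr0_norm n0) -ler_pdivlMl//.
by apply: le_trans (normr_sin_le _ _) _; rewrite normrM normfV (gtr0_norm n0) mulrC.
Qed.

Let msin n : measurable_fun setT (fun w => sin (V w / n.+1%:R)).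
Proof.
apply: (@measurableT_comp _ _ _ _ _ _ (@sin R)).
  by apply: continuous_measurable_fun; exact: continuous_sin.
by apply: measurable_funM => //; exact: Lm.
Qed.

(** At the phase - pi / 2 the right-hand side of [cos_orth_system] vanishes, and n sin (V / n) tends
    to [V] while being dominated by |V|. *)
Lemma orth_system_int1 B : orth_system P U B -> \int[P]_w (V w * \1_B w) = 0.
Proof.
move=> oB; have [mB _] := oB.
have mI : measurable_fun setT (\1_B : Omega -> R) by exact: measurable_indic.
have [||||_ H] := Rintegral_dominated_cvg _ _ _ P
  (fun n w => n.+1%:R * sin (V w / n.+1%:R) * \1_B w) (fun w => V w * \1_B w)
    (fun w => `|V w|).
- by move=> n; apply: measurable_funM => //; apply: measurable_funM.
- by move=> w; apply: cvgM; [exact: natr_sin_cvg|exact: cvg_cst].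
- exact: integrable_norm.
- move=> n w; rewrite normrM (le_trans _ (sin_lin_le (V w) n))// ler_piMr//.
  by rewrite indicE; case: (_ \in _); rewrite ?normr1 ?normr0.
rewrite -(cvg_lim _ H)//.
have E n : \int[P]_w (n.+1%:R * sin (V w / n.+1%:R) * \1_B w) = 0.
  have := cos_orth_system n.+1%:R^-1 (- (pi / 2)) B oB.
  rewrite cosN cos_pihalf mulr0 mul0r.
  have -> : \int[P]_w (cos (n.+1%:R^-1 * V w - pi / 2) * \1_B w) =
            \int[P]_w (sin (V w / n.+1%:R) * \1_B w).
    by apply: eq_Rintegral => w _; rewrite cosBpihalf; congr (sin _ * _);
      rewrite mulrC.
  move=> H0; under eq_Rintegral do rewrite -mulrA.
  rewrite RintegralZl// ?H0 ?mulr0//.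
  apply: (integrable_bounded _ 1); first exact: measurable_funM.
  move=> w; rewrite normrM mulr_ile1 ?sin_max//.
  by rewrite indicE; case: (_ \in _); rewrite ?normr1 ?normr0.
by under eq_fun do rewrite E; apply: cvg_lim => //; exact: cvg_cst.
Qed.

(** Since sin^2 x = (1 - cos 2x) / 2, the approximations of the left-hand side are P(B) times a
    sequence that does not depend on [B]. Taking the whole space for [B] identifies the limit of
    this sequence as [v], without an expansion of [kappa]. *)
Lemma orth_system_int2 B : orth_system P U B ->
  \int[P]_w (V w ^+ 2 * \1_B w) = v * fine (P B).
Proof.
pose b (C : set Omega) n := \int[P]_w ((n.+1%:R * sin (V w / n.+1%:R)) ^+ 2 *
  \1_C w).
have bE C n : orth_system P U C -> b C n = n.+1%:R ^+ 2 / 2 * (1 - kappa (2 /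
  n.+1%:R)) * fine (P C).
  move=> oC; have [mC _] := oC.
  have mI : measurable_fun setT (\1_C : Omega -> R) by exact: measurable_indic.
  have jC : P.-integrable setT (EFin \o (\1_C : Omega -> R)).
    by apply: (integrable_bounded _ 1) => // w; rewrite indicE; case: (_ \in _);
      rewrite ?normr1 ?normr0.
  have jc : P.-integrable setT (EFin \o (fun w => cos (2 / n.+1%:R * V w + 0) *
    \1_C w)).
    apply: (integrable_bounded _ 1).
      by apply: measurable_funM => //; exact: (mcos (fun w => 2 / n.+1%:R * V w)).
    move=> w; rewrite normrM mulr_ile1 ?cos_max//.
    by rewrite indicE; case: (_ \in _); rewrite ?normr1 ?normr0.
  transitivity (\int[P]_w (n.+1%:R ^+ 2 / 2 * (\1_C w - cos (2 / n.+1%:R * V w +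
    0) * \1_C w))).
    apply: eq_Rintegral => w _.
    have -> : 2 / n.+1%:R * V w + 0 = (V w / n.+1%:R) *+ 2 by ring.
    by rewrite cos_mulr2n -mulr_natr cos2sin2; field.
  rewrite (RintegralZl _ measurableT (integrableB measurableT jC jc)).
  rewrite (RintegralB measurableT jC jc) cos_orth_system// cos0 mulr1.
  rewrite {1}/Rintegral integral_indic// setIT.
  by rewrite -mulrA; congr (_ * _); ring.
have bcvg C : measurable C -> b C n @[n --> \oo] --> \int[P]_w (V w ^+ 2 * \1_C w).
  move=> mC.
  have mI : measurable_fun setT (\1_C : Omega -> R) by exact: measurable_indic.
  have [||||_ H] := Rintegral_dominated_cvg _ _ _ P
    (fun n w => (n.+1%:R * sin (V w / n.+1%:R)) ^+ 2 * \1_C w)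
    (fun w => V w ^+ 2 * \1_C w) (fun w => V w ^+ 2).
  - by move=> n; apply: measurable_funM => //; apply: measurable_funX;
    apply: measurable_funM.
  - by move=> w; apply: cvgM; [apply: cvgM; exact: natr_sin_cvg|exact: cvg_cst].
  - exact: L2.
  - move=> n w; rewrite normrM ger0_norm ?sqr_ge0//.
    apply: (@le_trans _ _ ((n.+1%:R * sin (V w / n.+1%:R)) ^+ 2)).
      rewrite ler_piMr ?sqr_ge0//.
      by rewrite indicE; case: (_ \in _); rewrite ?normr1 ?normr0.
    rewrite -[leLHS]real_normK ?num_real// -[leRHS]real_normK ?num_real//.
    by rewrite lerXn2r ?nnegrE.
  exact: H.
move=> oB; have [mB _] := oB.
have HB := bcvg _ mB.
have HT := bcvg _ (@measurableT _ Omega).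
have ET : \int[P]_w (V w ^+ 2 * \1_setT w) = v.
  by apply: eq_Rintegral => w _; rewrite indicT mulr1.
rewrite ET in HT.
have PT : fine (P setT) = 1 by rewrite probability_setT.
rewrite -(cvg_lim _ HB)//; apply: cvg_lim => //.
under eq_fun do rewrite (bE _ _ oB).
apply: cvgM; last exact: cvg_cst.
move: HT; under eq_fun do rewrite (bE _ _ orth_system_setT) PT mulr1.
exact.
Qed.

End gaussian_independence.

(** * The linear span of a Gaussian field *)

Section gaussian_field_span.
Context d (Omega : measurableType d) (R : realType) (X : countType).
Variables (P : probability Omega R) (Z : X -> {RV P >-> R}) (K : X -> X -> R).
Hypothesis hZ : centered_gaussian_field K Z.

Definition field_span : set (Omega -> R) := [set f | exists (B : {fset X}) (c :
  X -> R),
  f = fun w => \sum_(x <- B) c x * Z x w].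

Lemma field_span_measurable f : field_span f -> measurable_fun setT f.
Proof.
move=> [B [c ->]]; apply: measurable_sum => x; apply: measurable_funM => //.
Qed.

Lemma field_span_sum (B : {fset X}) (c : X -> R) :
  field_span (fun w => \sum_(x <- B) c x * Z x w).
Proof. by exists B, c. Qed.

Lemma field_span_field x : field_span (Z x).
Proof.
exists [fset x]%fset, (cst 1); apply/funext => w.
by rewrite big_seq_fset1 mul1r.
Qed.

Let sum_widen (B D : {fset X}) (b F : X -> R) : (B `<=` D)%fset ->
  \sum_(x <- B) b x * F x = \sum_(x <- D) (if x \in B then b x else 0) * F x.
Proof.
move=> BD; transitivity (\sum_(x <- B) (if x \in B then b x else 0) * F x).
  by apply: eq_big_seq => x ->.
by apply: big_fset_incl => // x _ /negbTE ->; rewrite mul0r.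
Qed.

Lemma field_spanD f g (c : R) : field_span f -> field_span g ->
  field_span (fun w => f w + c * g w).
Proof.
move=> [B [b ->]] [C [e ->]].
exists (B `|` C)%fset, (fun x => (if x \in B then b x else 0) + c * (if x \in C
  then e x else 0)).
apply/funext => w.
rewrite (sum_widen _ _ _ _ (fsubsetUl B C)) (sum_widen _ _ _ _ (fsubsetUr B C)).
rewrite mulr_sumr -big_split/=; apply: eq_bigr => x _; ring.
Qed.

Lemma field_span0 : field_span (fun=> 0).
Proof. by exists fset0, (cst 0); apply/funext => w; rewrite big_seq_fset0. Qed.

Let law f : field_span f -> exists m v : R, 0 <= v /\
  forall U : set R, measurable U -> P [set w | U (f w)] = gaussian_prob m v U.
Proof. by move=> [B [c ->]]; have [G _ _] := hZ; exact: G. Qed.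

Lemma field_span_integrable f : field_span f -> P.-integrable setT (EFin \o f).
Proof.
move=> Lf; have [m [v [v0 H]]] := law _ Lf.
exact: (integrable_gaussian _ _ _ _ _ _ _ (field_span_measurable _ Lf) v0 H).
Qed.

Lemma field_span_integrable_sqr f : field_span f ->
  P.-integrable setT (EFin \o (fun w => f w ^+ 2)).
Proof.
move=> Lf; have [m [v [v0 H]]] := law _ Lf.
exact: (integrable_gaussian_sqr _ _ _ _ _ _ _ (field_span_measurable _ Lf) v0 H).
Qed.

Lemma field_span_centered f : field_span f -> \int[P]_w f w = 0.
Proof.
have Z0 x : \int[P]_w Z x w = 0.
  have [_ /(_ x) + _] := hZ; rewrite expectation_def => E.
  by rewrite /Rintegral E.
suff S (s : seq X) (c : X -> R) :
    P.-integrable setT (EFin \o (fun w => \sum_(x <- s) c x * Z x w)) /\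
    \int[P]_w (\sum_(x <- s) c x * Z x w) = 0.
  by move=> [B [c ->]]; have [] := S B c.
elim: s => [|x s [IH1 IH2]].
  have E : (fun w => \sum_(x <- [::]) c x * Z x w) = cst 0.
    by apply/funext => w; rewrite big_nil.
  rewrite E; split; first exact: finite_measure_integrable_cst.
  by rewrite Rintegral_cst// mul0r.
have iZ := integrableZl measurableT (c x) (field_span_integrable _
  (field_span_field x)).
have E : (fun w => \sum_(x <- x :: s) c x * Z x w) =
    (fun w => c x * Z x w + \sum_(x <- s) c x * Z x w).
  by apply/funext => w; rewrite big_cons.
rewrite E; split; first exact: (integrableD measurableT iZ IH1).
rewrite (RintegralD measurableT iZ IH1) IH2 addr0.
by rewrite (RintegralZl _ measurableT (field_span_integrable _ (field_span_field
  x))) Z0 mulr0.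
Qed.

(** [gaussian_field] leaves the mean and the variance of a combination unspecified; centering forces
    the mean to be 0, and the variance is then the second moment. *)
Lemma field_span_char f th : field_span f -> \int[P]_w cos (f w + th) =
  cos th * expR (- ((\int[P]_w (f w) ^+ 2) / 2)).
Proof.
move=> Lf; have [m [v [v0 H]]] := law _ Lf.
have mf := field_span_measurable _ Lf.
have m0 : m = 0.
  by rewrite -(gaussian_mean _ _ _ _ _ _ _ mf v0 H) field_span_centered.
have := gaussian_variance _ _ _ _ _ _ _ mf v0 H.
have := gaussian_char _ _ _ _ _ _ _ mf v0 H th.
rewrite m0; under eq_Rintegral do rewrite subr0; move=> ->.
by under eq_Rintegral do rewrite subr0; move=> ->.
Qed.

Lemma field_cov x y : \int[P]_w (Z x w * Z y w) = K x y.
Proof.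
have [_ E C] := hZ; have := C x y; rewrite unlock !E /= => H.
rewrite /Rintegral; move: H; rewrite [in X in X -> _]unlock => H.
have -> : (\int[P]_w (Z x w * Z y w)%:E = (K x y)%:E)%E.
  rewrite -H; apply: eq_integral => w _ /=; congr EFin.
  by rewrite /GRing.mul/= !subr0.
by [].
Qed.

Lemma field_span_cov (B : {fset X}) (c : X -> R) g : field_span g ->
  \int[P]_w ((\sum_(x <- B) c x * Z x w) * g w) =
  \sum_(x <- B) c x * \int[P]_w (Z x w * g w).
Proof.
move=> Lg.
have iZg x : P.-integrable setT (EFin \o (fun w => Z x w * g w)).
  apply: integrable_mul_sqr.
  - exact: field_span_measurable (field_span_field x).
  - exact: field_span_measurable.
  - exact: field_span_integrable_sqr (field_span_field x).
  - exact: field_span_integrable_sqr.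
suff S (s : seq X) :
    P.-integrable setT (EFin \o (fun w => (\sum_(x <- s) c x * Z x w) * g w)) /\
    \int[P]_w ((\sum_(x <- s) c x * Z x w) * g w) =
    \sum_(x <- s) c x * \int[P]_w (Z x w * g w).
  by have [] := S B.
elim: s => [|x s [IH1 IH2]].
  rewrite big_nil.
  have E : (fun w => (\sum_(x <- [::]) c x * Z x w) * g w) = cst 0.
    by apply/funext => w; rewrite big_nil mul0r.
  rewrite E; split; first exact: finite_measure_integrable_cst.
  by rewrite Rintegral_cst// mul0r.
have iZ := integrableZl measurableT (c x) (iZg x).
have E : (fun w => (\sum_(x <- x :: s) c x * Z x w) * g w) =
    (fun w => c x * (Z x w * g w) + (\sum_(x <- s) c x * Z x w) * g w).
  by apply/funext => w; rewrite big_cons mulrDl mulrA.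
rewrite E; split; first exact: (integrableD measurableT iZ IH1).
rewrite (RintegralD measurableT iZ IH1) IH2 big_cons.
by rewrite (RintegralZl _ measurableT (iZg x)).
Qed.

End gaussian_field_span.
Arguments field_span {d Omega R X P} Z.

(** * Conditioning a Gaussian field on finitely many of its values *)

Section gaussian_field_conditioning.
Context d (Omega : measurableType d) (R : realType) (X : countType).
Variables (P : probability Omega R) (Z : X -> {RV P >-> R}) (K : X -> X -> R).
Hypothesis hZ : centered_gaussian_field K Z.
Variable A : {fset X}.

Notation residual b c := (fun w => Z b w - \sum_(a <- A) c a * Z a w).

Let Lm := @field_span_measurable _ _ _ _ P Z.
Let LD := @field_spanD _ _ _ _ P Z.
Let L1 := @field_span_integrable _ _ _ _ P Z K hZ.
Let L2 := @field_span_integrable_sqr _ _ _ _ P Z K hZ.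
Let Lc := @field_span_char _ _ _ _ P Z K hZ.

Let residual_span b (c : X -> R) : field_span Z (residual b c).
Proof.
rewrite (_ : residual b c = (fun w => Z b w + (- 1) * \sum_(a <- A) c a * Z a
  w)); last first.
  by apply/funext => w; rewrite mulN1r.
by apply: LD; [exact: field_span_field|exact: field_span_sum].
Qed.

Let prod_int f g : field_span Z f -> field_span Z g ->
  P.-integrable setT (EFin \o (fun w => f w * g w)).
Proof. by move=> Lf Lg; apply: integrable_mul_sqr;
  [exact: Lm|exact: Lm|exact: L2|exact: L2]. Qed.

Lemma residual_cov b c g : field_span Z g -> \int[P]_w ((residual b c) w * g w) =
  \int[P]_w (Z b w * g w) - \sum_(a <- A) c a * \int[P]_w (Z a w * g w).
Proof.
move=> Lg; rewrite -(field_span_cov _ _ _ _ _ _ _ hZ A c _ Lg).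
have i1 := prod_int _ _ (field_span_field _ _ _ _ P Z b) Lg.
have i2 := prod_int _ _ (field_span_sum _ _ _ _ P Z A c) Lg.
rewrite -(RintegralB measurableT i1 i2).
by apply: eq_Rintegral => w _; rewrite mulrBl.
Qed.

Definition normal_equations b (c : X -> R) :=
  {in A, forall a, K b a = \sum_(a' <- A) c a' * K a' a}.

Lemma residual_uncorrelated b c a : normal_equations b c -> a \in A ->
  \int[P]_w ((residual b c) w * Z a w) = 0.
Proof.
move=> nE aA; rewrite residual_cov; last exact: field_span_field.
rewrite (field_cov _ _ _ _ _ _ _ hZ) nE// -[RHS](subrr (\sum_(a' <- A) c a' * K
  a' a)).
by congr (_ - _); apply: eq_bigr => a' _; rewrite (field_cov _ _ _ _ _ _ _ hZ).
Qed.

Section uncorrelated.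
Variable V : Omega -> R.
Hypothesis LV : field_span Z V.
Hypothesis VA : {in A, forall a, \int[P]_w (V w * Z a w) = 0}.

(** A linear space, as the independence argument requires, which contains every [Z a] with a in [A];
    hence its [orth_system] contains the sigma-algebra of the [Z a]. *)
Let U : set (Omega -> R) := [set u | field_span Z u /\ \int[P]_w (V w * u w) = 0].

Let UD u v (c : R) : U u -> U v -> U (fun w => u w + c * v w).
Proof.
move=> [Lu Vu] [Lv Vv]; split; first exact: LD.
have i1 := prod_int _ _ LV Lu; have i2 := prod_int _ _ LV Lv.
transitivity (\int[P]_w (V w * u w + c * (V w * v w))).
  by apply: eq_Rintegral => w _; ring.
by rewrite (RintegralD measurableT i1 (integrableZl measurableT c i2))
  (RintegralZl _ measurableT i2) Vu Vv mulr0 addr0.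
Qed.

Let U0 : U (fun=> 0).
Proof.
split; first exact: field_span0.
by under eq_Rintegral do rewrite mulr0; rewrite Rintegral_cst// mul0r.
Qed.

Let UL : U `<=` field_span Z. Proof. by move=> u []. Qed.

Let Um u : U u -> measurable_fun setT u. Proof. by move=> [Lu _]; exact: Lm. Qed.

Lemma sigma_of_orth B : sigma_of Z A B -> orth_system P U B.
Proof.
apply: smallest_sub; first exact: (sigma_algebra_orth_system _ _ _ P U U0 UD Um).
move=> C [a aA [S mS <-]]; rewrite setTI.
apply: (orth_system_preimage _ _ _ P U U0 UD Um) => //; split;
  first exact: field_span_field.
exact: VA.
Qed.

Lemma sigma_of_measurable B : sigma_of Z A B -> measurable B.
Proof. by move=> /sigma_of_orth[]. Qed.

Lemma uncorrelated_int1 B : sigma_of Z A B -> \int[P]_w (V w * \1_B w) = 0.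
Proof.
move=> /sigma_of_orth; apply: (orth_system_int1 _ _ _ P _ LD Lm L2 Lc V U) => //.
by move=> u [].
Qed.

Lemma uncorrelated_int2 B : sigma_of Z A B ->
  \int[P]_w (V w ^+ 2 * \1_B w) = \int[P]_w (V w ^+ 2) * fine (P B).
Proof.
move=> /sigma_of_orth; apply: (orth_system_int2 _ _ _ P _ LD Lm L2 Lc V U) => //.
by move=> u [].
Qed.

End uncorrelated.

Let integral_restrict (f : Omega -> R) B : measurable B -> P.-integrable setT
  (EFin \o f) ->
  (\int[P]_(w in B) (f w)%:E = (\int[P]_w (f w * \1_B w))%:E)%E.
Proof.
move=> mB i1.
have i2 : P.-integrable setT (EFin \o (fun w => f w * \1_B w)).
  apply: (integrable_mul_bounded 1) => // w.
  by rewrite indicE; case: (_ \in _); rewrite ?normr1 ?normr0.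
rewrite /Rintegral fineK; last exact: (integrable_fin_num measurableT i2).
rewrite [LHS]integral_mkcond; apply: eq_integral => w _.
by rewrite patchE indicE; case: (_ \in _); rewrite ?mulr1 ?mulr0.
Qed.

Let sigma_of_preimage (c : X -> R) (U : set R) : measurable U ->
  sigma_of Z A ((fun w => \sum_(a <- A) c a * Z a w) @^-1` U).
Proof.
move=> mU.
pose G := \bigcup_(a in [set` A]) preimage_set_system setT (Z a) measurable.
(* The sample space with the sigma-algebra of the [Z a] only, so that the closure lemmas for
   measurable functions apply to it. *)
pose T := g_sigma_algebraType G.
have mZ a : a \in A -> @measurable_fun _ _ T _ setT (Z a : Omega -> R).
  move=> aA _ V mV; apply: sub_sigma_algebra; exists a => //.
  by exists V.
suff : @measurable_fun _ _ T _ setT (fun w => \sum_(a <- A) c a * Z a w : R).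
  by move=> /(_ measurableT U mU); rewrite setTI.
(* [measurable_sum] asks for the measurability of every term; the guard, which is true along the
   sum, supplies the membership in [A]. *)
have E : (fun w => \sum_(a <- A) c a * Z a w) =
    (fun w => \sum_(a <- A) if a \in A then c a * Z a w else 0).
  by apply/funext => w; rewrite [LHS]big_seq [RHS]big_seq;
    apply: eq_bigr => a aA; rewrite aA.
rewrite E; apply: (@measurable_sum _ T) => a; have [aA|aA] := boolP (a \in A).
  by apply: measurable_funM => //; exact: mZ.
exact: measurable_cst.
Qed.

Lemma gaussian_cond_exp b c : normal_equations b c ->
  is_cond_exp P (sigma_of Z A) (Z b) (fun w => \sum_(a <- A) c a * Z a w).
Proof.
move=> nE.
have i1 := L1 _ (field_span_field _ _ _ _ P Z b).
have i2 := L1 _ (field_span_sum _ _ _ _ P Z A c).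
have uc a : a \in A -> \int[P]_w ((residual b c) w * Z a w) = 0.
  by move=> aA; exact: residual_uncorrelated.
split=> //; first exact: sigma_of_preimage.
move=> B sB.
have mB := sigma_of_measurable _ (residual_span b c) uc _ sB.
rewrite !integral_restrict//; congr EFin.
have := uncorrelated_int1 _ (residual_span b c) uc _ sB.
have j f : P.-integrable setT (EFin \o f) -> P.-integrable setT (EFin \o (fun w
  => f w * \1_B w)).
  move=> i; apply: (integrable_mul_bounded 1) => // w.
  by rewrite indicE; case: (_ \in _); rewrite ?normr1 ?normr0.
under eq_Rintegral do rewrite mulrBl.
rewrite (RintegralB measurableT (j _ i1) (j _ i2)) => /eqP.
by rewrite subr_eq0 => /eqP.
Qed.

(** Polarization: the sum and the difference of the two residuals are again uncorrelated with the
    [Z a], so [uncorrelated_int2] applies to both, and the product of the residuals is a quarter of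
    the difference of the two squares. *)
Lemma gaussian_cond_cov b b' c c' : normal_equations b c -> normal_equations b'
  c' ->
  is_cond_cov P (sigma_of Z A) (Z b) (Z b')
    (fun=> K b b' - \sum_(a <- A) c a * K a b').
Proof.
move=> nE nE'.
exists (fun w => \sum_(a <- A) c a * Z a w), (fun w => \sum_(a <- A) c' a * Z a w).
split; [exact: gaussian_cond_exp|exact: gaussian_cond_exp|].
set W := residual b c; set W' := residual b' c'.
have LW : field_span Z W by exact: residual_span.
have LW' : field_span Z W' by exact: residual_span.
have uW a : a \in A -> \int[P]_w (W w * Z a w) = 0 by move=> aA;
  exact: residual_uncorrelated.
have uW' a : a \in A -> \int[P]_w (W' w * Z a w) = 0 by move=> aA;
  exact: residual_uncorrelated.
have iWW' := prod_int _ _ LW LW'.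
(* Expand bilinearly: the terms in K b a and the double sum cancel by the normal equations for
   [b]. *)
have EWW' : \int[P]_w (W w * W' w) = K b b' - \sum_(a <- A) c a * K a b'.
  rewrite [LHS](residual_cov b c W' LW').
  have sw g : \int[P]_w (Z g w * W' w) = K g b' - \sum_(a <- A) c' a * K g a.
    transitivity (\int[P]_w (W' w * Z g w)); first by apply: eq_Rintegral => w _;
      rewrite mulrC.
    rewrite residual_cov; last exact: field_span_field.
    congr (_ - _).
      by rewrite -(field_cov _ _ _ _ _ _ _ hZ); apply: eq_Rintegral => w _;
        rewrite mulrC.
    apply: eq_bigr => a _; rewrite -(field_cov _ _ _ _ _ _ _ hZ g a); congr (_ * _).
    by apply: eq_Rintegral => w _; rewrite mulrC.
  rewrite sw -addrA; congr (_ + _).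
  have -> : \sum_(a <- A) c a * \int[P]_w (Z a w * W' w) =
      \sum_(a <- A) (c a * K a b' - c a * \sum_(a' <- A) c' a' * K a a').
    by apply: eq_bigr => a _; rewrite sw mulrBr.
  rewrite big_split/= opprD addrC -[RHS]addr0 -addrA; congr (_ + _).
  rewrite sumrN opprK; apply/eqP; rewrite subr_eq0; apply/eqP.
  under [RHS]eq_big_seq => a aA do rewrite nE//.
  under eq_bigr do rewrite mulr_sumr.
  rewrite exchange_big/=; apply: eq_bigr => a _; rewrite mulr_sumr.
  by apply: eq_bigr => a' _; ring.
split.
- exact: iWW'.
- exact: finite_measure_integrable_cst.
- move=> S mS; rewrite preimage_cst; case: ifPn => _; last first.
    by have [] := smallest_sigma_algebra setT (\bigcup_(a in [set` A])
      preimage_set_system setT (Z a) measurable).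
  have [h0 h1 _] := smallest_sigma_algebra setT (\bigcup_(a in [set` A])
    preimage_set_system setT (Z a) measurable).
  by rewrite -[setT]setD0; exact: h1.
move=> B sB.
have mB := sigma_of_measurable _ LW uW _ sB.
rewrite integral_cst//= integral_restrict//.
have fB : P B \is a fin_num by exact: fin_num_measure.
rewrite -[P B]fineK// -EFinM -EWW'; congr EFin.
have Lp : field_span Z (fun w => W w + 1 * W' w) by exact: LD.
have Ln : field_span Z (fun w => W w + (- 1) * W' w) by exact: LD.
have up (e : R) a : a \in A -> \int[P]_w ((W w + e * W' w) * Z a w) = 0.
  move=> aA.
  have i1 := prod_int _ _ LW (field_span_field _ _ _ _ P Z a).
  have i2 := prod_int _ _ LW' (field_span_field _ _ _ _ P Z a).
  transitivity (\int[P]_w (W w * Z a w + e * (W' w * Z a w))).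
    by apply: eq_Rintegral => w _; ring.
  by rewrite (RintegralD measurableT i1 (integrableZl measurableT e i2))
    (RintegralZl _ measurableT i2) uW// uW'// mulr0 addr0.
have j f : P.-integrable setT (EFin \o f) -> P.-integrable setT (EFin \o (fun w
  => f w * \1_B w)).
  move=> i; apply: (integrable_mul_bounded 1) => // w.
  by rewrite indicE; case: (_ \in _); rewrite ?normr1 ?normr0.
have Hp := uncorrelated_int2 _ Lp (up 1) _ sB.
have Hn := uncorrelated_int2 _ Ln (up (- 1)) _ sB.
have ip := L2 _ Lp; have im := L2 _ Ln.
have E1 : \int[P]_w (W w * W' w * \1_B w) = 4^-1 * (\int[P]_w ((W w + 1 * W' w)
  ^+ 2 * \1_B w)
   - \int[P]_w ((W w + (- 1) * W' w) ^+ 2 * \1_B w)).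
  rewrite -(RintegralB measurableT (j _ ip) (j _ im)).
  rewrite -(RintegralZl _ measurableT (integrableB measurableT (j _ ip) (j _ im))).
  by apply: eq_Rintegral => w _; field.
have E2 : \int[P]_w (W w * W' w) = 4^-1 * (\int[P]_w ((W w + 1 * W' w) ^+ 2)
   - \int[P]_w ((W w + (- 1) * W' w) ^+ 2)).
  rewrite -(RintegralB measurableT ip im).
  rewrite -(RintegralZl _ measurableT (integrableB measurableT ip im)).
  by apply: eq_Rintegral => w _; field.
by rewrite [RHS]E1 Hp Hn E2; ring.
Qed.

End gaussian_field_conditioning.

(** * Absolutely summable families *)

Section infsum_theory.
Context (R : realType) (X : countType).
Implicit Types f g h : X -> R.

Definition abs_summable f := (\esum_(x in [set: X]) `|f x|%:E < +oo)%E.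

Let esum_fin f : (forall x, 0 <= f x) ->
  (\esum_(x in [set: X]) (f x)%:E < +oo)%E -> summable [set: X] (EFin \o f).
Proof.
move=> f0; rewrite /summable; congr (_ < _)%E; apply: eq_esum => x _ /=.
by rewrite ger0_norm.
Qed.

Let esum_fin_num g : (forall x, 0 <= g x) ->
  (\esum_(x in [set: X]) (g x)%:E < +oo)%E ->
  \esum_(x in [set: X]) (g x)%:E \is a fin_num.
Proof.
move=> g0 gf; rewrite ge0_fin_numE; first exact: gf.
by apply: esum_ge0 => x _; rewrite lee_fin.
Qed.

(** [infsum] can be computed from any splitting into summable nonnegative families, not only from
    positive and negative parts. The two signs of the walk will give such a splitting. *)
Lemma infsum_diff f g h : (forall x, 0 <= g x) -> (forall x, 0 <= h x) ->
  (\esum_(x in [set: X]) (g x)%:E < +oo)%E ->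
  (\esum_(x in [set: X]) (h x)%:E < +oo)%E -> (forall x, f x = g x - h x) ->
  infsum f = fine (\esum_(x in [set: X]) (g x)%:E) - fine (\esum_(x in [set: X])
    (h x)%:E).
Proof.
move=> g0 h0 gf hf fE.
have gE : \esum_(x in [set: X]) (g x)%:E \is a fin_num.
  by rewrite ge0_fin_numE// esum_ge0// => x _; rewrite lee_fin.
have hE : \esum_(x in [set: X]) (h x)%:E \is a fin_num.
  by rewrite ge0_fin_numE// esum_ge0// => x _; rewrite lee_fin.
have le1 k : (forall x, 0 <= k x) -> (forall x, k x <= g x + h x) ->
    \esum_(x in [set: X]) (k x)%:E \is a fin_num.
  move=> k0 kgh; rewrite ge0_fin_numE; last by rewrite esum_ge0// => x _;
    rewrite lee_fin.
  apply: le_lt_trans (lte_add_pinfty gf hf).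
  rewrite -esumD => [|x _|x _]; rewrite ?lee_fin//.
  by apply: le_esum => x _; rewrite -EFinD lee_fin.
have pE : \esum_(x in [set: X]) (maxr (f x) 0)%:E \is a fin_num.
  apply: le1 => x; first by rewrite le_max lexx orbT.
  by rewrite ge_max addr_ge0// andbT fE lerD// lerNl (le_trans _ (h0 x))// oppr_le0.
have nE : \esum_(x in [set: X]) (maxr (- f x) 0)%:E \is a fin_num.
  apply: le1 => x; first by rewrite le_max lexx orbT.
  by rewrite ge_max addr_ge0// andbT fE opprB addrC lerD// lerNl (le_trans _ (g0
    x))// oppr_le0.
rewrite /infsum -!fineB//; congr fine.
rewrite -(esumB (esum_fin _ g0 gf) (esum_fin _ h0 hf)) => [|x _|x _];
  rewrite ?lee_fin//.
by congr (_ - _)%E; apply: eq_esum => x _;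
  rewrite ?funeposE ?funenegE fE/= EFin_max.
Qed.

Let abs_pos f : abs_summable f ->
  (\esum_(x in [set: X]) (maxr (f x) 0)%:E < +oo)%E /\
  (\esum_(x in [set: X]) (maxr (- f x) 0)%:E < +oo)%E.
Proof.
move=> sf; split; apply: le_lt_trans sf; apply: le_esum => x _;
  rewrite lee_fin ge_max normr_ge0 andbT.
  exact: ler_norm.
by rewrite -[leRHS]normrN; exact: ler_norm.
Qed.

Lemma abs_summableD f g : abs_summable f -> abs_summable g ->
  abs_summable (fun x => f x + g x).
Proof.
move=> sf sg; apply: le_lt_trans (lte_add_pinfty sf sg).
rewrite -esumD => [|x _|x _]; rewrite ?lee_fin//.
by apply: le_esum => x _; rewrite -EFinD lee_fin ler_normD.
Qed.

Lemma esumZl (c : R) f : 0 <= c -> (forall x, 0 <= f x) ->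
  (\esum_(x in [set: X]) (c * f x)%:E = c%:E * \esum_(x in [set: X]) (f x)%:E)%E.
Proof.
(* Applied to c^-1 and c f, this inequality also gives the converse one. *)
have le (k : R) g : 0 <= k -> (forall x, 0 <= g x) ->
    (\esum_(x in [set: X]) (k * g x)%:E <= k%:E * \esum_(x in [set: X]) (g x)%:E)%E.
  move=> k0 g0; apply: ge_ereal_sup => _ [F [finF _] <-].
  under eq_fsbigr do rewrite EFinM.
  rewrite -ge0_mule_fsumr; last by move=> x; rewrite lee_fin.
  rewrite lee_wpmul2l ?lee_fin//; apply: ereal_sup_ubound.
  by exists F.
move=> c0 f0; apply/eqP; rewrite eq_le le//=.
have [->|cN0] := eqVneq c 0.
  by rewrite mul0e esum_ge0// => x _; rewrite mul0r.
have cp : 0 < c by rewrite lt_neqAle eq_sym cN0.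
rewrite muleC -lee_pdivlMr// muleC.
apply: le_trans (le c^-1 (fun x => c * f x) _ _).
- by apply: le_esum => x _; rewrite mulKf.
- by rewrite invr_ge0.
- by move=> x; rewrite mulr_ge0.
Qed.

Lemma abs_summableZ (c : R) f : abs_summable f -> abs_summable (fun x => c * f x).
Proof.
move=> sf; rewrite /abs_summable; under eq_esum do rewrite normrM.
by rewrite esumZl// lte_mul_pinfty// lee_fin.
Qed.

Let esumDE f g : (forall x, 0 <= f x) -> (forall x, 0 <= g x) ->
  (\esum_(x in [set: X]) (f x + g x)%:E =
   \esum_(x in [set: X]) (f x)%:E + \esum_(x in [set: X]) (g x)%:E)%E.
Proof. by move=> f0 g0; rewrite -esumD => [|x _|x _]; rewrite ?lee_fin. Qed.

Lemma infsumD f g : abs_summable f -> abs_summable g ->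
  infsum (fun x => f x + g x) = infsum f + infsum g.
Proof.
move=> sf sg; have [fp fn] := abs_pos _ sf; have [gp gn] := abs_pos _ sg.
have m0 (y : R) : 0 <= maxr y 0 by rewrite le_max lexx orbT.
have fin_ (k : X -> R) : (\esum_(x in [set: X]) (maxr (k x) 0)%:E < +oo)%E ->
    \esum_(x in [set: X]) (maxr (k x) 0)%:E \is a fin_num.
  move=> H; rewrite ge0_fin_numE; first exact: H.
  by apply: esum_ge0 => x _; rewrite lee_fin.
rewrite (infsum_diff _ (fun x => maxr (f x) 0 + maxr (g x) 0)
   (fun x => maxr (- f x) 0 + maxr (- g x) 0)).
- rewrite !esumDE//.
  by rewrite !fineD ?fin_// /infsum; ring.
- by move=> x; rewrite addr_ge0.
- by move=> x; rewrite addr_ge0.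
- by rewrite esumDE ?lte_add_pinfty.
- by rewrite esumDE ?lte_add_pinfty.
- move=> x; rewrite !maxEle !oppr_le0.
  by case: (lerP (f x) 0) => ?; case: (lerP (g x) 0) => ?;
    case: (lerP 0 (f x)) => ?; case: (lerP 0 (g x)) => ?; lra.
Qed.

Lemma infsumN f : infsum (fun x => - f x) = - infsum f.
Proof.
rewrite /infsum opprB; congr (_ - fine _).
by apply: eq_esum => x _; rewrite opprK.
Qed.

Lemma infsumZ (c : R) f : abs_summable f ->
  infsum (fun x => c * f x) = c * infsum f.
Proof.
have pos (k : R) g : 0 <= k -> abs_summable g -> infsum (fun x => k * g x) = k *
  infsum g.
  move=> k0 sg; have [gp gn] := abs_pos _ sg.
  have m0 (y : R) : 0 <= maxr y 0 by rewrite le_max lexx orbT.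
  rewrite (infsum_diff _ (fun x => k * maxr (g x) 0) (fun x => k * maxr (- g x) 0)).
  - rewrite !esumZl//.
    have pE := esum_fin_num _ (fun x => m0 (g x)) gp.
    have nE := esum_fin_num _ (fun x => m0 (- g x)) gn.
    by rewrite !fineM// /infsum/= mulrBr.
  - by move=> x; rewrite mulr_ge0.
  - by move=> x; rewrite mulr_ge0.
  - by rewrite esumZl// lte_mul_pinfty// lee_fin.
  - by rewrite esumZl// lte_mul_pinfty// lee_fin.
  - move=> x; rewrite -mulrBr; congr (_ * _); rewrite !maxEle oppr_le0.
    by case: (lerP (g x) 0) => ?; case: (lerP 0 (g x)) => ?; lra.
move=> sf; have [c0|c0] := leP 0 c; first exact: pos.
rewrite -[LHS]opprK -infsumN -[RHS]opprK -mulNr -pos ?oppr_ge0 ?ltW//.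
by congr (- infsum _); apply/funext => x; rewrite mulNr.
Qed.

Lemma infsum0 : infsum (fun _ : X => 0 : R) = 0.
Proof.
rewrite /infsum oppr0.
by rewrite subrr.
Qed.

Lemma abs_summable0 : abs_summable (fun=> 0).
Proof. by rewrite /abs_summable esum1// => x _; rewrite normr0. Qed.

Lemma infsum_sum (I : Type) (s : seq I) (F : I -> X -> R) :
  (forall i, abs_summable (F i)) ->
  abs_summable (fun x => \sum_(i <- s) F i x) /\
  infsum (fun x => \sum_(i <- s) F i x) = \sum_(i <- s) infsum (F i).
Proof.
move=> sF; elim: s => [|i s [IH1 IH2]].
  rewrite big_nil (_ : (fun x => _) = fun=> 0).
    by split; [exact: abs_summable0|exact: infsum0].
  by apply/funext => x; rewrite big_nil.
rewrite (_ : (fun x => _) = (fun x => F i x + \sum_(j <- s) F j x)).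
  by split; [exact: abs_summableD|rewrite infsumD// IH2 big_cons].
by apply/funext => x; rewrite big_cons.
Qed.

Lemma infsum_delta (a : X) (k : R) : 
  abs_summable (fun x => k * (x == a)%:R) /\
  infsum (fun x => k * (x == a)%:R) = k.
Proof.
have E : (\esum_(x in [set: X]) ((x == a)%:R)%:E = 1 :> \bar R)%E.
  rewrite (esumID [set a])// setTI setTI esum_set1 ?eqxx//.
  rewrite esum1 ?adde0// => x /= /eqP/negbTE ->//.
have sd : abs_summable (fun x => (x == a)%:R).
  by rewrite /abs_summable; under eq_esum do rewrite normr_nat; rewrite E ltry.
split; first exact: abs_summableZ.
rewrite infsumZ// (infsum_diff _ (fun x => (x == a)%:R) (fun=> 0))//.
- by rewrite E esum1//= subr0 mulr1.
- by rewrite E ltry.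
- by rewrite esum1.
- by move=> x; rewrite subr0.
Qed.

Lemma le_abs_summable f g : (forall x, `|f x| <= `|g x|) -> abs_summable g ->
  abs_summable f.
Proof. by move=> fg; apply: le_lt_trans; apply: le_esum => x _;
  rewrite lee_fin. Qed.

End infsum_theory.

(** * Cauchy products of absolutely convergent series *)

Section cauchy_product.
Context (R : realType).
Implicit Types u v : nat -> R.

Definition convolution u v n := \sum_(j < n.+1) u j * v (n - j)%N.

Let sE (w : nat -> R) n : series w n = \sum_(i < n) w i. Proof. by rewrite
  seriesEord. Qed.

Let series_convolution u v N : series (convolution u v) N =
  \sum_(i < N) u i * series v (N - i)%N.
Proof.
elim: N => [|N IH]; first by rewrite sE/= !big_ord0.
rewrite seriesSr IH /convolution !big_ord_recr/= addrA -big_split/=; congr (_ + _).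
  apply: eq_bigr => i _; rewrite subSn; last exact: ltnW.
  by rewrite seriesSr mulrDr.
by rewrite subnn subSn// subnn seriesSr seriesEnat/= big_nil add0r.
Qed.

(** The pairs (i, j) with i + j < n contain the square of side n/2 and lie in the square of side n,
    so the partial sums are squeezed between two products. *)
Let nonneg_case u v (U V : R) : (forall n, 0 <= u n) -> (forall n, 0 <= v n) ->
  series u @ \oo --> U -> series v @ \oo --> V ->
  series (convolution u v) @ \oo --> U * V.
Proof.
move=> u0 v0 cU cV.
have ndv : nondecreasing_seq (series v) by apply: nondecreasing_series.
have v0' n : 0 <= series v n by rewrite sE sumr_ge0.
have half : (fun n => n./2) @ \oo --> \oo.
  apply/cvgnyPge => n; near=> m.
  rewrite -(doubleK n); apply: half_leq.
  near: m; exact: nbhs_infty_ge.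
apply: (@squeeze_cvgr _ _ _ _ (fun n => series u n./2 * series v n./2)
  (fun n => series u n * series v n)).
- apply: nearW => n; rewrite series_convolution; apply/andP; split.
    rewrite sE mulr_suml.
    have le : (n./2 <= n)%N by rewrite -{2}(odd_double_half n) -addnn addnA
      leq_addl.
    rewrite -(big_mkord xpredT (fun i => u i * series v n./2)).
    rewrite -(big_mkord xpredT (fun i => u i * series v (n - i)%N)).
    rewrite [leRHS](@big_cat_nat _ _ _ n./2)//=.
    rewrite -[leLHS]addr0 lerD//.
      rewrite big_nat [leRHS]big_nat; apply: ler_sum => i /andP[_ iN].
      rewrite ler_wpM2l//; apply: ndv.
      by apply: leq_trans (leq_sub2l n (ltnW iN));
        rewrite -{2}(odd_double_half n) -addnn addnA addnK leq_addl.
    by apply: sumr_ge0 => i _; rewrite mulr_ge0.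
  rewrite [X in _ <= X * _]sE mulr_suml; apply: ler_sum => i _.
  by rewrite ler_wpM2l//; apply: ndv; exact: leq_subr.
- by apply: cvgM; apply: (cvg_comp _ _ half).
- exact: cvgM.
Unshelve. all: by end_near. Qed.

(** The product of the partial sums exceeds the partial sum of the convolution by the terms with i,
    j < n and i + j >= n. They are bounded by the same terms in absolute value, whose sum tends to 0
    by the nonnegative case. *)
Lemma cauchy_product_cvg u v :
  cvgn (series (fun n => `|u n|)) -> cvgn (series (fun n => `|v n|)) ->
  series (convolution u v) @ \oo --> limn (series u) * limn (series v).
Proof.
move=> cu cv.
have cu' : series u @ \oo --> limn (series u) by exact: normed_cvg.
have cv' : series v @ \oo --> limn (series v) by exact: normed_cvg.
have uv : series u n * series v n @[n --> \oo] --> limn (series u) * limn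
  (series v).
  exact: cvgM.
have H := nonneg_case _ _ _ _ (fun n => normr_ge0 _) (fun n => normr_ge0 _) cu cv.
have H2 : series (fun n => `|u n|) n * series (fun n => `|v n|) n -
   series (convolution (fun n => `|u n|) (fun n => `|v n|)) n @[n --> \oo] -->
     (0 : R).
  rewrite -(subrr (limn (series (fun n => `|u n|)) * limn (series (fun n => `|v
    n|)))).
  by apply: cvgB => //; exact: cvgM.
suff D : series u n * series v n - series (convolution u v) n @[n --> \oo] -->
  (0 : R).
  rewrite (_ : series (convolution u v) = (fun n => series u n * series v n -
    (series u n * series v n - series (convolution u v) n))); last first.
    by apply/funext => n; rewrite subKr.
  by rewrite -[X in _ --> X]subr0; exact: cvgB.
apply: norm_cvg0; apply: (@squeeze_cvgr _ _ _ _ (cst 0) _ _ _ _ _ H2);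
  last exact: cvg_cst.
apply: nearW => n; rewrite normr_ge0/=.
rewrite !series_convolution !sE !mulr_suml -!sumrB.
apply: le_trans (ler_norm_sum _ _ _) _; apply: ler_sum => i _.
rewrite -!mulrBr normrM ler_wpM2l//.
have le : (n - i <= n)%N by exact: leq_subr.
have sub w : series w n - series w (n - i)%N = \sum_(n - i <= k < n) w k.
  by rewrite sub_series_geq.
by rewrite -(sE v n) -(sE (fun k => `|v k|) n) !sub; exact: ler_norm_sum.
Qed.

End cauchy_product.

Arguments abs_summable {R X} f.
Arguments infsum_diff {R X f} g h.
Arguments le_abs_summable {R X f} g.

(** * The jump chain *)

(** Coding [T] by [pickle] turns the fibers into a sequence of disjoint sets, to which countable
    additivity applies. *)
Lemma measure_esum_fibers d (Omega : measurableType d) (R : realType)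
    (mu : {measure set Omega -> \bar R}) (T : countType) (f : Omega -> T) (E :
      set Omega) :
  (forall t, measurable [set w | f w = t]) -> measurable E ->
  mu E = \esum_(t in [set: T]) mu (E `&` [set w | f w = t]).
Proof.
move=> mf mE.
pose F k := E `&` [set w | choice.pickle (f w) = k].
have mF k : measurable (F k).
  apply: measurableI => //.
  case E0 : (choice.pickle_inv k : option T) => [t|].
    rewrite (_ : [set w | _] = [set w | f w = t])//; apply/seteqP; split=> w /=.
      by move=> H; move: E0; rewrite -H choice.pickleK_inv => -[].
    by move=> ->; have := @choice.pickle_invK T k; rewrite E0.
  rewrite (_ : [set w | _] = set0)//; apply/seteqP; split=> w //= H.
  by move: E0; rewrite -H choice.pickleK_inv.
have {1}-> : E = \bigcup_(k in range (@choice.pickle T)) F k.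
  apply/seteqP; split=> w; first by move=> Ew; exists (choice.pickle (f w)).
  by move=> [k _ []].
rewrite measure_bigcup//; last first.
  apply/trivIsetP => i j _ _ ij; apply/seteqP; split=> w //= [[_ /= iw] [_ /= jw]].
  by rewrite -iw -jw eqxx in ij.
rewrite nneseries_esum//.
have -> : [set x | x \in range (@choice.pickle T)] = range (@choice.pickle T).
  by apply/seteqP; split=> x; rewrite /= inE.
rewrite esum_image; last by move=> x y _ _; exact: (pcan_inj choice.pickleK).
apply: eq_esum => t _; congr (mu _); apply/seteqP; split=> w [Ew /= H].
  by split=> //; exact: (pcan_inj choice.pickleK).
by split=> //=; rewrite H.
Qed.

Section jump_chain.
Context (R : realType) (X : countType) (d : measure_display) (Omega :
  measurableType d).
Variables (Q : X -> X -> R) (Y : nat -> Omega -> option X) (tau : nat -> {mfun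
  Omega >-> R}).
Variable PX : X -> probability Omega R.
Hypothesis hX : forall x, process_law Y tau Q x (PX x).
Hypothesis P0 : forall x y : X, 0 <= trans_prob Q (Some x) (Some y).
Notation path := (nat -> option X).
Implicit Types (x z : X) (y : path) (T : path -> Prop).

Let mY (x0 : X) n u : measurable [set w | Y n w = u].
Proof. by case: (hX x0). Qed.

Definition cylinder n y : set Omega := [set w | forall i, (i <= n)%N -> Y i w =
  y i].

(** One implication is enough, since the hypothesis is symmetric in [y] and [y']. *)
Definition depends n T := forall y y', (forall i, (i <= n)%N -> y i = y' i) -> T
  y -> T y'.

Definition path_event T : set Omega := [set w | T (Y ^~ w)].

(** A variable with countably many values whose fibers are cylinders, so that path events become
    countable disjoint unions of cylinders. *)
Let tup n (w : Omega) : n.+1.-tuple (option X) := [tuple Y i w | i < n.+1].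

Let tnth_tup n w (i : nat) : (i <= n)%N -> nth None (tup n w) i = Y i w.
Proof.
move=> ni; rewrite -ltnS in ni.
have -> : nth None (tup n w) i = tnth (tup n w) (Ordinal ni) by rewrite
  (tnth_nth None).
by rewrite tnth_mktuple.
Qed.

Let tupE n w t : tup n w = t <-> cylinder n (nth None t) w.
Proof.
split=> [<- i ni|H]; first by rewrite tnth_tup.
apply: val_inj; apply: (@eq_from_nth _ None); first by rewrite !size_tuple.
by move=> i; rewrite size_tuple ltnS => ni; rewrite tnth_tup// H.
Qed.

Let measurable_cylinder (x0 : X) n y : measurable (cylinder n y).
Proof.
have -> : cylinder n y = \bigcap_(i in `I_n.+1) [set w | Y i w = y i].
  by apply/seteqP; split=> w H i /=; [rewrite ltnS; exact: H|rewrite -ltnS;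
    exact: H].
by apply: fin_bigcap_measurable => // i _; exact: mY.
Qed.

Lemma measurable_fiber_tuple (x0 : X) n t : measurable [set w | tup n w = t].
Proof.
rewrite (_ : [set w | _] = cylinder n (nth None t));
  first exact: measurable_cylinder.
by apply/seteqP; split=> w /tupE.
Qed.

Lemma measurable_path_event (x0 : X) n T : depends n T -> measurable (path_event T).
Proof.
move=> dT.
have -> : path_event T = \bigcup_(t : n.+1.-tuple (option X)) 
    (if `[< T (nth None t) >] then cylinder n (nth None t) else set0).
  apply/seteqP; split=> w.
    move=> Tw; exists (tup n w) => //.
    have H i : (i <= n)%N -> Y i w = nth None (tup n w) i by move=> ?;
      rewrite tnth_tup.
    by rewrite (asboolT (dT _ _ H Tw)) => i /H.
  move=> [t _]; case: asboolP => // Tt ct; apply: dT Tt => i ni.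
  by rewrite ct.
apply: countable_bigcupT_measurable; first exact: countableP.
by move=> t; case: ifP => // _; exact: measurable_cylinder.
Qed.

(** A conditional probability of [D] that is the same on all the cylinders of the event is that of
    the whole event. [D] will concern the next state or the current holding time. *)
Lemma path_event_indep x n T (D : set Omega) (k : R) : depends n T -> measurable
  D -> 0 <= k ->
  (forall y, T y -> PX x (cylinder n y `&` D) = (PX x (cylinder n y) * k%:E)%E) ->
  PX x (path_event T `&` D) = (PX x (path_event T) * k%:E)%E.
Proof.
move=> dT mD k0 H.
have mT := measurable_path_event x n T dT.
rewrite (measure_esum_fibers _ _ _ _ _ (tup n) _ (measurable_fiber_tuple x n)
  (measurableI _ _ mT mD)).
rewrite [in RHS](measure_esum_fibers _ _ _ _ _ (tup n) _ (measurable_fiber_tuple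
  x n) mT).
have fin_ B : measurable B -> PX x B \is a fin_num by move=> mB;
  exact: fin_num_measure.
have mTt t : measurable (path_event T `&` [set w | tup n w = t]).
  by apply: measurableI => //; exact: measurable_fiber_tuple.
rewrite muleC.
transitivity (k%:E * \esum_(t in [set: n.+1.-tuple (option X)])
   (fine (PX x (path_event T `&` [set w | tup n w = t])))%:E)%E; last first.
  by congr (_ * _)%E; apply: eq_esum => t _; rewrite fineK ?fin_.
rewrite -esumZl//; last by move=> t; rewrite fine_ge0.
apply: eq_esum => t _; rewrite EFinM fineK ?fin_//.
have [Tt|nTt] := pselect (T (nth None t)).
  have E : path_event T `&` [set w | tup n w = t] = cylinder n (nth None t).
    apply/seteqP; split=> w; first by move=> [_ /tupE].
    move=> ct; split; last by apply/tupE.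
    by apply: dT Tt => i /ct.
  rewrite setIAC E muleC; exact: H Tt.
have E : path_event T `&` [set w | tup n w = t] = set0.
  apply/seteqP; split=> w // -[Tw /= tw]; apply: nTt; apply: dT Tw => i ni.
  by rewrite -tw tnth_tup.
by rewrite setIAC E set0I !measure0 mule0.
Qed.

Lemma cylinder_step x n y v :
  PX x (cylinder n y `&` [set w | Y n.+1 w = v]) =
  (PX x (cylinder n y) * (trans_prob Q (y n) v)%:E)%E.
Proof.
pose y' i := if i == n.+1 then v else y i.
have yy' i : (i <= n)%N -> y' i = y i.
  by move=> ni; rewrite /y' ifN// neq_ltn ltnS ni.
have E : cylinder n y `&` [set w | Y n.+1 w = v] = cylinder n.+1 y'.
  apply/seteqP; split=> w.
    move=> [cy /= Yn] i; rewrite leq_eqVlt => /predU1P[->|];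
      first by rewrite /y' eqxx.
    by rewrite ltnS => ni; rewrite yy'// cy.
  move=> cy'; split=> [i ni|/=]; first by rewrite cy' ?yy'// ltnW.
  by rewrite cy'// /y' eqxx.
rewrite E /cylinder !(chain_law (hX x)) big_ord_recr -EFinM mulrA; congr (_ %:E).
have [y0 yn] : y' 0%N = y 0%N /\ y' n = y n by rewrite !yy'.
have yS : y' n.+1 = v by rewrite /y' eqxx.
rewrite /= y0 yn yS; congr (_ * _ * _).
by apply: eq_bigr => i _; rewrite /= !yy'//; apply: ltnW.
Qed.

Lemma path_event_step x n T (u v : option X) : depends n T -> 0 <= trans_prob Q
  u v ->
  (forall y, T y -> y n = u) ->
  PX x (path_event T `&` [set w | Y n.+1 w = v]) =
  (PX x (path_event T) * (trans_prob Q u v)%:E)%E.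
Proof.
move=> dT p0 Tu; apply: (path_event_indep x n) => //; first exact: mY.
by move=> y /Tu yn; rewrite cylinder_step yn.
Qed.

(** [process_law] prescribes the initial state only with probability 1, whereas identities between
    path events use it on every path. *)
Lemma start_ae x E : measurable E -> PX x E = PX x (E `&` [set w | Y 0%N w =
  Some x]).
Proof.
move=> mE.
have m0 := mY x 0%N (Some x).
have P1 : PX x [set w | Y 0%N w = Some x] = 1%E.
  transitivity (PX x (cylinder 0 (fun=> Some x))).
    congr (PX x _); apply/seteqP; split=> w /=; first by move=> H [].
    by move=> /(_ 0%N) ->.
  by rewrite /cylinder (chain_law (hX x)) eqxx big_ord0 mulr1.
have PC : PX x (~` [set w | Y 0%N w = Some x]) = 0%E.
  by rewrite probability_setC// P1 subee.
rewrite (measureDI _ mE m0) [X in (X + _)%E](_ : _ = 0%E) ?add0e//.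
by apply: subset_measure0 PC; [exact: measurableD|exact: measurableC|move=> w []].
Qed.

(** Markov property at the first jump. For each tuple of n + 1 states, read from time 1 under [x]
    and from time 0 under [z], [chain_law] gives the same product up to the factor of the jump from
    [x] to [z]. *)
Lemma path_event_shift x z n T : depends n T ->
  PX x (path_event (fun y => y 1%N = Some z /\ T (fun i => y i.+1))) =
  (PX z (path_event T) * (trans_prob Q (Some x) (Some z))%:E)%E.
Proof.
move=> dT; have p0 := P0 x z; move: p0; set p := trans_prob _ _ _ => p0.
set E := path_event _.
have mE : measurable E.
  apply: (measurable_path_event x n.+1) => y y' yy' [y1 Ty]; split.
    by rewrite -yy'.
  by apply: dT Ty => i ni; exact: yy'.
have mT := measurable_path_event z n T dT.
pose g (w : Omega) : n.+1.-tuple (option X) := [tuple Y i.+1 w | i < n.+1].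
have gE w t : g w = t <-> forall i, (i <= n)%N -> Y i.+1 w = nth None t i.
  split=> [<- i|H].
    rewrite -ltnS => ni.
    have -> : nth None (g w) i = tnth (g w) (Ordinal ni) by rewrite (tnth_nth None).
    by rewrite tnth_mktuple.
  apply: val_inj; apply: (@eq_from_nth _ None); first by rewrite !size_tuple.
  move=> i; rewrite size_tuple => ni.
  have -> : nth None (g w) i = tnth (g w) (Ordinal ni) by rewrite (tnth_nth None).
  by rewrite tnth_mktuple H.
pose cons_ (u : option X) (t : n.+1.-tuple (option X)) i := if i is j.+1 then
  nth None t j else u.
have gE' u t : [set w | g w = t] `&` [set w | Y 0%N w = u] = cylinder n.+1
  (cons_ u t).
  apply/seteqP; split=> w.
    by move=> [/= /gE H H0] [|i] //; exact: H.
  move=> H; split=> /=; last by rewrite H.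
  by apply/gE => i ni; rewrite H.
have mg t : measurable [set w | g w = t].
  rewrite (_ : [set w | _] = \bigcap_(i in `I_n.+1) [set w | Y i.+1 w = nth None
    t i]).
    by apply: fin_bigcap_measurable => // i _; exact: mY.
  apply/seteqP; split=> w /=; first by move=> /gE H i /=; rewrite ltnS; exact: H.
  by move=> H; apply/gE => i; rewrite -ltnS; exact: H.
rewrite (measure_esum_fibers _ _ _ _ _ g _ mg mE).
rewrite (measure_esum_fibers _ _ _ _ _ (tup n) _ (measurable_fiber_tuple z n) mT).
have fin_ v B : measurable B -> PX v B \is a fin_num by move=> mB;
  exact: fin_num_measure.
have mTt t : measurable (path_event T `&` [set w | tup n w = t]).
  by apply: measurableI => //; exact: measurable_fiber_tuple.
rewrite muleC.
transitivity (p%:E * \esum_(t in [set: n.+1.-tuple (option X)])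
   (fine (PX z (path_event T `&` [set w | tup n w = t])))%:E)%E; last first.
  by congr (_ * _)%E; apply: eq_esum => t _; rewrite fineK ?fin_.
rewrite -esumZl//; last by move=> t; rewrite fine_ge0.
apply: eq_esum => t _; rewrite EFinM fineK ?fin_//.
have [Tt|nTt] := pselect (T (nth None t)); last first.
  have -> : E `&` [set w | g w = t] = set0.
    apply/seteqP; split=> w // -[[_ Tw] /= /gE gw]; apply: nTt;
      apply: dT Tw => i ni.
    by rewrite gw.
  have -> : path_event T `&` [set w | tup n w = t] = set0.
    apply/seteqP; split=> w // -[Tw /= tw]; apply: nTt; apply: dT Tw => i ni.
    by rewrite -tw tnth_tup.
  by rewrite !measure0 mule0.
have Ez : path_event T `&` [set w | tup n w = t] = cylinder n (nth None t).
  apply/seteqP; split=> w; first by move=> [_ /tupE].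
  move=> ct; split; last by apply/tupE.
  by apply: dT Tt => i /ct.
(* A tuple that does not start at [z] contributes 0 to both sides. *)
have [t0|t0] := eqVneq (nth None t 0%N) (Some z); last first.
  have -> : E `&` [set w | g w = t] = set0.
    apply/seteqP; split=> w // -[[Y1 _] /= /gE gw].
    by move: t0; rewrite -gw// Y1 eqxx.
  rewrite measure0 Ez; apply/esym.
  transitivity (p%:E * 0)%E; last by rewrite mule0.
  congr (_ * _)%E; rewrite /cylinder; apply: etrans (chain_law (hX z) n (nth
    None t)) _.
  by rewrite (negbTE t0) mul0r.
have Ex : E `&` [set w | g w = t] = [set w | g w = t].
  apply/seteqP; split=> w; first by move=> [].
  move=> gw; split=> //; move: (gw) => /= /gE H; split; first by rewrite H.
  by apply: dT Tt => i /H.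
rewrite Ex Ez; apply: etrans (start_ae x _ (mg t)) _; rewrite gE'.
apply: etrans (chain_law (hX x) n.+1 (cons_ (Some x) t)) _.
transitivity (p%:E * ((nth None t 0%N == Some z)%:R *
  \prod_(i < n) trans_prob Q (nth None t i) (nth None t i.+1))%:E)%E; last first.
  by congr (_ * _)%E; apply/esym; exact: (chain_law (hX z) n (nth None t)).
by rewrite -EFinM big_ord_recl/= eqxx !mul1r t0 eqxx mul1r.
Qed.

(** Nothing forbids a path to leave the cemetery, but such paths are null because
    [trans_prob Q None (Some v)] is 0. *)
Lemma cemetery_absorbing x n k v :
  PX x [set w | Y n w = None /\ Y (n + k)%N w = Some v] = 0%E.
Proof.
have mE j u : measurable [set w | Y n w = None /\ Y (n + j)%N w = u].
  by apply: measurableI; exact: mY.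
elim: k v => [|k IH] v.
  rewrite (_ : [set w | _] = set0) ?measure0//.
  by apply/seteqP; split=> w //= [+]; rewrite addn0 => ->.
rewrite (measure_esum_fibers _ _ _ _ _ (Y (n + k)%N) _ (fun u => mY x (n + k)%N
  u) (mE k.+1 (Some v))).
apply: esum1 => -[u|] _.
  apply: subset_measure0 (IH u).
  - by apply: measurableI; [exact: mE|exact: mY].
  - exact: mE.
  - by move=> w /= [[]].
have dN : depends (n + k) (fun y => y (n + k)%N = None).
  by move=> y y' yy'; rewrite yy'.
have := path_event_step x _ _ None (Some v) dN (lexx 0) (fun y h => h).
rewrite mule0; apply: subset_measure0.
- by apply: measurableI; [exact: mE|exact: mY].
- by apply: measurableI; exact: mY.
- by move=> w /= [[_ +]]; rewrite addnS.
Qed.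

End jump_chain.
Arguments depends {X} n T.
Arguments path_event {X d Omega} Y T.
Arguments cylinder {X d Omega} Y n y.
Arguments measurable_path_event {R X d Omega Q Y tau PX} hX x0 {n T}.
Arguments path_event_indep {R X d Omega Q Y tau PX} hX x {n T D}.
Arguments path_event_step {R X d Omega Q Y tau PX} hX x n T u v.
Arguments path_event_shift {R X d Omega Q Y tau PX} hX P0 x z {n T}.
Arguments cemetery_absorbing {R X d Omega Q Y tau PX} hX x n k v.
Arguments start_ae {R X d Omega Q Y tau PX} hX x {E}.

(** * Generators and transience of the jump chain *)

Section generator.
Context (R : realType) (X : countType) (Q : X -> X -> R).
Hypothesis hQ : symmetric_generator Q.

(** This form matches the off-diagonal sum in [rowsum]. *)
Lemma jump_matrixE x y : jump_matrix Q x y =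
  (- Q x x)^-1 * (if y \in [set y | y != x] then Q x y else 0).
Proof.
rewrite /jump_matrix eq_sym; case: eqVneq => [->|xy].
  by rewrite memNset ?mulr0//= eqxx.
by rewrite mem_set//= invrN !mulNr mulrC.
Qed.

Let Qpos x : 0 < - Q x x. Proof. by rewrite oppr_gt0 (gen_diag hQ). Qed.

Let offdiag_ge0 x y : 0 <= (if y \in [set y | y != x] then Q x y else 0).
Proof. by case: ifP => //; rewrite inE /= eq_sym => /(gen_offdiag hQ). Qed.

Lemma jump_matrix_ge0 x y : 0 <= jump_matrix Q x y.
Proof. by rewrite jump_matrixE mulr_ge0// invr_ge0 ltW. Qed.

Let esum_jump x : (\esum_(y in [set: X]) (jump_matrix Q x y)%:E =
  ((- Q x x)^-1)%:E * \esum_(y in [set y | y != x]) (Q x y)%:E)%E.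
Proof.
transitivity (\esum_(y in [set: X]) ((- Q x x)^-1 *
    (if y \in [set y | y != x] then Q x y else 0))%:E)%E.
  by apply: eq_esum => y _; rewrite jump_matrixE.
rewrite esumZl//; last by rewrite invr_ge0 ltW.
by congr (_ * _)%E; rewrite [RHS]esum_mkcond; apply: eq_esum => y _; case: ifP.
Qed.

Let esum_offdiag x : (0 <= \esum_(y in [set y | y != x]) (Q x y)%:E)%E.
Proof. by apply: esum_ge0 => y /= yx; rewrite lee_fin (gen_offdiag hQ)// eq_sym.
  Qed.

Let esum_offdiag_le x : (\esum_(y in [set y | y != x]) (Q x y)%:E <= (- Q x
  x)%:E)%E.
Proof.
have := gen_rowsum hQ x; rewrite /rowsum.
move: (esum_offdiag x); case: (esum _ _) => [r| |]//= _.
by rewrite -EFinD !lee_fin; lra.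
Qed.

Lemma jump_matrix_sum_le1 x : (\esum_(y in [set: X]) (jump_matrix Q x y)%:E <= 1)%E.
Proof.
rewrite esum_jump; move: (esum_offdiag x) (esum_offdiag_le x).
case: (esum _ _) => [r| |]//= r0; rewrite lee_fin => rQ.
by rewrite -EFinM lee_fin mulrC ler_pdivrMr// mul1r.
Qed.

Lemma jump_matrix_abs_summable x : abs_summable (jump_matrix Q x).
Proof.
rewrite /abs_summable; under eq_esum do rewrite ger0_norm ?jump_matrix_ge0//.
by apply: le_lt_trans (jump_matrix_sum_le1 x) _; rewrite ltry.
Qed.

Let infsum_jump x : infsum (jump_matrix Q x) = fine (\esum_(y in [set: X])
  (jump_matrix Q x y)%:E)%E.
Proof.
rewrite (infsum_diff (jump_matrix Q x) (fun=> 0))//.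
- by rewrite [X in _ - fine X]esum1// subr0.
- exact: jump_matrix_ge0.
- by apply: le_lt_trans (jump_matrix_sum_le1 x) _; rewrite ltry.
- by rewrite esum1.
- by move=> y; rewrite subr0.
Qed.

Lemma trans_prob_ge0 u v : 0 <= trans_prob Q u v.
Proof.
case: u v => [x|] [y|] //=; first exact: jump_matrix_ge0.
rewrite subr_ge0 infsum_jump -lee_fin fineK ?jump_matrix_sum_le1//.
rewrite ge0_fin_numE; first by apply: le_lt_trans (jump_matrix_sum_le1 x) _;
  rewrite ltry.
by apply: esum_ge0 => y _; rewrite lee_fin jump_matrix_ge0.
Qed.

Lemma killing_gt0 x : (rowsum Q x < 0)%E -> 0 < trans_prob Q (Some x) None.
Proof.
rewrite /= infsum_jump esum_jump /rowsum.
move: (esum_offdiag x); case: (esum _ _) => [r| |]//= _.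
rewrite -EFinD lte_fin => H.
by rewrite subr_gt0 mulrC ltr_pdivrMr// mul1r; lra.
Qed.

(** The common consequence of the two alternatives of [gen_transient]: under irreducibility one
    follows a path to a killing state, otherwise the empty path will do. *)
Lemma killing_reachable x : exists s : seq X,
  path (fun u v => 0 < jump_matrix Q u v) x s /\ 0 < trans_prob Q (Some (last x
    s)) None.
Proof.
case: (gen_transient hQ) => [[irr [z zk]]|H]; last first.
  by exists [::]; split=> //; exact/killing_gt0.
have [s [ps ls]] := irr x z.
exists s; split; last by rewrite ls; exact: killing_gt0.
apply: sub_path ps => u v /andP[uv Quv].
rewrite jump_matrixE mem_set/=; last by rewrite eq_sym.
by rewrite mulr_gt0// invr_gt0.
Qed.

Section transience.
Context (d : measure_display) (Omega : measurableType d).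
Variables (Y : nat -> Omega -> option X) (tau : nat -> {mfun Omega >-> R}).
Variable PX : X -> probability Omega R.
Hypothesis hX : forall x, process_law Y tau Q x (PX x).

Let P0 x y : 0 <= trans_prob Q (Some x) (Some y). Proof. exact: trans_prob_ge0. Qed.

Let mY (x0 : X) n u : measurable [set w | Y n w = u].
Proof. by case: (hX x0). Qed.

Let exit n : set Omega := [set w | Y n w <> None] `&` [set w | Y n.+1 w = None].

Let measurable_exit (x : X) n : measurable (exit n).
Proof.
apply: measurableI; last exact: mY.
by rewrite (_ : [set w | _] = ~` [set w | Y n w = None]) //; apply: measurableC;
  exact: mY.
Qed.

(** [q] is the product of the transition probabilities along [s] and of the final killing
    probability. Quantifying over the past event [T] lets the induction absorb the states of [s]
    into it one at a time. *)
Let exit_prob (s : seq X) : forall u, path (fun u v => 0 < jump_matrix Q u v) u s ->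
  0 < trans_prob Q (Some (last u s)) None ->
  exists2 q : R, 0 < q & forall x n T, depends n T -> (forall y, T y -> y n =
    Some u) ->
  (PX x (path_event Y T) * q%:E <= PX x (exit (n + size s)))%E.
Proof.
elim: s => [|v s IH] u /=.
  move=> _ k0; exists (1 - infsum (jump_matrix Q u)) => // x n T dT Tu.
  have tp := trans_prob_ge0 (Some u) None.
  rewrite -(path_event_step hX x n T (Some u) None dT tp Tu) addn0.
  have mT := measurable_path_event hX x dT.
  apply: le_measure; rewrite ?inE.
  - by apply: measurableI => //; exact: mY.
  - exact: measurable_exit.
  - by move=> w [Tw Yw]; split=> //=; rewrite (Tu _ Tw).
move=> /andP[uv ps] lk; have [q q0 H] := IH _ ps lk.
exists (jump_matrix Q u v * q); first exact: mulr_gt0.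
move=> x n T dT Tu.
have tp := trans_prob_ge0 (Some u) (Some v).
pose T' y := T y /\ y n.+1 = Some v.
have dT' : depends n.+1 T'.
  move=> y y' yy' [Ty yn]; split; last by rewrite -yy'.
  by apply: dT Ty => i ni; apply: yy'; apply: leqW.
rewrite EFinM muleA -(path_event_step hX x n T (Some u) (Some v) dT tp Tu).
rewrite addnS -addSn.
by apply: H dT' _ => y [].
Qed.

(** Being in the cemetery at time n almost surely implies being there at time n + 1. In this form
    the exit probabilities telescope. *)
Let exitE x n : fine (PX x (exit n)) =
  fine (PX x [set w | Y n.+1 w = None]) - fine (PX x [set w | Y n w = None]).
Proof.
have mA := mY x n None; have mB := mY x n.+1 None.
have fin_ B : measurable B -> PX x B \is a fin_num by move=> mB';
  exact: fin_num_measure.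
have dN : depends (X:=X) n (fun y => y n = None) by move=> y y' yy'; rewrite yy'.
have E := path_event_step hX x n _ None None dN ler01 (fun y h => h).
rewrite mule1 in E.
have D : PX x [set w | Y n.+1 w = None] = (PX x (exit n) + PX x [set w | Y n w =
  None])%E.
  rewrite -[X in (_ + X)%E]E; apply: etrans (measureDI (PX x) mB mA) _.
  rewrite setIC; congr (PX x _ + _)%E.
  by apply/seteqP; split=> w /= [].
rewrite D fineD ?addrK//; first by apply: fin_; exact: measurable_exit.
exact: fin_.
Qed.

(* Each visit to [z] leads to the cemetery after a fixed number of jumps with a
   fixed positive probability, and the probabilities of being absorbed at the
   [n]-th jump have a sum at most 1. *)
Lemma transient x z : cvgn (series (fun n => fine (PX x [set w | Y n w = Some z]))).
Proof.
have [s [ps lk]] := killing_reachable z.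
have [q q0 H] := exit_prob s z ps lk.
have fin_ B : measurable B -> PX x B \is a fin_num by move=> mB';
  exact: fin_num_measure.
have le_ n : fine (PX x [set w | Y n w = Some z]) * q <=
    fine (PX x [set w | Y (n + size s).+1 w = None]) - fine (PX x [set w | Y (n
      + size s) w = None]).
  rewrite -exitE -lee_fin EFinM !fineK; [|exact: fin_ _ (measurable_exit x
    _)|exact: fin_ _ (mY x _ _)].
  by apply: (H x n (fun y => y n = Some z)) => // y y' yy'; rewrite yy'.
apply: nondecreasing_is_cvgn.
  by apply: nondecreasing_series => n _ _; exact: fine_ge0.
pose m n := fine (PX x [set w | Y n w = None]).
have tel N : series (fun n => fine (PX x [set w | Y n w = Some z])) N * q <=
    m (N + size s)%N - m (size s).
  elim: N => [|N IH]; first by rewrite seriesEnat/= big_nil mul0r subrr.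
  by rewrite seriesSr mulrDl addSn; have := le_ N; rewrite -/(m _) -/(m _); lra.
exists q^-1 => _ [N _ <-].
rewrite -[leRHS]mul1r ler_pdivlMr//; apply: le_trans (tel N) _.
have m1 n : m n <= 1.
  by rewrite -lee_fin fineK; [apply: probability_le1;
    exact: mY|exact: fin_ _ (mY x _ _)].
have m0 n : 0 <= m n by exact: fine_ge0.
by have := m1 (N + size s)%N; have := m0 (size s); lra.
Qed.


End transience.
End generator.

Arguments transient {R X Q} hQ {d Omega Y tau PX} hX x z.
Arguments trans_prob_ge0 {R X Q} hQ u v.
Arguments jump_matrix_ge0 {R X Q} hQ x y.
Arguments jump_matrix_abs_summable {R X Q} hQ x.

(** * First passage decomposition *)

Lemma esum_option (R : realType) (X : countType) (a : option X -> \bar R) :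
  (forall u, (0 <= a u)%E) -> a None = 0%E ->
  \esum_(u in [set: option X]) a u = \esum_(z in [set: X]) a (Some z).
Proof.
move=> a0 aN; rewrite (esumID [set None])// setTI setTI esum_set1// aN add0e.
have -> : ~` [set None] = range (@Some X).
  apply/seteqP; split=> [[z|]|_ [z _ <-]]//=; first by exists z.
by apply: (esum_image setT (@Some X) a) => z z' _ _ [].
Qed.

Section signed_walk.
Context (R : realType) (X : countType) (Q S : X -> X -> R).
Hypotheses (hQ : symmetric_generator Q) (hS : sign_matrix S).
Context (d : measure_display) (Omega : measurableType d).
Variables (Y : nat -> Omega -> option X) (tau : nat -> {mfun Omega >-> R}).
Variable PX : X -> probability Omega R.
Hypothesis hX : forall x, process_law Y tau Q x (PX x).

Notation Pt := (hadamard (jump_matrix Q) S).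

Let P0 x y : 0 <= trans_prob Q (Some x) (Some y). Proof. exact: trans_prob_ge0. Qed.

Let mY (x0 : X) n u : measurable [set w | Y n w = u].
Proof. by case: (hX x0). Qed.

Definition path_sign n (y : nat -> option X) : R :=
  \prod_(i < n) trans_sign S (y i) (y i.+1).

Definition avoids (A : {fset X}) n (y : nat -> option X) :=
  forall i, (0 < i < n)%N -> forall a, a \in A -> y i <> Some a.

(* [A] is avoided strictly between the times 0 and [n]: when [v] is in [A] and
   [0 < n] the path hits [A] for the first time at [n]; when [v] is not in [A]
   it has not hit [A] up to time [n]. *)
Definition visit (A : {fset X}) n (s : R) (v : X) (y : nat -> option X) :=
  [/\ y n = Some v, avoids A n y & path_sign n y = s].

Definition visit_prob A n s x v : R := fine (PX x (path_event Y (visit A n s v))).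

Definition signed_visit A n x v : R := visit_prob A n 1 x v - visit_prob A n
  (-1) x v.

Lemma sign_sqr x y : S x y * S x y = 1.
Proof.
have [->|xy] := eqVneq x y; first by rewrite (sign_diag hS) mulr1.
by case: (sign_val hS xy) => ->; rewrite ?mulrNN mulr1.
Qed.

Lemma sign_cases x y : S x y = 1 \/ S x y = -1.
Proof.
have [->|xy] := eqVneq x y; first by left; exact: sign_diag.
by case: (sign_val hS xy) => ->; [right|left].
Qed.

Lemma depends_visit A n s v : depends n (visit A n s v).
Proof.
move=> y y' yy' [yn av sg]; split.
- by rewrite -yy'.
- by move=> i /[dup] /andP[_ /ltnW ni] /av H a /H; rewrite yy'.
- rewrite -sg /path_sign; apply: eq_bigr => i _; rewrite !yy'//.
  exact: ltnW.
Qed.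

Lemma measurable_visit (x0 : X) A n s v : measurable (path_event Y (visit A n s v)).
Proof. exact: (measurable_path_event hX x0 (depends_visit A n s v)). Qed.

Let fin_ x B : measurable B -> PX x B \is a fin_num.
Proof. by move=> mB; exact: fin_num_measure. Qed.

Lemma visit_prob_ge0 A n s x v : 0 <= visit_prob A n s x v.
Proof. exact: fine_ge0. Qed.

Lemma visit_probE A n s x v : PX x (path_event Y (visit A n s v)) = (visit_prob
  A n s x v)%:E.
Proof. by rewrite /visit_prob fineK// fin_//; exact: measurable_visit. Qed.

Lemma visit_prob_le A n s x v : visit_prob A n s x v <= fine (PX x [set w | Y n
  w = Some v]).
Proof.
rewrite -lee_fin -visit_probE fineK; last exact: fin_ (mY x _ _).
by apply: le_measure; rewrite ?inE; [exact: measurable_visit|exact: mY|move=> w []].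
Qed.

Lemma signed_visit_le A n x v : `|signed_visit A n x v| <= fine (PX x [set w | Y
  n w = Some v]).
Proof.
have := visit_prob_le A n 1 x v; have := visit_prob_le A n (-1) x v.
have := visit_prob_ge0 A n 1 x v; have := visit_prob_ge0 A n (-1) x v.
by move=> *; rewrite ler_norml; apply/andP; split; rewrite /signed_visit; lra.
Qed.

Lemma signed_visit_le1 A n x v : `|signed_visit A n x v| <= 1.
Proof.
apply: le_trans (signed_visit_le A n x v) _.
rewrite -lee_fin fineK; last exact: fin_ (mY x _ _).
by apply: probability_le1; exact: mY.
Qed.

Lemma signed_visit_summable A x v : cvgn (series (fun n => `|signed_visit A n x
  v|)).
Proof.
apply: (@series_le_cvg _ _ (fun n => fine (PX x [set w | Y n w = Some v]))).
- by move=> n.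
- by move=> n; exact: fine_ge0.
- by move=> n; exact: signed_visit_le.
- exact: (transient hQ hX).
Qed.

Let mulNN1 (s t : R) : s * s = 1 -> t = s * (s * t).
Proof. by move=> ss; rewrite mulrA ss mul1r. Qed.

(** One-step analysis: after a first jump to z the remaining n jumps must have sign s * S x z,
    because S x z is its own inverse, and z must lie outside [A] unless the first jump is also the
    last. *)
Lemma visit_prob_rec A n s x v : s * s = 1 ->
  ((visit_prob A n.+1 s x v)%:E = \esum_(z in [set: X])
    (jump_matrix Q x z * ((n == 0%N) || (z \notin A))%:R * visit_prob A n (s * S
      x z) z v)%:E)%E.
Proof.
move=> ss; rewrite -visit_probE.
set E := path_event Y _.
have mE : measurable E by exact: measurable_visit.
rewrite (measure_esum_fibers _ _ _ _ _ (Y 1%N) _ (fun u => mY x 1%N u) mE).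
(* Paths whose first jump is to the cemetery form a null part of [E]. *)
rewrite esum_option//; last first.
  apply: subset_measure0 (cemetery_absorbing hX x 1 n v).
  - by apply: measurableI => //; exact: mY.
  - by apply: measurableI; exact: mY.
  - by move=> w [[Yn _ _] Y1]; split.
apply: eq_esum => z _.
pose T y := ((n == 0%N) || (z \notin A)) /\ visit A n (s * S x z) v y.
have dT : depends n T.
  by move=> y y' yy' [ok vis]; split=> //; exact: depends_visit vis.
have mF : measurable (path_event Y (fun y => y 1%N = Some z /\ T (fun i => y
  i.+1))).
  apply: (measurable_path_event hX x (n := n.+1)) => y y' yy' [y1 Ty]; split.
    by rewrite -yy'.
  by apply: dT Ty => i ni; exact: yy'.
(* The sign of the first jump is S x z only on paths that do start at x; [start_ae] removes this
   restriction afterwards. *)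
have EE : (E `&` [set w | Y 1%N w = Some z]) `&` [set w | Y 0%N w = Some x] =
   path_event Y (fun y => y 1%N = Some z /\ T (fun i => y i.+1)) `&` [set w | Y
     0%N w = Some x].
  apply/seteqP; split=> w [].
    move=> [[Yn av sg] /= Y1] /= Y0; split=> //; split=> //; split.
      case: n av {Yn sg dT mF mE E} T => //= n av _.
      by apply/negP => zA; exact: (av 1%N isT z zA).
    split=> //.
      by move=> i /andP[i0 ni] a aA; apply: av => //=; rewrite ltnS.
    rewrite /path_sign -sg /path_sign big_ord_recl/= Y0 Y1/= mulrAC sign_sqr mul1r.
    by apply: eq_bigr => i _.
  move=> [Y1 [ok [Yn av sg]]] /= Y0; split=> //; split=> //; split=> //.
    move=> [|[|i]]//; last by move=> /= ni a aA; apply: (av i.+1).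
    move=> /= n1 a aA; rewrite Y1 => -[za]; move: ok;
      rewrite za aA/= orbF => /eqP n0.
    by rewrite n0 in n1.
  rewrite /path_sign big_ord_recl/= Y0 Y1/= [s](mulNN1 (S x z)) ?sign_sqr//.
  by congr (_ * _); rewrite [RHS]mulrC -sg; apply: eq_bigr.
transitivity (PX x (path_event Y (fun y => y 1%N = Some z /\ T (fun i => y i.+1)))).
  have mEz : measurable (E `&` [set w | Y 1%N w = Some z]) by apply: measurableI
    => //; exact: mY.
  by rewrite (start_ae hX x mF) -EE -(start_ae hX x mEz).
rewrite (path_event_shift hX P0 x z dT) /=.
rewrite -mulrA EFinM muleC; congr (_ * _)%E.
case ok : ((n == 0%N) || (z \notin A)).
  rewrite mul1r -visit_probE; congr (PX z _).
  by apply/seteqP; split=> w; [move=> []|move=> ?; split].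
rewrite mul0r (_ : path_event _ _ = set0) ?measure0//.
by apply/seteqP; split=> w // []; rewrite ok.
Qed.

Lemma hadamard_abs_summable x (g : X -> R) : (forall z, `|g z| <= 1) ->
  abs_summable (fun z => Pt x z * g z).
Proof.
move=> g1; apply: le_abs_summable (jump_matrix_abs_summable hQ x) => z.
rewrite /hadamard !normrM -[leRHS]mulr1 -mulrA ler_wpM2l//.
have -> : `|S x z| = 1 by case: (sign_cases x z) => ->; rewrite ?normrN normr1.
by rewrite mul1r.
Qed.

(** A jump with S x z = -1 exchanges the two signs, hence changes the sign of the difference: this
    is the factor [S] in [Pt]. *)
Lemma signed_visit_rec A n x v : signed_visit A n.+1 x v =
  infsum (fun z => Pt x z * (((n == 0%N) || (z \notin A))%:R * signed_visit A n
    z v)).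
Proof.
have H1 := visit_prob_rec A n 1 x v (mulr1 1).
have ss : (-1) * (-1) = 1 :> R by rewrite mulrNN mulr1.
have H2 := visit_prob_rec A n (-1) x v ss.
rewrite (infsum_diff
  (fun z => jump_matrix Q x z * ((n == 0%N) || (z \notin A))%:R * visit_prob A n
    (1 * S x z) z v)
  (fun z => jump_matrix Q x z * ((n == 0%N) || (z \notin A))%:R * visit_prob A n
    (-1 * S x z) z v)).
- by rewrite -H1 -H2.
- by move=> z; rewrite !mulr_ge0 ?visit_prob_ge0 ?(jump_matrix_ge0 hQ).
- by move=> z; rewrite !mulr_ge0 ?visit_prob_ge0 ?(jump_matrix_ge0 hQ).
- by rewrite -H1 ltry.
- by rewrite -H2 ltry.
- move=> z; rewrite /hadamard /signed_visit mul1r mulN1r.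
  by case: (sign_cases x z) => ->; rewrite ?opprK; ring.
Qed.

Lemma signed_visit0 A x v : signed_visit A 0 x v = (x == v)%:R.
Proof.
have ps y : path_sign 0 y = 1 by rewrite /path_sign big_ord0.
rewrite /signed_visit /visit_prob.
have -> : path_event Y (visit A 0 (-1) v) = set0.
  apply/seteqP; split=> w // [_ _]; rewrite ps => /eqP.
  by rewrite -subr_eq0 opprK -[1 + 1]/(2%:R) pnatr_eq0.
rewrite measure0 subr0.
have -> : path_event Y (visit A 0 1 v) = [set w | forall i, (i <= 0)%N -> Y i w
  = (fun=> Some v) i].
  apply/seteqP; split=> w.
    by move=> [Y0 _ _] [].
  move=> H; split=> //; [exact: H|by move=> i; rewrite ltn0 andbF].
by rewrite (chain_law (hX x)) big_ord0 mulr1 eq_sym.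
Qed.

(** With an empty [A] no state is avoided, and [signed_visit_rec] becomes the recursion of matrix
    powers. *)
Lemma mxpow_signed_visit n : mxpow Pt n = signed_visit fset0 n.
Proof.
elim: n => [|n IH] /=; apply/funext => x; apply/funext => v.
  by rewrite signed_visit0.
rewrite signed_visit_rec /mxprod; congr infsum; apply/funext => z.
by rewrite IH inE orbT mul1r.
Qed.

End signed_walk.
Arguments path_sign {R X} S n y.
Arguments avoids {X} A n y.
Arguments visit {R X} S A n s v y.

Section first_passage.
Context (R : realType) (X : countType) (Q S : X -> X -> R).
Hypotheses (hQ : symmetric_generator Q) (hS : sign_matrix S).
Context (d : measure_display) (Omega : measurableType d).
Variables (Y : nat -> Omega -> option X) (tau : nat -> {mfun Omega >-> R}).
Variable PX : X -> probability Omega R.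
Hypothesis hX : forall x, process_law Y tau Q x (PX x).
Variable A : {fset X}.

Notation Pt := (hadamard (jump_matrix Q) S).
Notation sv := (signed_visit R X S d Omega Y PX).

(* The term [n = 0] is 0 because [R_A] is at least the first jump time. *)
Definition first_hit a n b : R := if n is 0 then 0 else sv A n b a.

(** The visit at n = 0 counts even in [A], since the initial state is not a hit; this makes
    [first_passage] valid for every starting point. *)
Definition killed_visit n b v : R := if (n == 0%N) || (v \notin A) then sv A n b
  v else 0.

Let M n b v := mxpow Pt n b v.

Let svE := mxpow_signed_visit _ _ _ _ hQ hS _ _ _ _ _ hX.
Let rec_ := signed_visit_rec _ _ _ _ hQ hS _ _ _ _ _ hX.
Let sv0 := signed_visit0 _ _ _ S _ _ _ _ _ hX.
Let sv1 := signed_visit_le1 _ _ _ S _ _ _ _ _ hX.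
Let svs := signed_visit_summable _ _ _ S hQ _ _ _ _ _ hX.
Let has := hadamard_abs_summable _ _ _ _ hQ hS.

Let M1 n b v : `|M n b v| <= 1. Proof. by rewrite /M svE. Qed.

Let norm_bool_mul (b : bool) (x : R) : `|x| <= 1 -> `|b%:R * x| <= 1.
Proof. by case: b => x1; rewrite ?mul1r ?mul0r ?normr0. Qed.

Let c1 a n b : `|first_hit a n b| <= 1.
Proof. by case: n => [|n]; rewrite /first_hit ?normr0. Qed.

Let o1 n b v : `|killed_visit n b v| <= 1.
Proof. by rewrite /killed_visit; case: ifP; rewrite ?normr0. Qed.

Let hit1 a b : first_hit a 1 b = Pt b a.
Proof.
rewrite /first_hit rec_/= -[RHS](infsum_delta _ _ a (Pt b a)).2; congr infsum.
apply/funext => z; rewrite mul1r sv0.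
by case: eqVneq => [->|]; rewrite ?mulr0.
Qed.

Let hit_rec a j b : infsum (fun z => Pt b z * ((z \notin A)%:R * first_hit a j z)) =
  if j is 0 then 0 else first_hit a j.+1 b.
Proof.
case: j => [|j]; last by rewrite [RHS]/first_hit rec_.
rewrite -[RHS](infsum0 R X); congr infsum; apply/funext => z.
by rewrite !mulr0.
Qed.

Let killed_rec n b v : infsum (fun z => Pt b z * ((z \notin A)%:R * killed_visit
  n z v)) =
  killed_visit n.+1 b v.
Proof.
rewrite /killed_visit /=; case vA : (v \in A) => /=; last first.
  rewrite orbT rec_; congr infsum; apply/funext => z.
  case: n => [|n] //=; rewrite mul1r sv0; case: eqVneq => [->|];
    last by rewrite !mulr0.
  by rewrite vA mul1r.
rewrite orbF -[RHS](infsum0 R X); congr infsum; apply/funext => z.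
case: n => [|n] /=; last by rewrite !mulr0.
by rewrite sv0; case: eqVneq => [->|]; rewrite ?vA ?mul0r !mulr0.
Qed.

(** Induction on [n] through the first jump: if it ends at a in [A], the hit occurs at time 1 and
    the walk continues from a without restriction; otherwise the induction hypothesis applies at the
    new state, and every hit is delayed by one jump. *)
Lemma first_passage n b v : mxpow Pt n b v =
  killed_visit n b v + \sum_(a <- A) convolution R (first_hit a ^~ b) (fun k =>
    mxpow Pt k a v) n.
Proof.
rewrite -[LHS]/(M n b v).
elim: n b => [|n IH] b.
  rewrite big1 ?addr0; first by rewrite /M svE /killed_visit/= !sv0.
  by move=> a _; rewrite /convolution big_ord_recl big_ord0 mul0r addr0.
have split_ z : Pt b z * M n z v = \sum_(a <- A) (Pt b a * M n a v) * (z == a)%:R +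
   (Pt b z * ((z \notin A)%:R * killed_visit n z v) +
    \sum_(a <- A) \sum_(j < n.+1) M (n - j)%N a v * (Pt b z * ((z \notin A)%:R *
      first_hit a j z))).
  case zA : (z \in A) => /=.
    rewrite (big_fsetD1 z)//= eqxx mulr1 mul0r mulr0 add0r.
    rewrite big_seq big1 => [|a]; last first.
      by rewrite !inE => /andP[az _]; rewrite eq_sym (negbTE az) mulr0.
    rewrite big1 ?addr0// => a _; rewrite big1// => j _.
    by rewrite mul0r !mulr0.
  rewrite big_seq big1 => [|a aA]; last first.
    have -> : (z == a) = false by apply/eqP => za; rewrite za aA in zA.
    by rewrite mulr0.
  rewrite add0r mul1r IH mulrDr; congr (_ + _).
  rewrite mulr_sumr; apply: eq_bigr => a _.
  rewrite /convolution mulr_sumr; apply: eq_bigr => j _.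
  by rewrite mul1r /M; ring.
have s1 a : abs_summable (fun z => (Pt b a * M n a v) * (z == a)%:R).
  exact: (infsum_delta R X a _).1.
have s2 : abs_summable (fun z => Pt b z * ((z \notin A)%:R * killed_visit n z v)).
  by apply: has => z; exact: norm_bool_mul.
have s3 a (j : 'I_n.+1) : abs_summable (fun z => M (n - j)%N a v * (Pt b z * ((z
  \notin A)%:R * first_hit a j z))).
  by apply: abs_summableZ; apply: has => z; exact: norm_bool_mul.
have t1 := infsum_sum R X X A (fun a z => (Pt b a * M n a v) * (z == a)%:R) s1.
have t3 a := infsum_sum R X _ (index_enum 'I_n.+1)
  (fun j z => M (n - j)%N a v * (Pt b z * ((z \notin A)%:R * first_hit a j z)))
    (s3 a).
have t4 := infsum_sum R X X A (fun a z => \sum_(j < n.+1) M (n - j)%N a v *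
   (Pt b z * ((z \notin A)%:R * first_hit a j z))) (fun a => (t3 a).1).
rewrite {1}/M /= /mxprod.
transitivity (infsum (fun z => Pt b z * M n z v)); first by [].
rewrite (funext split_).
rewrite infsumD; [|exact: t1.1|by apply: abs_summableD => //; exact: t4.1].
rewrite infsumD; [|exact: s2|exact: t4.1].
rewrite killed_rec t1.2 t4.2 addrCA; congr (_ + _).
rewrite -big_split/=; apply: eq_bigr => a _.
rewrite (infsum_delta R X a _).2 (t3 a).2 /convolution.
(* The term j = 0 of the convolution vanishes, the term j = 1 is [Pt b a] times the power of order
   n, and the later terms come from the induction hypothesis. *)
rewrite [RHS]big_ord_recl/= mul0r add0r [RHS]big_ord_recl [X in _ = X + _]/=
  -[bump 0 0]/(1%N) [sv A 1 b a](hit1 a b) subn1 -[n.+1.-1]/n; congr (_ + _).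
rewrite big_ord_recl infsumZ; last by apply: has => z; exact: norm_bool_mul.
rewrite (hit_rec a 0%N) mulr0 add0r; apply: eq_bigr => j _.
rewrite infsumZ; last by apply: has => z; exact: norm_bool_mul.
by rewrite (hit_rec a j.+1) mulrC; congr (_ * mxpow _ _ _ _).
Qed.

Lemma first_hit_summable a b : cvgn (series (fun n => `|first_hit a n b|)).
Proof.
have H := svs A b a.
by apply: (@series_le_cvg _ _ (fun n => `|sv A n b a|)) => // -[|n];
  rewrite /first_hit ?normr0.
Qed.

Lemma mxpow_summable b v : cvgn (series (fun n => `|mxpow Pt n b v|)).
Proof. by under eq_fun do rewrite svE; exact: svs. Qed.

Lemma killed_visit_summable b v : cvgn (series (fun n => `|killed_visit n b v|)).
Proof.
have H := svs A b v.
apply: (@series_le_cvg _ _ (fun n => `|sv A n b v|)) => // n.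
by rewrite /killed_visit; case: ifP; rewrite ?normr0.
Qed.

(** Summation over n turns the convolutions into products of sums; this is where absolute
    summability enters. *)
Lemma neumann_first_passage b v : neumann Pt b v =
  limn (series (fun n => killed_visit n b v)) +
  \sum_(a <- A) limn (series (first_hit a ^~ b)) * neumann Pt a v.
Proof.
have cM := normed_cvg (mxpow_summable b v).
have co := normed_cvg (killed_visit_summable b v).
have cc a : series (convolution R (first_hit a ^~ b) (fun k => mxpow Pt k a v))
  @ \oo -->
    limn (series (first_hit a ^~ b)) * neumann Pt a v.
  by apply: cauchy_product_cvg; [exact: first_hit_summable|exact: mxpow_summable].
have cs : (fun n => \sum_(a <- A) series (convolution R (first_hit a ^~ b) (fun
  k => mxpow Pt k a v)) n)
    @ \oo --> \sum_(a <- A) limn (series (first_hit a ^~ b)) * neumann Pt a v.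
  elim: (A : seq X) => [|a s IHs].
    rewrite big_nil (_ : (fun n => _) = cst 0); first exact: cvg_cst.
    by apply/funext => n; rewrite big_nil.
  rewrite big_cons (_ : (fun n => _) = (fun n => series (convolution R
    (first_hit a ^~ b)
    (fun k => mxpow Pt k a v)) n + \sum_(a0 <- s) series (convolution R
      (first_hit a0 ^~ b)
    (fun k => mxpow Pt k a0 v)) n)); first by apply: cvgD; [exact: cc|exact: IHs].
  by apply/funext => n; rewrite big_cons.
rewrite /neumann; apply: cvg_lim => //.
rewrite (_ : series _ = (fun n => series (fun n => killed_visit n b v) n +
  \sum_(a <- A) series (convolution R (first_hit a ^~ b) (fun k => mxpow Pt k a
    v)) n)).
  exact: cvgD.
apply/funext => N; rewrite !seriesEnat/= exchange_big/= -big_split/=.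
by apply: eq_bigr => n _; rewrite first_passage.
Qed.

Definition hitting_coef b a := limn (series (first_hit a ^~ b)).

Lemma Sigma_first_passage b v : Sigma Q S b v =
  - (limn (series (fun n => killed_visit n b v)) * (Q v v)^-1) +
  \sum_(a <- A) hitting_coef b a * Sigma Q S a v.
Proof.
rewrite /Sigma /decomp_inv neumann_first_passage mulrDl opprD; congr (_ + _).
rewrite mulr_suml -sumrN; apply: eq_bigr => a _.
by rewrite mulrN mulrA.
Qed.

(** The killed walk contributes nothing: at n = 0 it is at [b], which differs from [a], and a later
    presence at [a] is a hit. *)
Lemma Sigma_normal_equations b : b \notin A ->
  {in A, forall a, Sigma Q S b a = \sum_(a' <- A) hitting_coef b a' * Sigma Q S
    a' a}.
Proof.
move=> bA a aA; rewrite Sigma_first_passage.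
rewrite (_ : series _ = cst 0) ?lim_cst// ?mul0r ?oppr0 ?add0r//.
apply/funext => N; rewrite seriesEnat/= big1// => -[|n] _; rewrite /killed_visit/=.
  by rewrite sv0; case: eqVneq bA aA => // ->  /negbTE ->.
by rewrite aA.
Qed.

Lemma Sigma_residual b b' : b' \notin A ->
  Sigma Q S b b' - \sum_(a <- A) hitting_coef b a * Sigma Q S a b' =
  limn (series (fun n => sv A n b b')) * (- Q b' b')^-1.
Proof.
move=> bA; rewrite Sigma_first_passage addrK invrN mulrN.
suff -> : (fun n => killed_visit n b b') = (fun n => sv A n b b') by [].
by apply/funext => n; rewrite /killed_visit bA orbT.
Qed.

End first_passage.

(** * Sample paths *)

Lemma path_sign_cases (R : realType) (X : countType) (S : X -> X -> R) (hS :
  sign_matrix S) n y : path_sign S n y = 1 \/ path_sign S n y = -1.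
Proof.
rewrite /path_sign; elim: n => [|n IH]; first by left; rewrite big_ord0.
rewrite big_ord_recr/=.
have : trans_sign S (y n) (y n.+1) = 1 \/ trans_sign S (y n) (y n.+1) = -1.
  by case: (y n) (y n.+1) => [u|] [v|] /=; (try by left); exact: sign_cases.
by case: IH => ->; case=> ->; rewrite ?mulr1 ?mul1r ?mulrNN ?mulr1; tauto.
Qed.

Arguments path_sign_cases {R X S} hS n y.

Section pathwise.
Context (R : realType) (X : countType) (S : X -> X -> R).
Context (d : measure_display) (Omega : measurableType d).
Variables (Y : nat -> Omega -> option X) (tau : nat -> {mfun Omega >-> R}).
Hypothesis tau0 : forall n w, 0 < tau n w.
Implicit Types (w : Omega) (A : {fset X}).

Lemma jump_timeS n w : jump_time tau n.+1 w = jump_time tau n w + tau n w.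
Proof. by rewrite /jump_time big_ord_recr. Qed.

Lemma jump_time_le m n w : (m <= n)%N -> jump_time tau m w <= jump_time tau n w.
Proof.
apply: (@homo_leq _ (jump_time tau ^~ w) <=%R) => // [x y z|k];
  first exact: le_trans.
by rewrite jump_timeS lerDl ltW.
Qed.

Lemma jump_time_lt m n w : (m < n)%N -> jump_time tau m w < jump_time tau n w.
Proof.
move=> mn; apply: lt_le_trans (jump_time_le _ _ _ mn).
by rewrite jump_timeS ltrDl.
Qed.

Lemma jump_time_ge0 n w : 0 <= jump_time tau n w.
Proof. by apply: le_trans (jump_time_le 0 n w _) => //;
  rewrite /jump_time big_ord0. Qed.

Lemma jump_interval_uniq m n w t : jump_time tau m w <= t < jump_time tau m.+1 w ->
  jump_time tau n w <= t < jump_time tau n.+1 w -> m = n.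
Proof.
move=> /andP[m1 m2] /andP[n1 n2]; apply/eqP; rewrite eqn_leq; apply/andP; split.
  rewrite leqNgt; apply/negP => /(jump_time_le _ _ w) H.
  by have := lt_le_trans n2 (le_trans H m1); rewrite ltxx.
rewrite leqNgt; apply/negP => /(jump_time_le _ _ w) H.
by have := lt_le_trans m2 (le_trans H n1); rewrite ltxx.
Qed.

Lemma state_jump_interval n w t : jump_time tau n w <= t < jump_time tau n.+1 w ->
  state Y tau t w = Y n w.
Proof.
move=> tn; rewrite /state; case: xgetP => [u _ [m [tm <-]]|/(_ (Y n w))].
  by rewrite (jump_interval_uniq _ _ _ _ tm tn).
by case; exists n.
Qed.

Lemma state_Some w t v : state Y tau t w = Some v ->
  exists n, jump_time tau n w <= t < jump_time tau n.+1 w /\ Y n w = Some v.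
Proof.
by rewrite /state; case: xgetP => [u -> [n [tn <-]]|//] Yn; exists n.
Qed.

Lemma sign_process_jump_interval n w t : jump_time tau n w <= t < jump_time tau
  n.+1 w ->
  sign_process Y tau S t w = path_sign S n (Y ^~ w).
Proof.
move=> /andP[t1 t2]; rewrite /sign_process.
(* The jumps made by time t have indices 1 to n, so the product ranges over a finite set. *)
have -> : [set i | (1 <= i)%N /\ jump_time tau i w <= t] = [set i | (0 < i <
  n.+1)%N].
  apply/seteqP; split=> i /=.
    move=> [-> it] /=; rewrite ltnNge; apply/negP => /(jump_time_le _ _ w) H.
    by have := lt_le_trans t2 (le_trans H it); rewrite ltxx.
  move=> /andP[i0 ni]; split=> //; apply: le_trans t1; exact: jump_time_le.
rewrite -[X in \big[_/_]_(i \in X) _](_ : [set` index_iota 1 n.+1] = _); last first.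
  by apply/seteqP; split=> i /=; rewrite mem_index_iota.
rewrite -fsbig_seq ?iota_uniq//.
by rewrite /path_sign big_add1/= big_mkord.
Qed.

Definition in_fset A (u : option X) := exists2 a, a \in A & u = Some a.

Lemma avoidsE A n (y : nat -> option X) :
  avoids A n y <-> forall i, (0 < i < n)%N -> ~ in_fset A (y i).
Proof.
split=> H i /H; first by move=> H1 [a aA]; exact: H1.
by move=> H1 a aA ya; apply: H1; exists a.
Qed.

(** The state is constant between jumps, so a time spent in [A] belongs to a holding interval whose
    left end is not before the n-th jump. The requirement [jump_time 1 w <= t] in [hit_time] rules
    out the initial interval. *)
Lemma hit_time_first A n w : (0 < n)%N -> in_fset A (Y n w) -> avoids A n (Y ^~
  w) ->
  hit_time Y tau A w = (jump_time tau n w)%:E.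
Proof.
move=> n0 Yn /avoidsE av; apply/eqP; rewrite eq_le; apply/andP; split.
  apply: ereal_inf_lbound; exists (jump_time tau n w) => //; split.
    exact: jump_time_le.
  have [a aA Ya] := Yn; exists a => //.
  by rewrite (state_jump_interval n) // lexx jump_time_lt.
apply: le_ereal_inf_tmp => _ [t [t1 [a aA ta]] <-]; rewrite lee_fin.
have [k [/andP[kt tk] Yk]] := state_Some _ _ _ ta.
apply: le_trans kt; apply: jump_time_le; rewrite leqNgt; apply/negP => kn.
have k0 : (0 < k)%N.
  rewrite lt0n; apply/eqP => k0; move: tk; rewrite k0 => tk.
  by have := lt_le_trans tk t1; rewrite ltxx.
by apply: (av k); [rewrite k0 kn|exists a].
Qed.

Lemma hit_time_never A w : (forall n, (0 < n)%N -> ~ in_fset A (Y n w)) ->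
  hit_time Y tau A w = +oo%E.
Proof.
move=> H; rewrite /hit_time (_ : [set _ | t in _] = set0) ?ereal_inf0//.
apply/seteqP; split=> // x [t [t1 [a aA ta]] _].
have [k [/andP[kt tk] Yk]] := state_Some _ _ _ ta.
apply: (H k); last by exists a.
rewrite lt0n; apply/eqP => k0; move: tk; rewrite k0 => tk.
by have := lt_le_trans tk t1; rewrite ltxx.
Qed.

Lemma first_hit_dec A w : (exists n, [/\ (0 < n)%N, in_fset A (Y n w) & avoids A
  n (Y ^~ w)]) \/
  (forall n, (0 < n)%N -> ~ in_fset A (Y n w)).
Proof.
have [[n [n0 Yn]]|H] := pselect (exists n, (0 < n)%N /\ in_fset A (Y n w));
  last first.
  by right=> n n0 Yn; apply: H; exists n.
left.
have ex : exists n, (0 < n)%N && `[< in_fset A (Y n w) >].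
  by exists n; rewrite n0; exact/asboolP.
exists (ex_minn ex); case: ex_minnP => k /andP[k0 /asboolP Yk] kmin; split=> //.
apply/avoidsE => i /andP[i0 ik] Yi.
have := kmin i; rewrite i0/= => /(_ (asboolT Yi)).
by rewrite leqNgt ik.
Qed.

Lemma visit_uniq A m n s s' a y : a \in A -> (0 < m)%N -> (0 < n)%N ->
  visit S A m s a y -> visit S A n s' a y -> m = n.
Proof.
move=> aA m0 n0 [ym avm _] [yn avn _].
apply/eqP; rewrite eqn_leq; apply/andP; split; rewrite leqNgt; apply/negP => H.
  by apply: (avm n _ a) => //; rewrite n0.
by apply: (avn m _ a) => //; rewrite m0.
Qed.

(** Indices start at 1 because [R_A] is at least the first jump time. *)
Definition first_visit A a s : set Omega := \bigcup_n path_event Y (visit S A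
  n.+1 s a).

(** At the first hit, after n jumps, H equals [path_sign S n]. The difference of indicators reduces
    the expectation to probabilities of path events. *)
Lemma hit_signE (hS : sign_matrix S) A a w : a \in A ->
  hit_sign Y tau S A a w = \1_(first_visit A a 1) w - \1_(first_visit A a (-1)) w.
Proof.
move=> aA.
have not_ s : ~ (exists n, [/\ (0 < n)%N, Y n w = Some a & avoids A n (Y ^~ w)
  /\ path_sign S n (Y ^~ w) = s]) ->
    \1_(first_visit A a s) w = 0 :> R.
  move=> H; rewrite indicE memNset// => -[n _ [Yn av sg]]; apply: H.
  by exists n.+1; split.
rewrite /hit_sign; case: (first_hit_dec A w) => [[n [n0 Yn av]]|H]; last first.
  rewrite hit_time_never// !not_ ?subrr// => -[n [n0 Yn _]]; apply: (H n) => //;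
    by exists a.
rewrite (hit_time_first A n)//.
have jn : jump_time tau n w <= jump_time tau n w < jump_time tau n.+1 w.
  by rewrite lexx jump_time_lt.
rewrite (state_jump_interval n)// (sign_process_jump_interval n)//.
(* If the hit is at another state, no first visit to [a] exists: it would have to occur at the same
   index n, because m < n and n < m each contradict an avoidance. *)
have [Ya|Ya] := eqVneq (Y n w) (Some a); last first.
  rewrite mul0r !not_ ?subrr// => -[m [m0 Ym [avm _]]];
  (have mn : m = n; [|by rewrite -mn Ym eqxx in Ya]);
  (apply/eqP; rewrite eqn_leq; apply/andP; split; rewrite leqNgt; apply/negP => H);
  have [a' a'A Ya'] := Yn.
  - by apply: (avm n _ a') => //; rewrite n0.
  - by apply: (av m _ a) => //; rewrite m0.
  - by apply: (avm n _ a') => //; rewrite n0.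
  - by apply: (av m _ a) => //; rewrite m0.
have in_ s : path_sign S n (Y ^~ w) = s -> \1_(first_visit A a s) w = 1 :> R.
  move=> sg; rewrite indicE mem_set//; exists n.-1 => //.
  by rewrite /path_event/= prednK//; split.
have out s : path_sign S n (Y ^~ w) <> s -> \1_(first_visit A a s) w = 0 :> R.
  move=> sg; apply: not_ => -[m [m0 Ym [avm sgm]]]; apply: sg.
  rewrite -sgm (_ : m = n)//.
  by apply: (visit_uniq A m n s (path_sign S n (Y ^~ w)) a (Y ^~ w)).
have n11 : 1 <> -1 :> R.
  by move/eqP; rewrite -subr_eq0 opprK -[1 + 1]/(2%:R) pnatr_eq0.
rewrite mul1r; case: (path_sign_cases hS n (Y ^~ w)) => sg.
  by rewrite sg (in_ _ sg) out ?subr0// sg.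
by rewrite sg (in_ _ sg) out ?sub0r// sg => /esym.
Qed.

End pathwise.
Arguments first_visit {R X} S {d Omega} Y A a s.
Arguments in_fset {X} A u.
Arguments jump_time_le {R d Omega tau} tau0 m n w.
Arguments jump_time_lt {R d Omega tau} tau0 m n w.
Arguments jump_time_ge0 {R d Omega tau} tau0 n w.
Arguments jump_interval_uniq {R d Omega tau} tau0 {m n w t}.
Arguments state_jump_interval {R X d Omega Y tau} tau0 n {w t}.
Arguments state_Some {R X d Omega Y tau w t v}.
Arguments sign_process_jump_interval {R X S d Omega Y tau} tau0 n {w t}.
Arguments hit_time_first {R X d Omega Y tau} tau0 {A n w}.
Arguments hit_time_never {R X d Omega Y tau A w}.
Arguments first_hit_dec {X d Omega} Y A w.
Arguments visit_uniq {R X S A m n s s' a y}.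
Arguments hit_signE {R X S d Omega Y tau} tau0 hS {A a} w.

(** * Expected sign at the hitting time *)

Section expectation_hit_sign.
Context (R : realType) (X : countType) (Q S : X -> X -> R).
Hypotheses (hQ : symmetric_generator Q) (hS : sign_matrix S).
Context (d : measure_display) (Omega : measurableType d).
Variables (Y : nat -> Omega -> option X) (tau : nat -> {mfun Omega >-> R}).
Variable PX : X -> probability Omega R.
Hypothesis hX : forall x, process_law Y tau Q x (PX x).
Variable A : {fset X}.
Notation vp := (visit_prob R X S d Omega Y PX).

Lemma measure_bigcup_series (b : X) (F : nat -> set Omega) : (forall n,
  measurable (F n)) ->
  trivIset setT F ->
  series (fun n => fine (PX b (F n))) @ \oo --> fine (PX b (\bigcup_n F n)).
Proof.
move=> mF tF.
have mU : measurable (\bigcup_n F n) by exact: bigcupT_measurable.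
have fin_ B : measurable B -> PX b B \is a fin_num by move=> mB;
  exact: fin_num_measure.
have H := measure_semi_sigma_additive F mF tF mU.
have E : (fun n => \sum_(0 <= i < n) PX b (F i))%E = EFin \o series (fun n =>
  fine (PX b (F n))).
  apply/funext => n; rewrite seriesEnat/= -sumEFin; apply: eq_bigr => i _.
  by rewrite fineK// fin_.
apply: (@fine_cvg _ _ \oo _ (EFin \o series (fun n => fine (PX b (F n))))).
rewrite -E fineK; first exact: H.
exact: fin_.
Qed.

Let measurable_first_visit (b a : X) s : measurable (first_visit S Y A a s).
Proof.
by apply: bigcupT_measurable => n; exact: (measurable_visit _ _ Q S _ _ _ _ _ hX b).
Qed.

Lemma first_visit_prob b a s : a \in A ->
  series (fun n => vp A n.+1 s b a) @ \oo --> fine (PX b (first_visit S Y A a s)).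
Proof.
move=> aA; apply: measure_bigcup_series => [n|];
  first exact: (measurable_visit _ _ Q S _ _ _ _ _ hX b).
apply/trivIsetP => m n _ _ mn; apply/seteqP; split=> // w [vm vn].
by move: mn; rewrite -eqSS (visit_uniq aA (ltn0Sn _) (ltn0Sn _) vm vn) eqxx.
Qed.

Lemma expectation_hit_sign b a : a \in A ->
  fine ('E_(PX b)[hit_sign Y tau S A a])%E = hitting_coef R X S d Omega Y PX A b a.
Proof.
move=> aA.
have t0 n w : 0 < tau n w by case: (hX b).
have mf s := measurable_first_visit b a s.
have ii s : (PX b).-integrable setT (EFin \o (\1_(first_visit S Y A a s) : Omega
  -> R)).
  by have := @integrable_indic _ _ R (PX b) _ (mf s).
rewrite unlock.
transitivity (fine (\int[PX b]_w ((\1_(first_visit S Y A a 1) w : R)%:E -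
  (\1_(first_visit S Y A a (-1)) w : R)%:E)))%E.
  congr fine; apply: eq_integral => w _.
  by rewrite (hit_signE t0 hS)// EFinB.
have fin_ s : PX b (first_visit S Y A a s) \is a fin_num by exact: fin_num_measure.
rewrite (integralB_EFin measurableT (ii 1) (ii (-1))) !integral_indic// !setIT
  fineB; [|exact: fin_|exact: fin_].
apply/esym/cvg_lim; first by [].
(* The shift drops the term n = 0 of [first_hit], which is 0. *)
rewrite -(cvg_shiftS (series _)).
rewrite (_ : (fun n => _) = (fun n => series (fun n => vp A n.+1 1 b a) n -
   series (fun n => vp A n.+1 (-1) b a) n)); first by apply: cvgB;
     exact: first_visit_prob.
apply/funext => n; rewrite !seriesEnat/= big_nat_recl//= add0r -sumrB.
by apply: eq_bigr.
Qed.

End expectation_hit_sign.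

(** * Signed occupation times and holding times *)

Section occupation.
Context (R : realType) (X : countType) (Q S : X -> X -> R).
Hypotheses (hQ : symmetric_generator Q) (hS : sign_matrix S).
Context (d : measure_display) (Omega : measurableType d).
Variables (Y : nat -> Omega -> option X) (tau : nat -> {mfun Omega >-> R}).
Variable PX : X -> probability Omega R.
Hypothesis hX : forall x, process_law Y tau Q x (PX x).
Variable A : {fset X}.
Variable v : X.
Hypothesis vA : v \notin A.
Notation vp := (visit_prob R X S d Omega Y PX).
Notation mu := (@lebesgue_measure R).

Definition visit_event n s : set Omega := path_event Y (visit S A n s v).

Definition jump_interval n w : set R := `[jump_time tau n w, jump_time tau n.+1
  w[%classic.

(** For s = 1 or -1, the set of times at which the integrand of [signed_occupation] equals [s],
    presented as a union of holding intervals. *)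
Definition occupied s w : set R := \bigcup_n (if w \in visit_event n s then
  jump_interval n w else set0).

Section fixed_path.
Hypothesis tau0 : forall n w, 0 < tau n w.

Let jle := jump_time_le tau0.
Let jlt := jump_time_lt tau0.

Let sgn_occ s t w : occupied s w t -> state Y tau t w = Some v /\ sign_process Y
  tau S t w = s /\
  (t%:E < hit_time Y tau A w)%E /\ 0 <= t.
Proof.
move=> [n _]; case: ifP => // /set_mem [Yn av sg] /=;
  rewrite /jump_interval/= in_itv/= => tn.
split; first by rewrite (state_jump_interval tau0 n).
split; first by rewrite (sign_process_jump_interval tau0 n).
have [t1 t2] := andP tn.
split; last by apply: le_trans t1; exact: (jump_time_ge0 tau0).
case: (first_hit_dec Y A w) => [[m [m0 Ym avm]]|H]; last first.
  by rewrite hit_time_never// ltry.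
rewrite (hit_time_first tau0 m0 Ym avm) lte_fin.
(* The holding interval ends no later than the hit: m = n is excluded because [v] is not in [A], and
   m < n because the path avoids [A] before n. *)
apply: lt_le_trans t2 _; apply: jle; rewrite ltnNge; apply/negP => mn.
move: mn; rewrite leq_eqVlt => /predU1P[mn|mn].
  by have [a aA] := Ym; rewrite mn Yn => -[va]; move: vA; rewrite va aA.
by have [a aA Ya] := Ym; apply: (av m _ a) => //; rewrite m0 mn.
Qed.

Let occ_sgn t w : 0 <= t -> state Y tau t w = Some v -> (t%:E < hit_time Y tau A
  w)%E ->
  occupied (sign_process Y tau S t w) w t.
Proof.
move=> t0 st th.
have [n [tn Yn]] := state_Some st.
exists n => //; rewrite mem_set; first by rewrite /jump_interval/= in_itv.
split=> //; last by rewrite (sign_process_jump_interval tau0 n).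
have [t1 t2] := andP tn.
case: (first_hit_dec Y A w) => [[m [m0 Ym avm]]|H]; last first.
  by apply/avoidsE => i /andP[i0 _]; exact: H.
move: th; rewrite (hit_time_first tau0 m0 Ym avm) lte_fin => tm.
have nm : (n < m)%N.
  rewrite ltnNge; apply/negP => /(jle _ _ w) H.
  by have := lt_le_trans tm (le_trans H t1); rewrite ltxx.
move=> i /andP[i0 ni]; apply: avm; rewrite i0/=; exact: ltn_trans nm.
Qed.

Let measurable_occupied s w : measurable (occupied s w).
Proof. by apply: bigcupT_measurable => n; case: ifP => // _;
  exact: measurable_itv. Qed.

Lemma occupied_measure s w :
  mu (occupied s w) = (\sum_(0 <= n <oo) (\1_(visit_event n s) w * tau n w)%:E)%E.
Proof.
rewrite /occupied measure_bigcup//=; last 2 first.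
- by move=> n _; case: ifP => // _; exact: measurable_itv.
- apply/trivIsetP => m n _ _ mn; apply/seteqP; split=> // t [].
  case: ifP => // _; case: ifP => // _; rewrite /jump_interval/= !in_itv/= => h1 h2.
  by move: mn; rewrite (jump_interval_uniq tau0 h1 h2) eqxx.
rewrite (eq_eseriesl (Q := xpredT)); last by move=> n; rewrite in_setT.
apply: eq_eseriesr => n _; rewrite indicE; case: ifP => _.
  rewrite /jump_interval lebesgue_measure_itv/= lte_fin jlt// -EFinB mul1r.
  by rewrite jump_timeS addrAC subrr add0r.
by rewrite measure0 mul0r.
Qed.

(** The integrand takes the values 1, -1 and 0, so its positive and negative parts are the
    indicators of the two sets. By [integralE] the identity holds even where both measures are
    infinite. *)
Lemma signed_occupationE w : signed_occupation Y tau S A v w =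
  (mu (occupied 1 w) - mu (occupied (-1) w))%E.
Proof.
pose f (s : R) : \bar R := ((state Y tau s w == Some v)%:R * sign_process Y tau
  S s w *
  ((s%:E < hit_time Y tau A w)%E)%:R)%:E.
rewrite -[LHS]/(\int[mu]_(s in `[0%R, +oo[) f s)%E.
have n11 : 1 <> -1 :> R.
  by move/eqP; rewrite -subr_eq0 opprK -[1 + 1]/(2%:R) pnatr_eq0.
have sc t : occupied 1 w t \/ occupied (-1) w t \/ (t < 0 \/ f t = 0%E).
  have [t0|t0] := leP 0 t; last by right; right; left.
  have [st|st] := eqVneq (state Y tau t w) (Some v); last first.
    by right; right; right; rewrite /f (negbTE st) !mul0r.
  have [th|th] := boolP (t%:E < hit_time Y tau A w)%E; last first.
    by right; right; right; rewrite /f (negbTE th) mulr0.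
  have H := occ_sgn _ _ t0 st th.
  have [n [tn Yn]] := state_Some st.
  move: H; rewrite (sign_process_jump_interval tau0 n)//.
  by case: (path_sign_cases hS n (Y ^~ w)) => ->; tauto.
have fE t s : occupied s w t -> f t = s%:E.
  move=> /sgn_occ[st [sg [th t0]]].
  by rewrite /f st eqxx sg th mul1r mulr1.
have disj t : occupied 1 w t -> occupied (-1) w t -> False.
  by move=> /fE H1 /fE; rewrite H1 => -[].
have mp := measurable_occupied 1 w; have mn := measurable_occupied (-1) w.
rewrite integralE; congr (_ - _)%E.
- transitivity (\int[mu]_(s in `[0%R, +oo[) (\1_(occupied 1 w) s)%:E)%E.
    apply: eq_integral => t; rewrite inE/= in_itv/= andbT => t0.
    rewrite funeposE indicE; case: (sc t) => [H|[H|[H|H]]].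
    + by rewrite (fE _ _ H) mem_set// maxEle ifF// lee_fin ler10.
    + rewrite (fE _ _ H) memNset; last by move=> H2; exact: disj H2 H.
      by rewrite maxEle ifT// lee_fin oppr_le0.
    + by move: H; rewrite ltNge t0.
    + rewrite H maxxx memNset// => /fE; rewrite H => -[] /eqP.
      by rewrite eq_sym oner_eq0.
  rewrite integral_indic//; congr (mu _); apply/seteqP; split=> t; first by case.
  by move=> H; split=> //=; rewrite in_itv/= andbT;
    have [_ [_ [_ +]]] := sgn_occ _ _ _ H.
- transitivity (\int[mu]_(s in `[0%R, +oo[) (\1_(occupied (-1) w) s)%:E)%E.
    apply: eq_integral => t; rewrite inE/= in_itv/= andbT => t0.
    rewrite funenegE indicE; case: (sc t) => [H|[H|[H|H]]].
    + rewrite (fE _ _ H) memNset; last by move=> H2; exact: disj H H2.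
      by rewrite maxEle ifT//= lee_fin oppr_le0.
    + by rewrite (fE _ _ H) mem_set//= opprK maxEle ifF// lee_fin ler10.
    + by move: H; rewrite ltNge t0.
    + rewrite H oppe0 maxxx memNset// => /fE; rewrite H => -[] /eqP.
      by rewrite eq_sym oppr_eq0 oner_eq0.
  rewrite integral_indic//; congr (mu _); apply/seteqP; split=> t; first by case.
  by move=> H; split=> //=; rewrite in_itv/= andbT;
    have [_ [_ [_ +]]] := sgn_occ _ _ _ H.
Qed.

End fixed_path.

End occupation.

Section holding_times.
Context (R : realType) (X : countType) (Q : X -> X -> R).
Hypothesis hQ : symmetric_generator Q.
Context (d : measure_display) (Omega : measurableType d).
Variables (Y : nat -> Omega -> option X) (tau : nat -> {mfun Omega >-> R}).
Variable PX : X -> probability Omega R.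
Hypothesis hX : forall x, process_law Y tau Q x (PX x).
Notation mu := (@lebesgue_measure R).

Let tau0 (x0 : X) n w : 0 < tau n w. Proof. by case: (hX x0). Qed.

Let fin_ x B : measurable B -> PX x B \is a fin_num.
Proof. by move=> mB; exact: fin_num_measure. Qed.

Let measurable_tau n (r : R) : measurable [set w | tau n w <= r].
Proof.
rewrite (_ : [set w | _] = tau n @^-1` `]-oo, r]).
  by rewrite -[X in measurable X]setTI; apply: measurable_funPT => //;
    exact: measurable_itv.
by apply/seteqP; split=> w /=; rewrite in_itv.
Qed.

Lemma holding_cdf x n T z r : depends n T -> (forall y, T y -> y n = Some z) ->
  0 < r ->
  PX x (path_event Y T `&` [set w | tau n w <= r]) =
  (PX x (path_event Y T) * (1 - expR (Q z z * r))%:E)%E.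
Proof.
move=> dT Tz r0.
have Qz : 0 < - Q z z by rewrite oppr_gt0 (gen_diag hQ).
have k0 : 0 <= 1 - expR (Q z z * r).
  by rewrite subr_ge0 expR_le1 nmulr_rle0 ?(gen_diag hQ)// ltW.
apply: (path_event_indep hX x (n := n)) => // y Ty.
(* Only the n-th holding time is constrained; the earlier factors in [holding_law] are total masses,
   equal to 1. *)
pose B i : set R := if i == n then `[0, r]%classic else setT.
have mB i : measurable (B i) by rewrite /B; case: ifP => // _;
  exact: measurable_itv.
have HL := @holding_law _ _ _ _ _ _ _ _ _ (hX x) n y B mB.
transitivity (PX x [set w | (forall i, (i <= n)%N -> Y i w = y i) /\
   (forall i, (i <= n)%N -> y i <> None -> B i (tau i w))]).
  congr (PX x _); apply/seteqP; split=> w.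
    move=> [cy /= tr]; split=> // i ni yi; rewrite /B; case: eqP => // ->.
    by rewrite /= in_itv/= (ltW (tau0 x n w)) tr.
  move=> [cy H]; split=> //=; have Hn : B n (tau n w) by apply: H => //; rewrite Tz.
  move: Hn.
  by rewrite /B eqxx /= in_itv/= => /andP[].
rewrite HL; congr (_ * _)%E; rewrite big_ord_recr/= Tz// /B eqxx.
rewrite exponential_prob_itv0c// opprK EFinB big1 ?mul1e// => i _.
case: (y i) => // u; rewrite ifF; last by rewrite ltn_eqF.
by rewrite /exponential_prob integral_exponential_pdf// oppr_gt0 (gen_diag hQ).
Qed.

(** The mean of a nonnegative variable is the integral of its tail, and here the tail at r is P(T)
    exp(q_zz r). *)
Lemma integral_holding x n T z : depends n T -> (forall y, T y -> y n = Some z) ->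
  (\int[PX x]_w (\1_(path_event Y T) w * tau n w)%:E =
   PX x (path_event Y T) * ((- Q z z)^-1)%:E)%E.
Proof.
move=> dT Tz.
have Qz : 0 < - Q z z by rewrite oppr_gt0 (gen_diag hQ).
have mT := measurable_path_event hX x dT.
have mW : measurable_fun setT (fun w => (\1_(path_event Y T) w * tau n w) : R).
  by apply: measurable_funM => //; exact: measurable_indic.
pose W : {RV (PX x) >-> R} := mfun_Sub (mem_set mW).
have W0 w : 0 <= W w by rewrite /= mulr_ge0// ltW// (tau0 x).
have -> : (\int[PX x]_w (\1_(path_event Y T) w * tau n w)%:E = 'E_(PX x)[W])%E.
  by rewrite unlock.
rewrite ge0_expectation_ccdf//.
set p := PX x (path_event Y T).
have pE : p = (fine p)%:E by rewrite fineK// fin_.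
(* Expressed through the exponential density, whose total mass 1 then gives the integral. *)
have ccE r : 0 <= r -> ccdf W r = ((fine p / (- Q z z)) * exponential_pdf (- Q z
  z) r)%:E.
  move=> r0.
  rewrite exponential_pdfE// mulrA divfK ?gt_eqF// opprK.
  have mt := measurable_tau n r; pose F := [set w | tau n w <= r].
  have Er : PX x (path_event Y T `\` F) = (fine p * expR (Q z z * r))%:E.
    have D : PX x (path_event Y T) = (PX x (path_event Y T `\` F) +
        PX x (path_event Y T `&` F))%E by exact: measureDI.
    (* At r = 0 the positivity of the holding time replaces [holding_cdf]. *)
    move: r0; rewrite le_eqVlt => /predU1P[r00|r0].
      rewrite -r00 mulr0 expR0 mulr1 -pE; congr (PX x _); apply/seteqP;
        split=> w; first by case.
      by move=> Tw; split=> //; rewrite /F/= -r00; apply/negP; rewrite -ltNge;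
        exact: (tau0 x).
    have fE : PX x (path_event Y T `\` F) \is a fin_num.
      by apply: fin_; exact: measurableD.
    move: D; rewrite (holding_cdf x n T z r)// -/p pE -EFinM -[X in (X +
      _)%E]fineK// -EFinD => -[D].
    by rewrite -[LHS]fineK//; congr EFin; lra.
  rewrite -Er; congr (PX x _); apply/seteqP; split=> w /=;
    rewrite in_itv/= andbT indicE.
    case: (boolP (w \in path_event Y T)) => wT.
      by rewrite mul1r => rt; split; [exact: set_mem|apply/negP; rewrite -ltNge].
    by rewrite mul0r ltNge r0.
  by move=> [Tw] /negP; rewrite -ltNge mem_set// mul1r.
transitivity (\int[mu]_(r in `[0%R, +oo[) ((fine p / (- Q z z))%:E *
  (exponential_pdf (- Q z z) r)%:E))%E.
  by apply: eq_integral => r; rewrite inE/= in_itv/= andbT => r0;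
    rewrite ccE// EFinM.
have ie := integrable_exponential_pdf Qz.
rewrite integralZl//; last by apply: integrableS ie => //; exact: measurable_itv.
rewrite (_ : (\int[mu]_(r in `[0%R, +oo[) (exponential_pdf (- Q z z) r)%:E = 1)%E).
  by rewrite mule1 EFinM -pE.
rewrite -[RHS](integral_exponential_pdf Qz) integral_mkcond;
  apply: eq_integral => r _.
rewrite patchE; case: ifPn => // /negP; rewrite inE/= in_itv/= andbT => /negP;
  rewrite -ltNge => r0.
by rewrite lt0_exponential_pdf.
Qed.

End holding_times.

Section expected_occupation.
Context (R : realType) (X : countType) (Q S : X -> X -> R).
Hypotheses (hQ : symmetric_generator Q) (hS : sign_matrix S).
Context (d : measure_display) (Omega : measurableType d).
Variables (Y : nat -> Omega -> option X) (tau : nat -> {mfun Omega >-> R}).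
Variable PX : X -> probability Omega R.
Hypothesis hX : forall x, process_law Y tau Q x (PX x).
Variable A : {fset X}.
Variable v : X.
Hypothesis vA : v \notin A.
Notation vp := (visit_prob R X S d Omega Y PX).
Notation sv := (signed_visit R X S d Omega Y PX).
Notation mu := (@lebesgue_measure R).
Notation occ s w := (\sum_(0 <= n <oo) (\1_(path_event Y (visit S A n s v)) w *
  tau n w)%:E)%E.

Let tau0 (x0 : X) n w : 0 < tau n w. Proof. by case: (hX x0). Qed.

Let term_ge0 (x0 : X) s n w : (0 <= (\1_(path_event Y (visit S A n s v)) w * tau
  n w)%:E)%E.
Proof. by rewrite lee_fin mulr_ge0// ltW// (tau0 x0). Qed.

Let measurable_term (x0 : X) s n :
  measurable_fun setT (fun w => (\1_(path_event Y (visit S A n s v)) w * tau n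
    w)%:E).
Proof.
apply/measurable_EFinP; apply: measurable_funM => //; apply: measurable_indic.
exact: (measurable_visit _ _ Q S _ _ _ _ _ hX x0).
Qed.

Let measurable_occ (x0 : X) s : measurable_fun setT (fun w => occ s w).
Proof. by apply: ge0_emeasurable_sum => n *; [exact: (term_ge0 x0)|exact:
  (measurable_term x0)]. Qed.

Let vp_cvg x s : cvgn (series (fun n => vp A n s x v)).
Proof.
apply: (@series_le_cvg _ _ (fun n => fine (PX x [set w | Y n w = Some v]))) =>
  [n|n|n|].
- exact: visit_prob_ge0.
- exact: fine_ge0.
- exact: (visit_prob_le _ _ Q S _ _ _ _ _ hX).
- exact: (transient hQ hX).
Qed.

(** Each visit to [v] contributes the mean holding time there. The terms are nonnegative, so the sum
    passes through the integral, and transience makes it finite. *)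
Let integral_occ x s : (\int[PX x]_w occ s w =
  (limn (series (fun n => vp A n s x v)) * (- Q v v)^-1)%:E)%E.
Proof.
rewrite integral_nneseries//; last 2 first.
- exact: (measurable_term x).
- by move=> n w _; exact: (term_ge0 x).
transitivity (\sum_(0 <= n <oo) (vp A n s x v * (- Q v v)^-1)%:E)%E.
  apply: eq_eseriesr => n _.
  rewrite (integral_holding _ _ _ hQ _ _ _ _ _ hX x n _ v (depends_visit _ _ S _
    _ _ _)); last by move=> y [].
  by rewrite (visit_probE _ _ Q S _ _ _ _ _ hX) EFinM.
apply: cvg_lim => //.
rewrite (_ : (fun n => _) = EFin \o (fun n => series (fun n => vp A n s x v) n *
  (- Q v v)^-1)).
  apply: cvg_EFin; first exact: nearW.
  by apply: cvgM; [exact: vp_cvg|exact: cvg_cst].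
by apply/funext => n; rewrite sumEFin /= seriesEnat/= mulr_suml.
Qed.

Let integrable_occ x s : (PX x).-integrable setT (fun w => occ s w).
Proof.
apply/integrableP; split; first exact: (measurable_occ x).
have E : (\int[PX x]_w `|occ s w| = \int[PX x]_w occ s w)%E.
  by apply: eq_integral => w _; rewrite gee0_abs// nneseries_ge0// => n _ _;
    exact: (term_ge0 x).
by rewrite E integral_occ ltry.
Qed.

(** The two signs may be integrated separately because each occupation time has a finite mean. *)
Lemma integral_signed_occupation x :
  (\int[PX x]_w signed_occupation Y tau S A v w =
   (limn (series (fun n => sv A n x v)) * (- Q v v)^-1)%:E)%E.
Proof.
transitivity (\int[PX x]_w (occ 1 w - occ (-1) w))%E.
  apply: eq_integral => w _.
  rewrite (signed_occupationE R X S hS d Omega Y tau A v vA (tau0 x)).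
  by rewrite !(occupied_measure _ _ _ _ _ _ _ _ _ (tau0 x)).
rewrite (integralB measurableT (integrable_occ x 1) (integrable_occ x (-1)))
  !integral_occ.
rewrite -EFinB -mulrBl; congr (_ * _)%:E.
apply/esym/cvg_lim => //.
rewrite (_ : series _ = (fun n => series (fun n => vp A n 1 x v) n - series (fun
  n => vp A n (-1) x v) n)).
  by apply: cvgB; exact: vp_cvg.
by apply/funext => n; rewrite !seriesEnat/= -sumrB.
Qed.

End expected_occupation.

Theorem mainTheorem2 (R : realType) (X : countType) (Q S : X -> X -> R)
    (hQ : symmetric_generator Q) (hS : sign_matrix S)
    (d : measure_display) (Omega : measurableType d)
    (Y : nat -> Omega -> option X) (tau : nat -> {mfun Omega >-> R})
    (PX : X -> probability Omega R)
    (hX : forall x, process_law Y tau Q x (PX x))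
    (d' : measure_display) (Omega' : measurableType d')
    (P : probability Omega' R) (Z : X -> {RV P >-> R})
    (hZ : centered_gaussian_field (Sigma Q S) Z)
    (A : {fset X}) :
  (forall b : X, b \notin A ->
     is_cond_exp P (sigma_of Z A) (Z b)
       (fun w => \sum_(a <- A)
          fine ('E_(PX b)[hit_sign Y tau S A a])%E * Z a w)) /\
  (forall b b' : X, b \notin A -> b' \notin A ->
     let c := (\int[PX b]_w signed_occupation Y tau S A b' w)%E in
     c \is a fin_num /\
     is_cond_cov P (sigma_of Z A) (Z b) (Z b') (fun=> fine c)).
Proof.
have NE := Sigma_normal_equations _ _ _ _ hQ hS _ _ _ _ _ hX A.
split=> [b bA|b b' bA b'A c].
  rewrite (_ : (fun w => _) = (fun w => \sum_(a <- A) hitting_coef R X S d Omega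
    Y PX A b a * Z a w)).
    by apply: (gaussian_cond_exp _ _ _ _ _ _ _ hZ); exact: NE.
  apply/funext => w; rewrite [LHS]big_seq [RHS]big_seq; apply: eq_bigr => a aA.
  by rewrite (expectation_hit_sign _ _ _ _ hS _ _ _ _ _ hX).
have cE : c = (Sigma Q S b b' - \sum_(a <- A) hitting_coef R X S d Omega Y PX A
  b a * Sigma Q S a b')%:E.
  rewrite (Sigma_residual _ _ _ _ hQ hS _ _ _ _ _ hX)//.
  exact: (integral_signed_occupation _ _ _ _ hQ hS _ _ _ _ _ hX).
rewrite cE; split=> //.
by apply: (gaussian_cond_cov _ _ _ _ _ _ _ hZ) => //; exact: NE.
Qed.
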